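(* Let $n\ge2$ and let $\Lambda<\mathrm{M}_n(\mathbb R)$ be a Diophantine lattice that is not of $\mathbb Q$-split type and satisfies the isotropic noncoincidence condition. Then the limit $$c_{\Lambda,\mathrm{iso}}:=\lim_{T\to\infty}T^{-n(n-1)}\,\#\{v\in\Lambda_{\operatorname{iso}}:\|v\|<T\}\ \ge 0$$ exists and is finite. Moreover, $c_{\Lambda,\mathrm{iso}}>0$ if and only if $\Lambda$ contains a rank-$n(n-1)$ submodule on which the determinant vanishes identically.
   Context: A lattice in $\mathrm{M}_n(\mathbb R)$ is a discrete subgroup of full rank $n^2$. $\|\cdot\|$ is a fixed norm on $\mathrm{M}_n(\mathbb R)$ invariant under left and right multiplication by $\mathrm{SO}(n)$. Two discrete subgroups are commensurable if their intersection has finite index in both. $\Lambda$ is of $\mathbb Q$-split type if there exist $g_1,g_2\in\mathrm{GL}_n(\mathbb R)$ such that $\Lambda$ is commensurable with $g_1\mathrm{M}_n(\mathbb Z)g_2$. A subspace $V<\mathrm{M}_n(\mathbb R)$ is $\Lambda$-rational if $\Lambda\cap V$ is a lattice in $V$. Isotropic subspaces. For a $k$-dimensional subspace $\mathsf U<\mathbb R^n$, $1\le k\le n-1$, let $\mathcal L(\mathsf U)$ (resp. $\mathcal R(\mathsf U)$) be the $kn$-dimensional space of matrices all of whose columns (resp. rows) lie in $\mathsf U$; subspaces $\mathcal L(\mathsf U)$ are column-isotropic and $\mathcal R(\mathsf U)$ row-isotropic. $\Lambda_{\operatorname{iso}}:=\bigcup_V(\Lambda\cap V)$, where $V$ ranges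 over all $\Lambda$-rational column- and row-isotropic subspaces. Isotropic noncoincidence. $\mathrm{M}_n(\mathbb R)$ carries the inner product $\langle v,w\rangle=\operatorname{tr}(vw^{\intercal})$. For a $\Lambda$-rational subspace $V$ let $\Lambda_V:=p_{V^\perp}(\Lambda)<V^\perp$, with $p_{V^\perp}$ the orthogonal projection onto $V^\perp$. $\Lambda$ satisfies the column isotropic noncoincidence condition if for every integer $k$ with $\lceil n/2\rceil\le k\le n-2$ there do not exist distinct proper $\Lambda$-rational column-isotropic subspaces $V_1,V_2$, each maximal with respect to inclusion among all proper $\Lambda$-rational column-isotropic subspaces, such that $\dim V_1=\dim V_2=kn$ and, for some $h\in\mathrm{GL}_n(\mathbb R)$, $h\Lambda_{V_1}$ is commensurable with $\Lambda_{V_2}$. The row condition is defined analogously for row-isotropic subspaces with $\Lambda_{V_1}h$ in place of $h\Lambda_{V_1}$. The isotropic noncoincidence condition means both hold. Diophantine lattices. Exterior powers (and iterated exterior powers) of $\mathrm{M}_n(\mathbb R)$ carry the induced inner products and norms. The $\Lambda$-Plücker vector of a $d$-dimensional $\Lambda$-rational $V$ is $\mathsf w_{\Lambda,V}=v_1\wedge\cdots\wedge v_d$, with $v_1,\dots,v_d$ a $\mathbb Z$-basis of $\Lambda\cap V$ (well defined up to sign). Let $H=\mathrm{SL}_n(\mathbb R)\times \mathrm{SL}_n(\mathbb R)$ act on $\mathrm{M}_n(\mathbb R)$ by $(g,h)\cdot v=gvh^{\intercal}$, hence on all exterior powers, and let $H_1=\mathrm{SL}_n(\mathbb R)\times\{e\}$,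 $H_2=\{e\}\times \mathrm{SL}_n(\mathbb R)$. For $1\le k\le n-1$ let $\mathcal M_{k,1}:=(\wedge^{kn}\mathrm{M}_n(\mathbb R))^{H_2}$ and $\mathcal M_{k,2}:=(\wedge^{kn}\mathrm{M}_n(\mathbb R))^{H_1}$ (fixed vectors). The $H$-module $\wedge^{kn}\mathrm{M}_n(\mathbb R)$ is multiplicity-free and decomposes as $\mathcal M_{k,0}\oplus\mathcal M_{k,1}\oplus\mathcal M_{k,2}$, where $\mathcal M_{k,0}$ is the sum of the remaining irreducible summands. For $m=1,2$, $\pi_{k,m}$ is the associated $H$-equivariant projection onto $\mathcal M_{k,m}$, and $\pi_{k,m}^{(r)}:=\wedge^r\pi_{k,m}$. For $\eta>0$, $M>1$, $\Lambda$ is $(\eta,M)$-Diophantine if for every $1\le k\le n-1$, $m\in\{1,2\}$, $r\in\{1,\dim\mathcal M_{k,m}\}$, and every collection $V_1,\dots,V_r$ of $kn$-dimensional $\Lambda$-rational subspaces, the vector $\mathbf w:=\mathsf w_{\Lambda,V_1}\wedge\cdots\wedge\mathsf w_{\Lambda,V_r}\in\wedge^r(\wedge^{kn}\mathrm{M}_n(\mathbb R))$ satisfies, whenever it is nonzero, either $\mathbf w=\pi_{k,m}^{(r)}(\mathbf w)$ or $\|\mathbf w-\pi_{k,m}^{(r)}(\mathbf w)\|>\eta\|\mathbf w\|^{-M}$. $\Lambda$ is Diophantine if it is $(\eta,M)$-Diophantine for some $\eta>0$ and $M>1$. *)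

(* Defs.v *)
From HB Require Import structures.
From mathcomp Require Import all_boot all_order all_algebra finmap.
From mathcomp Require Import all_classical all_reals all_analysis.

Set Implicit Arguments.
Unset Strict Implicit.
Unset Printing Implicit Defensive.

Import Order.TTheory GRing.Theory Num.Theory.
Import numFieldNormedType.Exports.

Local Open Scope classical_set_scope.
Local Open Scope ring_scope.

Definition is_subgroup (W : zmodType) (L : set W) : Prop :=
  L 0 /\ forall x y, L x -> L y -> L (x - y).

Definition cosets (W : zmodType) (B A : set W) : set (set W) :=
  [set [set x + b | b in B] | x in A].

Definition commensurable (W : zmodType) (A B : set W) : Prop :=
  finite_set (cosets (A `&` B) A) /\ finite_set (cosets (A `&` B) B).

Definition Zbasis (W : zmodType) (L : set W) (d : nat) (b : 'I_d -> W) : Prop :=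
  (forall x, L x <-> exists z : 'I_d -> int, x = \sum_i b i *~ z i) /\
  (forall z : 'I_d -> int, \sum_i b i *~ z i = 0 -> forall i, z i = 0).

(* L is free of rank d over the integers. *)
Definition Zrank (W : zmodType) (L : set W) (d : nat) : Prop :=
  exists b : 'I_d -> W, Zbasis L b.

Section Lattices.
Context {R : realType} {n : nat}.
Implicit Types (L : set 'M[R]_n) (V : {vspace 'M[R]_n}).

Definition discrete_subgroup L : Prop := is_subgroup L /\ L `<=` isolated L.

Definition lattice L : Prop := discrete_subgroup L /\ Zrank L (n * n).

Definition rational L V : Prop :=
  discrete_subgroup (L `&` [set` V]) /\ Zrank (L `&` [set` V]) (\dim V).

Definition Qsplit_type L : Prop :=
  exists g1 g2 : 'M[R]_n, [/\ g1 \in unitmx, g2 \in unitmx &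
    commensurable L
      [set g1 *m map_mx intr z *m g2 | z in [set: 'M[int]_n]]].

Record SO_invariant_norm (N : 'M[R]_n -> R) : Prop := {
  norm_eq0 : forall x, N x = 0 -> x = 0;
  norm_scale : forall (a : R) x, N (a *: x) = `|a| * N x;
  norm_triangle : forall x y, N (x + y) <= N x + N y;
  norm_SOl : forall k x, k *m k^T = 1%:M -> \det k = 1 -> N (k *m x) = N x;
  norm_SOr : forall k x, k *m k^T = 1%:M -> \det k = 1 -> N (x *m k) = N x
}.

Definition column_isotropic V : Prop :=
  exists U : {vspace 'cV[R]_n}, (1 <= \dim U <= n - 1)%N /\
    forall A, (A \in V) <-> (forall j, col j A \in U).

Definition row_isotropic V : Prop :=
  exists U : {vspace 'cV[R]_n}, (1 <= \dim U <= n - 1)%N /\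
    forall A, (A \in V) <-> (forall i, (row i A)^T \in U).

Definition Lambda_iso L : set 'M[R]_n :=
  [set v | exists V, [/\ rational L V,
     column_isotropic V \/ row_isotropic V, L v & v \in V]].

(* The image of L under the orthogonal projection to the complement of V, for
   the inner product tr (v w^T): w is the projection of v iff w is orthogonal
   to V and v - w lies in V. *)
Definition proj_perp L V : set 'M[R]_n :=
  [set w | (forall u, u \in V -> \tr (u *m w^T) = 0) /\
           exists2 v, L v & v - w \in V].

Section Noncoincidence.
Variables (isotropic : {vspace 'M[R]_n} -> Prop) (L : set 'M[R]_n).

Definition proper_rational V : Prop :=
  [/\ rational L V, isotropic V & V != fullv].

Definition maximal_rational V : Prop :=
  proper_rational V /\
  forall V', proper_rational V' -> (V <= V')%VS -> V' = V.

End Noncoincidence.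

Definition column_noncoincidence L : Prop :=
  forall k : nat, (uphalf n <= k <= n - 2)%N ->
  ~ exists V1 V2 : {vspace 'M[R]_n},
      [/\ V1 != V2,
          maximal_rational column_isotropic L V1,
          maximal_rational column_isotropic L V2,
          \dim V1 = (k * n)%N /\ \dim V2 = (k * n)%N &
          exists2 h : 'M[R]_n, h \in unitmx &
            commensurable [set h *m v | v in proj_perp L V1] (proj_perp L V2)].

Definition row_noncoincidence L : Prop :=
  forall k : nat, (uphalf n <= k <= n - 2)%N ->
  ~ exists V1 V2 : {vspace 'M[R]_n},
      [/\ V1 != V2,
          maximal_rational row_isotropic L V1,
          maximal_rational row_isotropic L V2,
          \dim V1 = (k * n)%N /\ \dim V2 = (k * n)%N &
          exists2 h : 'M[R]_n, h \in unitmx &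
            commensurable [set v *m h | v in proj_perp L V1] (proj_perp L V2)].

Definition isotropic_noncoincidence L : Prop :=
  column_noncoincidence L /\ row_noncoincidence L.

(* The set being counted is finite for discrete L and a norm N, so fset_set
   does not take its default value. *)
Definition count_iso (N : 'M[R]_n -> R) L (T : R) : nat :=
  #|` fset_set (Lambda_iso L `&` [set v | N v < T])|.

End Lattices.

(* The exterior power of degree d of the space with orthonormal basis
   (e_i)_{i in I} has orthonormal basis (e_S), S ranging over the d-element
   subsets of I, where e_S is the wedge of the e_i, i in S, taken in the order
   of enum I.  A vector is its coordinate function, so that the construction can
   be iterated. *)
Section Exterior.
Context {R : realType}.

Definition extidx (I : finType) (d : nat) : finType :=
  {S : {set I} | #|S| == d}.

Definition elt (I : finType) (d : nat) (S : extidx I d) (j : 'I_d) : I :=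
  enum_val (cast_ord (esym (eqP (valP S))) j).

Definition euclid (I : finType) : vectType R := {ffun I -> R^o}.

Definition ext (I : finType) (d : nat) : vectType R := euclid (extidx I d).

Definition delta (I : finType) (i : I) : euclid I := [ffun k => (k == i)%:R].

(* The coordinates of v_1 /\ ... /\ v_d are the d x d minors. *)
Definition wedge (I : finType) (d : nat) (v : 'I_d -> euclid I) : ext I d :=
  [ffun S => \det (\matrix_(i < d, j < d) (v i (elt S j) : R))].

(* The d-th exterior power of a linear map f, determined by
   e_S |-> f e_{s_1} /\ ... /\ f e_{s_d}. *)
Definition extmap (I J : finType) (d : nat) (f : euclid I -> euclid J)
    (x : ext I d) : ext J d :=
  \sum_S (x S : R) *: wedge (fun j => f (delta (elt S j))).

Definition enorm (I : finType) (x : euclid I) : R :=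
  Num.sqrt (\sum_i (x i : R) ^+ 2).

End Exterior.

Section Diophantine.
Context {R : realType} {n : nat}.

(* The elementary matrices are orthonormal for tr (v w^T). *)
Definition mx_coord (A : 'M[R]_n) : euclid ('I_n * 'I_n)%type :=
  [ffun p => A p.1 p.2].

Definition coord_mx (x : euclid ('I_n * 'I_n)%type) : 'M[R]_n :=
  \matrix_(i, j) x (i, j).

Definition extM (d : nat) : vectType R := ext ('I_n * 'I_n)%type d.

Definition actM (d : nat) (g h : 'M[R]_n) : extM d -> extM d :=
  extmap (fun x => mx_coord (g *m coord_mx x *m h^T)).

Definition H (g h : 'M[R]_n) : Prop := \det g = 1 /\ \det h = 1.
Definition H1 (g h : 'M[R]_n) : Prop := \det g = 1 /\ h = 1%:M.
Definition H2 (g h : 'M[R]_n) : Prop := g = 1%:M /\ \det h = 1.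

Definition is_fixed_space (G : 'M[R]_n -> 'M[R]_n -> Prop) (d : nat)
    (F : {vspace extM d}) : Prop :=
  forall x, (x \in F) <-> (forall g h, G g h -> actM g h x = x).

(* For F the fixed space of H1 or of H2, such a p exists and is unique: its
   kernel is the sum of the irreducible summands not contained in F. *)
Definition is_equivariant_projection (d : nat) (F : {vspace extM d})
    (p : 'End(extM d)) : Prop :=
  [/\ forall x, p x \in F,
      forall x, x \in F -> p x = x &
      forall g h, H g h -> forall x, p (actM g h x) = actM g h (p x)].

Definition is_plucker (L : set 'M[R]_n) (d : nat) (V : {vspace 'M[R]_n})
    (w : extM d) : Prop :=
  exists b : 'I_d -> 'M[R]_n,
    Zbasis (L `&` [set` V]) b /\ w = wedge (fun j => mx_coord (b j)).

(* F is the space M_{k,1} for G = H2 and M_{k,2} for G = H1. *)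
Definition diophantine_with (eta M : R) (L : set 'M[R]_n) : Prop :=
  forall (k : nat) (G : 'M[R]_n -> 'M[R]_n -> Prop)
    (F : {vspace extM (k * n)}) (p : 'End(extM (k * n))) (r : nat)
    (V : 'I_r -> {vspace 'M[R]_n}) (w : 'I_r -> extM (k * n)),
  (1 <= k <= n - 1)%N ->
  G = H2 \/ G = H1 ->
  is_fixed_space G F ->
  is_equivariant_projection F p ->
  r = 1%N \/ r = \dim F ->
  (forall i, rational L (V i) /\ \dim (V i) = (k * n)%N) ->
  (forall i, is_plucker L (V i) (w i)) ->
  let W := wedge w in
  W != 0 ->
  W = extmap p W \/ enorm (W - extmap p W) > eta * (enorm W) `^ (- M).

Definition diophantine (L : set 'M[R]_n) : Prop :=
  exists eta M : R, [/\ 0 < eta, 1 < M & diophantine_with eta M L].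

End Diophantine.

(* Main.v *)
(**
A rational column-isotropic subspace is the space of matrices annihilated on the
left by some matrix p, so the theorem reduces (after transposing for the row case)
to lattice points in such annihilators; maximal annihilators correspond to minimal
row spaces. If infinitely many maximal ones had codimension at least 2n, one of
them would contain an intersection of others, and an exchange argument would give
two of them with commensurable quotient lattices, against noncoincidence. So only
the hyperplane case, p a row vector, contributes in the order T^(n(n-1)).

The image of the lattice under a rational row p is a lattice in R^n. Up to scaling
of p there are finitely many commensurability classes of images, and the p in one
class form a Q-space spanned by R-independent rows p_1, ..., p_j; if j = n the
lattice is of Q-split type, hence j < n. Lattice points annihilated by some p in the
class become integer j x n matrices of rank less than j. Those annihilated by a
primitive integer vector q number O(T^((j-1)n) / |q|^n), and since n > j these
bounds are summable over q: all but a small proportion of the points lie in finitely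
many hyperplanes. For finitely many subspaces the asymptotics follow from counting
lattice points in a norm ball, f(mT) ~ m^d f(T).

For the last equivalence, the determinant vanishes on the real span of the
sublattice, which by Dieudonne's theorem on spaces of singular matrices of maximal
dimension is column- or row-isotropic.
*)

(* The obstacle is uniformity: a class may contain infinitely many rational hyperplanes, so their
   separate asymptotics decide nothing until the tail is bounded. Put j = d + 1. There are O(k^d)
   integer vectors q of sup norm k, each annihilating O((m^d / k)^n) matrices with entries at most
   m. Since n >= d + 2, the product is O(m^(dn) / k^2), and the part k > P is O(m^(dn) / P). A fibre
   over one integer matrix holds O(T^((n-j)n)) lattice points, and (n-j)n + dn = n(n-1). The gain of
   1/k per column needs d independent short vectors in the hyperplane of q; they are found among the
   columns of the counted matrix and the standard basis. The range of k in the noncoincidence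
   condition comes from rank: two distinct minimal rational row spaces meet in 0, and the exchange
   makes their ranks equal, so twice the rank is at most n, while rank 1 is the hyperplane case. The
   limit is the supremum of the densities of finite unions of hyperplanes: finite unions bound the
   count from below, and the tail estimate bounds it from above. *)
Require Import Defs.
From HB Require Import structures.
From mathcomp Require Import all_boot all_order all_algebra finmap.
From mathcomp Require Import all_classical all_reals all_analysis.
From mathcomp Require Import zify ring lra.
Import Order.TTheory GRing.Theory Num.Theory.
Import numFieldNormedType.Exports.
Set Implicit Arguments.
Unset Strict Implicit.
Unset Printing Implicit Defensive.
Local Open Scope classical_set_scope.
Local Open Scope ring_scope.

(** * Cardinality of finite sets *)

Section Cardinal.
Local Open Scope nat_scope.

(** The same expression as in [count_iso]. Since [fset_set] is empty on an infinite set, the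
    comparisons below carry finiteness hypotheses. *)
Definition nb (T : choiceType) (A : set T) : nat := #|` fset_set A|.

Lemma nbS (T : choiceType) (A B : set T) : finite_set B -> A `<=` B -> nb A <= nb B.
Proof.
move=> fB AB; apply: fsubset_leq_card.
by rewrite -fset_set_sub //; apply: sub_finite_set fB.
Qed.

Lemma nbU (T : choiceType) (A B : set T) :
  finite_set A -> finite_set B -> nb (A `|` B) <= nb A + nb B.
Proof. by move=> fA fB; rewrite /nb fset_setU // cardfsU leq_subr. Qed.

Lemma nb_image (T U : choiceType) (f : T -> U) (A : set T) :
  finite_set A -> {in A &, injective f} -> nb (f @` A) = nb A.
Proof.
move=> fA fi; rewrite /nb fset_set_image // card_in_imfset //=.
by move=> x y; rewrite !in_fset_set //; apply: fi.
Qed.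

Lemma finite_fiber (T U : choiceType) (f : T -> U) (A : set T) :
  finite_set (f @` A) -> (forall y, finite_set (A `&` f @^-1` [set y])) ->
  finite_set A.
Proof.
move=> fB fF; apply: sub_finite_set (bigcup_finite fB (fun y _ => fF y)).
by move=> x Ax; exists (f x) => //; exists x.
Qed.

Lemma finite_inj (T U : choiceType) (f : T -> U) (A : set T) (B : set U) :
  finite_set B -> {in A &, injective f} -> (forall x, A x -> B (f x)) ->
  finite_set A.
Proof.
move=> fB fi AB; apply: (@finite_fiber _ _ f).
  by apply: sub_finite_set fB => _ [x Ax <-]; apply: AB.
move=> y; have [->|/set0P[x [Ax fx]]] := eqVneq (A `&` f @^-1` [set y]) set0.
  exact: finite_set0.
apply: sub_finite_set (finite_set1 x) => z [Az fz] /=.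
by apply: fi; rewrite ?inE // fz fx.
Qed.

Lemma nb_inj (T U : choiceType) (f : T -> U) (A : set T) (B : set U) :
  finite_set B -> {in A &, injective f} -> (forall x, A x -> B (f x)) ->
  nb A <= nb B.
Proof.
move=> fB fi AB; have fA := finite_inj fB fi AB.
by rewrite -(nb_image fA fi); apply: nbS => // y [x Ax <-]; apply: AB.
Qed.

Lemma nb_seq (T : choiceType) (s : seq T) : uniq s -> nb [set` s] = size s.
Proof.
move=> us; rewrite /nb (_ : fset_set _ = [fset x in s]%fset).
  by rewrite card_fseq undup_id.
apply/fsetP => x; rewrite in_fset_set ?inE; last exact: finite_seq.
by apply/idP/idP => [/set_mem //|xs]; apply/mem_set.
Qed.

Lemma nb_setT (T : finType) : nb [set: T] = #|T|.
Proof.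
rewrite cardE -(nb_seq (enum_uniq T)); congr nb.
by apply/seteqP; split=> x _ //=; rewrite mem_enum.
Qed.

Lemma nb_setX (T U : choiceType) (A : set T) (B : set U) :
  finite_set A -> finite_set B -> nb (A `*` B) = nb A * nb B.
Proof.
move=> fA fB; rewrite [nb A]/nb [nb B]/nb -(size_allpairs (@pair T U)) -nb_seq.
  congr nb; apply/seteqP; split=> [[x y] [/= Ax By]|[x y] /allpairsP[[x' y']]] /=.
    by apply/allpairsP; exists (x, y); rewrite !in_fset_set // !mem_set.
  rewrite !in_fset_set // => -[/set_mem Ax /set_mem By [-> ->]].
  by split.
by apply: allpairs_uniq => // -[? ?] [? ?].
Qed.

Lemma nb_bigcup (I : eqType) (T : choiceType) (s : seq I) (F : I -> set T) :
  (forall i, i \in s -> finite_set (F i)) ->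
  nb (\bigcup_(i in [set` s]) F i) <= \sum_(i <- s) nb (F i).
Proof.
elim: s => [|i s IHs] fF.
  by rewrite big_nil /nb (_ : \bigcup_(_ in _) _ = set0) ?fset_set0 // -subset0 => x [].
have fi : finite_set (F i) by apply: fF; rewrite mem_head.
have fs j : j \in s -> finite_set (F j) by move=> js; apply: fF; rewrite inE js orbT.
have fU : finite_set (\bigcup_(i in [set` s]) F i).
  by apply: bigcup_finite => //; apply: finite_seq.
rewrite big_cons; apply: leq_trans (leq_add (leqnn _) (IHs fs)).
apply: leq_trans (nbU fi fU); apply: nbS; first by rewrite finite_setU.
move=> x [j /=]; rewrite inE => /orP[/eqP->|js] Fx; first by left.
by right; exists j.
Qed.

Lemma nb_fiber (T U : choiceType) (f : T -> U) (A : set T) (m : nat) :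
  finite_set A -> (forall y, nb (A `&` f @^-1` [set y]) <= m) ->
  nb A <= m * nb (f @` A).
Proof.
move=> fA Am; have fB : finite_set (f @` A) by exact: finite_image.
have ff y : finite_set (A `&` f @^-1` [set y]) by exact: finite_setIl.
have sE : f @` A = [set` fset_set (f @` A)] by rewrite fset_setK.
apply: (@leq_trans (nb (\bigcup_(y in [set` (fset_set (f @` A) : seq U)])
     (A `&` f @^-1` [set y])))).
  apply: nbS; first by apply: bigcup_finite => //; apply: finite_seq.
  move=> x Ax; exists (f x) => //=; rewrite in_fset_set //.
  by apply/mem_set; exists x.
apply: leq_trans (nb_bigcup _) _ => //.
apply: leq_trans (leq_sum _ (fun i _ => Am i)) _.
by rewrite big_const_seq iter_addn_0 count_predT mulnC /nb.
Qed.

End Cardinal.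

(** * Norms *)

Section Norms.
Context {R : realType}.

(** Stated for every module, so that a norm on matrices can be pulled back to row vectors of lattice
    coordinates. *)
Record is_norm (V : lmodType R) (nu : V -> R) : Prop := {
  is_norm_eq0 : forall x, nu x = 0 -> x = 0;
  is_normZ : forall a x, nu (a *: x) = `|a| * nu x;
  is_normD : forall x y, nu (x + y) <= nu x + nu y
}.

Section Theory.
Context {V : lmodType R} {nu : V -> R} (hnu : is_norm nu).

Lemma is_norm0 : nu 0 = 0.
Proof. by rewrite -[0](scale0r (0 : V)) (is_normZ hnu) normr0 mul0r. Qed.

Lemma is_normN x : nu (- x) = nu x.
Proof. by rewrite -scaleN1r (is_normZ hnu) normrN1 mul1r. Qed.

Lemma is_norm_ge0 x : 0 <= nu x.
Proof.
by have := is_normD hnu x (- x); rewrite subrr is_norm0 is_normN; lra.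
Qed.

Lemma is_norm_gt0 x : x != 0 -> 0 < nu x.
Proof.
move=> x0; rewrite lt_def is_norm_ge0 andbT; apply: contra x0 => /eqP.
by move/(is_norm_eq0 hnu)->.
Qed.

Lemma is_normB x y : nu (x - y) <= nu x + nu y.
Proof. by rewrite -[nu y]is_normN; apply: is_normD. Qed.

Lemma is_norm_dist x y : `|nu x - nu y| <= nu (x - y).
Proof.
have := is_normD hnu (x - y) y; have := is_normD hnu (y - x) x.
rewrite !subrK -[nu (y - x)]is_normN opprB ler_norml; lra.
Qed.

Lemma is_norm_sum (I : Type) (s : seq I) (F : I -> V) :
  nu (\sum_(i <- s) F i) <= \sum_(i <- s) nu (F i).
Proof.
elim/big_rec2: _ => [|i y1 y2 _ le12]; first by rewrite is_norm0.
by apply: le_trans (is_normD hnu _ _) _; rewrite lerD2l.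
Qed.

End Theory.

Lemma mx_entry_le (m d : nat) (x : 'M[R]_(m, d)) i j : `|x i j| <= `|x|.
Proof.
rewrite [leRHS]/Num.norm /= mx_normrE; apply/bigmax_geP; right => /=.
by exists (i, j).
Qed.

Lemma mx_norm_le (m d : nat) (x : 'M[R]_(m, d)) c :
  0 <= c -> (forall i j, `|x i j| <= c) -> `|x| <= c.
Proof.
move=> c0 h; rewrite [leLHS]/Num.norm /= mx_normrE; by apply/bigmax_leP; split=> // -[i j] _; apply: h.
Qed.

Lemma is_norm_upper (d : nat) (nu : 'rV[R]_d -> R) : is_norm nu ->
  exists2 C, 0 < C & forall x, nu x <= C * `|x|.
Proof.
move=> hnu; exists (1 + \sum_i nu (delta_mx 0 i)).
  by rewrite ltr_pwDl // sumr_ge0 // => i _; apply: is_norm_ge0.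
move=> x; rewrite {1}(row_sum_delta x); apply: le_trans (is_norm_sum hnu _ _) _.
rewrite mulrDl mul1r; apply: ler_wpDl => //; rewrite mulr_suml.
apply: ler_sum => i _; rewrite (is_normZ hnu) mulrC ler_wpM2l ?is_norm_ge0 //.
exact: mx_entry_le.
Qed.

(** A norm is continuous by the upper bound, so it attains a positive minimum on the compact unit
    sphere of the sup norm. *)
Lemma is_norm_lower (d : nat) (nu : 'rV[R]_d -> R) : is_norm nu ->
  exists2 c, 0 < c & forall x, c * `|x| <= nu x.
Proof.
move=> hnu; have [C C0 hC] := is_norm_upper hnu.
have cnu : continuous nu.
  move=> x A /nbhs_ballP[e /= e0 hA]; apply/nbhs_ballP; exists (C^-1 * e) => /=.
    by rewrite mulr_gt0 ?invr_gt0.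
  move=> y; rewrite mx_norm_ball /ball_ /= => xy; apply: hA => /=.
  apply: le_lt_trans (is_norm_dist hnu _ _) _; apply: le_lt_trans (hC _) _.
  by rewrite -ltr_pdivlMl.
pose A := [set x : 'rV[R]_d | `|x| = 1].
(* The sphere is empty exactly when [d = 0]. *)
have [A0|/set0P A0] := eqVneq A set0.
  exists 1 => // x; have [->|x0] := eqVneq x 0; first by rewrite normr0 mulr0 is_norm_ge0.
  have : A (`|x|^-1 *: x).
    by rewrite /A /= normrZ normfV normr_id mulVf // normr_eq0.
  by rewrite A0.
have cA : compact A.
  apply: bounded_closed_compact.
    exists 1; split; first exact: num_real.
    by move=> M M1 x Ax; apply: le_trans (ltW M1); rewrite -[leRHS]Ax.
  rewrite (_ : A = (fun x : 'rV[R]_d => `|x|) @^-1` [set 1 : R]) //.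
  by apply: closed_comp => [x _|]; [exact: norm_continuous | exact: closed_eq].
have [x0 Ax0 hx0] := EVT_min_rV A0 cA (continuous_subspaceT cnu).
have nx0 : 0 < nu x0.
  apply: is_norm_gt0 => //; apply/eqP => x00; move: Ax0; rewrite inE /A /= x00.
  by rewrite normr0 => /esym/eqP; rewrite oner_eq0.
exists (nu x0) => // x; have [->|xn0] := eqVneq x 0.
  by rewrite normr0 mulr0 is_norm_ge0.
have nx : 0 < `|x| by rewrite normr_gt0.
have := hx0 (`|x|^-1 *: x).
rewrite inE /A /= normrZ normfV normr_id mulVf ?gt_eqF // => /(_ erefl).
by rewrite (is_normZ hnu) normfV normr_id ler_pdivlMl // mulrC.
Qed.

Lemma is_norm_comp (V W : lmodType R) (f : {linear V -> W}) (nu : W -> R) :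
  injective f -> is_norm nu -> is_norm (nu \o f).
Proof.
move=> fi hnu; split=> [x /= /(is_norm_eq0 hnu)|a x|x y] /=.
- by rewrite -(linear0 f) => /fi.
- by rewrite linearZ (is_normZ hnu).
- by rewrite linearD (is_normD hnu).
Qed.

End Norms.

(** * Lattice points in norm balls *)

Section Asymptotics.
Context {R : realType}.

Lemma cvg_pow1D (d : nat) (a : R) : (1 + a * S^-1) ^+ d @[S --> +oo] --> (1 : R).
Proof.
have h : {for (0 : R), continuous (fun x => (1 + a * x) ^+ d)}.
  apply: (@continuous_comp _ _ _ (fun x => 1 + a * x) (fun y => y ^+ d)).
    by apply: cvgD; [exact: cvg_cst | apply: cvgM; [exact: cvg_cst | exact: cvg_id]].
  exact: exprn_continuous.
have {}h : (1 + a * x) ^+ d @[x --> (0 : R)] --> (1 : R).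
  by rewrite -[X in _ --> X](_ : (1 + a * 0) ^+ d = 1) // mulr0 addr0 expr1n.
apply: (cvg_comp (fun S => S^-1) (fun x => (1 + a * x) ^+ d)) h.
apply/cvgrPdist_lt => e e0; near=> S.
have S0 : 0 < S by near: S; apply: nbhs_pinfty_gt; rewrite num_real.
rewrite sub0r normrN gtr0_norm ?invr_gt0 // invf_plt //.
by near: S; apply: nbhs_pinfty_gt; rewrite num_real.
Unshelve. all: by end_near.
Qed.

(* The limit is the infimum of [F (T + C) / T ^ d]. *)
Lemma cvg_almost_homogeneous (F : R -> R) (d : nat) (C : R) : 0 < C ->
  {homo F : x y / x <= y} -> (forall T, 0 < T -> 1 <= F T) ->
  (forall m T, (0 < m)%N -> m%:R ^+ d * F (T - C) <= F (m%:R * T)) ->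
  (forall m T, (0 < m)%N -> F (m%:R * T) <= m%:R ^+ d * F (T + C)) ->
  exists2 l : R, 0 < l & (T ^- d * F T) @[T --> +oo] --> l.
Proof.
move=> C0 Fmono F1 Flo Fhi.
pose hi T := F (T + C) / T ^+ d; pose E := [set hi T | T in [set T : R | 0 < T]].
(* Positive lower bound for [hi]: if [T <= C + 1] then [F >= 1] is enough; otherwise [m], the
   integral part of [T / (C + 1)], is at least [T / (2 * (C + 1))], and [Flo] at [C + 1] gives
   [m ^ d * F 1 <= F (T + C)]. *)
pose dl : R := (2 * (C + 1)) ^- d.
have dl0 : 0 < dl by rewrite invr_gt0 exprn_gt0 // mulr_gt0 // addr_gt0.
have lbE : lbound E dl.
  move=> _ [T /= T0 <-]; rewrite /hi ler_pdivlMr ?exprn_gt0 //.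
  have [TC|CT] := lerP T (C + 1).
    apply: le_trans (F1 _ _); last by rewrite addr_gt0.
    rewrite /dl mulrC ler_pdivrMr ?mul1r; last by rewrite exprn_gt0 //; lra.
    by apply: lerXn2r; rewrite ?nnegrE //; lra.
  pose m := Num.trunc (T / (C + 1)).
  have TC0 : 0 <= T / (C + 1) by rewrite divr_ge0; lra.
  have /andP[m1 m2] := truncn_itv TC0.
  have mpos : (0 < m)%N by rewrite /m truncn_gt0 ler_pdivlMr; lra.
  apply: (@le_trans _ _ (m%:R ^+ d)).
    rewrite /dl mulrC -exprVn -exprMn; apply: lerXn2r; rewrite ?nnegrE.
    - by rewrite divr_ge0; lra.
    - by rewrite ler0n.
    - rewrite ler_pdivrMr; last lra.
      move: m2; rewrite ltr_pdivrMr; last lra.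
      rewrite -/m -natr1 => h.
      have : 1 <= m%:R :> R by rewrite ler1n.
      by move: h; set q := m%:R; nra.
  apply: le_trans (_ : F (m%:R * (C + 1)) <= _).
    apply: le_trans (Flo m (C + 1) mpos).
    by rewrite -{1}[_ ^+ d]mulr1 ler_wpM2l ?exprn_ge0 // F1; lra.
  apply: Fmono; apply: (@le_trans _ _ T); last lra.
  by rewrite -ler_pdivlMr; lra.
have hE : has_inf E by split; [exists (hi 1), 1 => /= | exists dl].
pose l := inf E.
have ll : forall T, 0 < T -> l <= hi T by move=> T T0; apply: ge_inf => //; [case: hE | exists T].
exists l; first by apply: lt_le_trans dl0 _; apply: lb_le_inf => //; case: hE.
apply/cvgrPdist_lt => e e0.
have [_ [T /= T0 <-] hT] := inf_adherent (divr_gt0 e0 (ltr0n _ 2)) hE.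
have hT0 : 0 < hi T by apply: lt_le_trans dl0 _; apply: lbE; exists T.
have up := @cvg_pow1D d T; have lo := @cvg_pow1D d (- C).
have l0 : 0 < l by apply: lt_le_trans dl0 _; apply: lb_le_inf => //; case: hE.
near=> S.
have S0 : 0 < S by near: S; apply: nbhs_pinfty_gt; rewrite num_real.
have SC : C < S by near: S; apply: nbhs_pinfty_gt; rewrite num_real.
have upS : (1 + T * S^-1) ^+ d < 1 + e / 2 / hi T.
  near: S; apply: (cvgr_lt _ up).
  by rewrite ltrDl; do 2!apply: divr_gt0 => //.
have loS : 1 - e / l < (1 - C * S^-1) ^+ d.
  rewrite -[- (C / S)]mulNr; near: S; apply: (cvgr_gt _ lo).
  by rewrite ltrBlDr ltrDl divr_gt0.
(* Upper bound: [S] is rounded up to a multiple [m * T] of the near-minimizer [T], at most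
   [S + T]. *)
have aup : S ^- d * F S <= (1 + T * S^-1) ^+ d * hi T.
  pose m := (Num.trunc (S / T)).+1.
  have ST0 : 0 <= S / T by rewrite divr_ge0 // ltW.
  have /andP[m1 m2] := truncn_itv ST0.
  have SmT : S <= m%:R * T by rewrite -ler_pdivrMr // ltW.
  have mTS : m%:R * T <= S + T.
    by rewrite /m -natr1 mulrDl mul1r lerD2r -ler_pdivlMr.
  apply: (@le_trans _ _ (S ^- d * (m%:R ^+ d * F (T + C)))).
    apply: ler_wpM2l; first by rewrite invr_ge0 exprn_ge0 // ltW.
    exact: le_trans (Fmono _ _ SmT) (Fhi m T isT).
  have -> : F (T + C) = hi T * T ^+ d by rewrite /hi divfK // expf_neq0 ?gt_eqF.
  have -> : S ^- d * (m%:R ^+ d * (hi T * T ^+ d)) = hi T * (m%:R * T / S) ^+ d.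
    by rewrite !exprMn exprVn; ring.
  rewrite [leRHS]mulrC.
  apply: ler_wpM2l; first exact: ltW.
  apply: lerXn2r; rewrite ?nnegrE.
  - by rewrite !mulr_ge0 ?invr_ge0 ?ltW.
  - by rewrite addr_ge0 // mulr_ge0 ?invr_ge0 ?ltW.
  - by rewrite ler_pdivrMr // mulrDl mul1r divfK ?gt_eqF.
(* Lower bound: the infimum is at most [hi (S - C)], whose numerator is [F S]. *)
have alo : (1 - C * S^-1) ^+ d * l <= S ^- d * F S.
  have := ll (S - C); rewrite subr_gt0 => /(_ SC); rewrite /hi subrK ler_pdivlMr; last first.
    by rewrite exprn_gt0 // subr_gt0.
  move=> h; apply: le_trans (ler_wpM2l _ h); last by rewrite invr_ge0 exprn_ge0 ?ltW.
  rewrite -exprVn mulrCA -exprMn mulrBr mulVf ?gt_eqF // [_ * l]mulrC.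
  by rewrite [C / S]mulrC.
have up' : (1 + T * S^-1) ^+ d * hi T < hi T + e / 2.
  by have := upS; rewrite -(ltr_pM2r hT0) mulrDl mul1r divfK ?gt_eqF.
have lo' : l - e < (1 - C * S^-1) ^+ d * l.
  by have := loS; rewrite -(ltr_pM2r l0) mulrBl mul1r divfK ?gt_eqF.
by rewrite -/l in hT; rewrite ltr_norml; apply/andP; split; lra.
Unshelve. all: by end_near.
Qed.

End Asymptotics.


Definition box (d m : nat) : set 'rV[int]_d :=
  [set z : 'rV[int]_d | forall i, (absz (z 0%R i) <= m)%N].

Arguments box : clear implicits.

Lemma box_inj (d m : nat) :
  {in box d m &, injective (fun z : 'rV[int]_d =>
     [ffun i : 'I_d => inord (absz (z 0 i + m%:Z)%R) : 'I_(m * 2).+1])}.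
Proof.
move=> z w; rewrite !inE /= => zb wb /ffunP zw; apply/rowP => i.
have := congr1 val (zw i); rewrite !ffunE /=; move: (zb i) (wb i) => hz hw.
by rewrite !inordK; lia.
Qed.

Lemma finite_box (d m : nat) : finite_set (box d m).
Proof. by apply: finite_inj (@finite_finset _ setT) (@box_inj d m) _. Qed.

Lemma nb_box (d m : nat) : (nb (box d m) <= (m * 2).+1 ^ d)%N.
Proof.
apply: leq_trans (nb_inj (@finite_finset _ setT) (@box_inj d m) _) _ => //.
by rewrite nb_setT card_ffun !card_ord.
Qed.


Lemma euclid_int_inj (q q' : int) (m r r' : nat) : (r < m)%N -> (r' < m)%N ->
  q * m%:Z + r%:Z = q' * m%:Z + r'%:Z -> q = q' /\ r = r'.
Proof.
move=> rm rm'; have dE (x : int) (s : nat) : (s < m)%N -> ((x * m%:Z + s%:Z) %/ m)%Z = x.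
  by move=> sm; rewrite divzMDl ?divz_small ?addr0 //; lia.
move=> h; have := congr1 (fun x => (x %/ m)%Z) h; rewrite !dE // => qq.
by split=> //; move: h; rewrite qq => /addrI [].
Qed.

Section LatticeCount.
Context {R : realType}.

Definition real_row (d : nat) (z : 'rV[int]_d) : 'rV[R]_d := map_mx intr z.

Section Norm.
Context {d : nat} (nu : 'rV[R]_d -> R) (hnu : is_norm nu).

Definition zball (T : R) : set 'rV[int]_d := [set z | nu (real_row z) < T].

Lemma zball_box (c : R) T m : 0 < c -> (forall x, c * `|x| <= nu x) ->
  T <= c * m%:R -> zball T `<=` box d m.
Proof.
move=> c0 hc Tm z /= zT i.
have : c * `|(z 0 i)%:~R| < c * m%:R :> R.
  apply: lt_le_trans Tm; apply: le_lt_trans zT; apply: le_trans (hc _).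
  rewrite ler_pM2l //; have := mx_entry_le (real_row z) 0 i.
  by rewrite mxE.
rewrite ltr_pM2l // -intr_norm pmulrn ltr_int; lia.
Qed.

Lemma finite_zball T : finite_set (zball T).
Proof.
have [c c0 hc] := is_norm_lower hnu.
apply: sub_finite_set (finite_box d (Num.trunc (T / c)).+1).
apply: zball_box hc _ => //; rewrite mulrC -ler_pdivrMr //.
have [Tc0|Tc0] := lerP 0 (T / c); last by apply: le_trans (ltW Tc0) _.
by have /andP[_ /ltW] := truncn_itv Tc0.
Qed.

Definition zcount T : nat := nb (zball T).

Lemma zcount_ge1 T : 0 < T -> (1 <= zcount T)%N.
Proof.
move=> T0; rewrite -[1%N](@nb_seq _ [:: 0 : 'rV[int]_d]) //.
apply: nbS; first exact: finite_zball.
move=> z /=; rewrite inE => /eqP ->; rewrite /zball /= (_ : real_row 0 = 0).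
  by rewrite is_norm0.
by apply/rowP => i; rewrite !mxE.
Qed.

Lemma zcountS T T' : T <= T' -> (zcount T <= zcount T')%N.
Proof.
move=> TT; apply: nbS; first exact: finite_zball.
by move=> z /= zT; apply: lt_le_trans TT.
Qed.

Lemma real_row_euclid (m : nat) (q : 'rV[int]_d) (r : {ffun 'I_d -> 'I_m}) :
  real_row (\row_i (q 0 i * m%:Z + (r i)%:Z)) =
  m%:R *: real_row q + real_row (\row_i (r i)%:Z).
Proof.
by apply/rowP => i; rewrite !mxE rmorphD rmorphM /= mulrC -!pmulrn.
Qed.

Lemma nu_digits (C : R) (m : nat) (r : {ffun 'I_d -> 'I_m}) : 0 < C ->
  (forall x, nu x <= C * `|x|) -> nu (real_row (\row_i (r i)%:Z)) <= m%:R * C.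
Proof.
move=> C0 hC; apply: le_trans (hC _) _; rewrite [leRHS]mulrC ler_pM2l //.
apply: mx_norm_le => // i j; rewrite !mxE -pmulrn normr_nat ler_nat.
exact: ltnW.
Qed.

(** Entrywise Euclidean division by [m] writes an integer vector as [m q + r] with digits [r] below
    [m]. The norm of [r] is at most [m C], so passing between [q] and [m q + r] costs at most [C] in
    the radius; there are [m ^ d] choices of [r]. *)
Lemma zcount_scale (C : R) (m : nat) T : (0 < m)%N -> 0 < C ->
    (forall x, nu x <= C * `|x|) ->
  (m ^ d * zcount (T - C) <= zcount (m%:R * T))%N /\
  (zcount (m%:R * T) <= m ^ d * zcount (T + C))%N.
Proof.
move=> m0 C0 hC; have mR : 0 < m%:R :> R by rewrite ltr0n.
have cE : nb [set: {ffun 'I_d -> 'I_m}] = (m ^ d)%N.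
  by rewrite nb_setT card_ffun !card_ord.
rewrite -cE -!nb_setX //; try exact: finite_zball; try exact: finite_finset.
split.
  apply: (@nb_inj _ _ (fun p : {ffun 'I_d -> 'I_m} * 'rV[int]_d =>
     \row_i (p.2 0 i * m%:Z + (p.1 i)%:Z))).
  - exact: finite_zball.
  - move=> [r q] [r' q'] _ _ /= /rowP h.
    have hq i : q 0 i = q' 0 i /\ r i = r' i.
      have := h i; rewrite !mxE => {}h; have := ltn_ord (r i); have := ltn_ord (r' i).
      move=> h1 h2; have [] := euclid_int_inj h2 h1 h; split=> //.
      exact: val_inj.
    by congr pair; [apply/ffunP => i | apply/rowP => i]; case: (hq i).
  - move=> [r q] [_ /= qT]; rewrite /zball /= real_row_euclid.
    apply: le_lt_trans (is_normD hnu _ _) _; rewrite (is_normZ hnu) normr_nat.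
    have := nu_digits r C0 hC; have : m%:R * nu (real_row q) < m%:R * (T - C).
      by rewrite ltr_pM2l.
    by lra.
pose dig (z : 'rV[int]_d) := [ffun i => Ordinal (ltn_pmod (absz (modz (z 0 i) m)) m0)].
pose quo (z : 'rV[int]_d) := \row_i divz (z 0 i) m.
have zE z : z = \row_i (quo z 0 i * m%:Z + (dig z i)%:Z).
  apply/rowP => i; rewrite !mxE ffunE /= modn_small.
    by rewrite gez0_abs ?modz_ge0 -?divz_eq //; lia.
  by rewrite -ltz_nat gez0_abs ?modz_ge0 ?ltz_pmod //; lia.
apply: (@nb_inj _ _ (fun z => (dig z, quo z))).
- by apply: finite_setX; [exact: finite_finset | exact: finite_zball].
- by move=> z w _ _ [hd hq]; rewrite (zE z) (zE w) hd hq.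
- move=> z /= zT; split=> //=.
  have : m%:R * nu (real_row (quo z)) < m%:R * (T + C).
    have -> : m%:R * nu (real_row (quo z)) = nu (m%:R *: real_row (quo z)).
      by rewrite (is_normZ hnu) normr_nat.
    have -> : m%:R *: real_row (quo z) = real_row z - real_row (\row_i (dig z i)%:Z).
      by have := real_row_euclid (quo z) (dig z); rewrite -zE => ->; rewrite addrK.
    apply: le_lt_trans (is_normB hnu _ _) _; have := nu_digits (dig z) C0 hC.
    have {}zT : nu (real_row z) < m%:R * T := zT.
    by lra.
  by rewrite ltr_pM2l.
Qed.

Lemma zcount_cvg :
  exists2 l : R, 0 < l & (T ^- d * (zcount T)%:R) @[T --> +oo] --> l.
Proof.
have [C C0 hC] := is_norm_upper hnu.
apply: (@cvg_almost_homogeneous _ (fun T => (zcount T)%:R) d C) => //.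
- by move=> x y xy; rewrite ler_nat zcountS.
- by move=> T T0; rewrite ler1n zcount_ge1.
- move=> m T m0; rewrite -natrX -natrM ler_nat.
  by case: (zcount_scale T m0 C0 hC).
- move=> m T m0; rewrite -natrX -natrM ler_nat.
  by case: (zcount_scale T m0 C0 hC).
Qed.

End Norm.

End LatticeCount.

(** * Real independence of integral bases of discrete groups, and counting in them *)

Section Independence.
Context {R : realType}.

Definition indep (W : lmodType R) (d : nat) (b : 'I_d -> W) : Prop :=
  forall x : 'I_d -> R, \sum_i x i *: b i = 0 -> forall i, x i = 0.

(* Dirichlet's argument: among the multiples of a real relation [sum x_i b_i = 0]
   with [x_k = 1], two have fractional parts so close that the difference of
   their integral parts gives a nonzero lattice vector near 0. *)
Lemma discrete_Zbasis_indep (p q : nat) (L : set 'M[R]_(p, q)) d (b : 'I_d -> 'M[R]_(p, q)) :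
  L 0 -> L `<=` isolated L -> Zbasis L b -> indep b.
Proof.
move=> L0 Liso [Lb bZ] x xb k; apply/eqP; apply: contraT => xk.
have [_ [V /nbhs_ballP[e /= e0 eV] VL]] := Liso _ L0.
have small v : L v -> `|v| < e -> v = 0.
  move=> Lv ve; have : (V `&` L) v.
    by split=> //; apply: eV; rewrite mx_norm_ball /ball_ /= sub0r normrN.
  by rewrite VL.
pose y i := x i / x k.
have yk : y k = 1 by rewrite /y divff.
have yb : \sum_i y i *: b i = 0.
  transitivity ((x k)^-1 *: \sum_i x i *: b i); last by rewrite xb scaler0.
  by rewrite scaler_sumr; apply: eq_bigr => i _; rewrite scalerA mulrC.
pose S : R := 1 + \sum_i `|b i|.
have S0 : 0 < S by rewrite ltr_pwDl // sumr_ge0.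
(* Cells of side [1 / K] are fine enough that two multiples in one cell differ by a lattice vector
   of norm below [e]; there are [K ^ d] cells for [K ^ d + 1] multiples. *)
pose K := (Num.trunc (S / e)).+1.
have SK : S / K%:R < e.
  rewrite ltr_pdivrMr ?ltr0n // mulrC -ltr_pdivrMr //.
  by have /andP[] := truncn_itv (ltW (divr_gt0 S0 e0)).
pose fr (m : nat) i : R := m%:R * y i - (Num.floor (m%:R * y i))%:~R.
have fr0 m i : 0 <= fr m i by rewrite subr_ge0 floor_le.
have fr1 m i : fr m i < 1.
  by have /andP[_] := floor_itv (m%:R * y i); rewrite intrD /fr; lra.
have frK m i : (Num.trunc (K%:R * fr m i) < K)%N.
  rewrite truncn_lt_nat ?mulr_ge0 //; have := fr1 m i.
  by rewrite -{2}[K%:R]mulr1 ltr_pM2l ?ltr0n.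
pose cell (m : 'I_(K ^ d).+1) : {ffun 'I_d -> 'I_K} := [ffun i => Ordinal (frK m i)].
have : ~ injective cell.
  by move/leq_card; rewrite card_ffun !card_ord ltnn.
move/existsNP => [m1 /existsNP[m2 /not_implyP[/ffunP cm /eqP m12]]].
pose z i := Num.floor (m1%:R * y i) - Num.floor (m2%:R * y i).
(* As [y k = 1], the coefficient of index [k] is [m1 - m2], so the small vector cannot be the
   trivial combination. *)
have zk : z k != 0.
  have fl (m : nat) : Num.floor (m%:R : R) = m by rewrite -[m%:R]/(m%:Z%:~R) intrKfloor.
  by rewrite /z yk !mulr1 !fl subr_eq0 eqz_nat.
have zE : \sum_i b i *~ z i = \sum_i (fr m2 i - fr m1 i) *: b i.
  have -> : \sum_i b i *~ z i = \sum_i b i *~ z i - (m1%:R - m2%:R) *: \sum_i y i *: b i.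
    by rewrite yb scaler0 subr0.
  rewrite scaler_sumr -sumrB; apply: eq_bigr => i _.
  rewrite -scaler_int scalerA -scalerBl; congr (_ *: _).
  by rewrite /z /fr intrB; ring.
have Lz : L (\sum_i b i *~ z i) by apply/Lb; exists z.
have := bZ z (small _ Lz _) k => h; move: zk; rewrite h ?eqxx //.
rewrite zE; apply: le_lt_trans SK; apply: le_trans (ler_norm_sum _ _ _) _.
rewrite /S mulrDl mul1r mulr_suml; apply: ler_wpDl; first by rewrite invr_ge0.
apply: ler_sum => i _; rewrite normrZ mulrC ler_wpM2l //.
have := congr1 val (cm i); rewrite !ffunE /= => tE.
have K0 : 0 < K%:R :> R by rewrite ltr0n.
have t1 := truncn_itv (mulr_ge0 (ltW K0) (fr0 m1 i)).
have t2 := truncn_itv (mulr_ge0 (ltW K0) (fr0 m2 i)).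
rewrite tE in t1; move: t1 t2 => /andP[a1 a2] /andP[a3 a4].
rewrite -(ler_pM2l K0) divff ?gt_eqF // -[X in X * _]gtr0_norm // -normrM ler_norml mulrBr.
by move: a2 a4; rewrite -natr1 => a2 a4; apply/andP; split; lra.
Qed.

Section Count.
Context {W : lmodType R} {N : W -> R} (hN : is_norm N).
Context {d : nat} {b : 'I_d -> W} (hb : indep b) {L : set W} (Lb : Zbasis L b).

Lemma is_norm_coords : is_norm (fun x : 'rV[R]_d => N (\sum_i x 0 i *: b i)).
Proof.
split=> [x /(is_norm_eq0 hN)/hb h|a x|x y].
- by apply/rowP => i; rewrite mxE h.
- rewrite -(is_normZ hN) scaler_sumr; congr N; apply: eq_bigr => i _.
  by rewrite mxE scalerA.
- apply: le_trans (is_normD hN _ _); rewrite -big_split le_eqVlt; apply/orP; left.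
  by apply/eqP; congr N; apply: eq_bigr => i _; rewrite mxE scalerDl.
Qed.

Let nu (x : 'rV[R]_d) := N (\sum_i x 0 i *: b i).
Let g (z : 'rV[int]_d) := \sum_i b i *~ z 0 i.

Let gE z : N (g z) = nu (real_row z).
Proof. by congr N; apply: eq_bigr => i _; rewrite mxE scaler_int. Qed.

Let gball T : L `&` [set v | N v < T] = g @` zball nu T.
Proof.
apply/seteqP; split=> [v [/(Lb.1)[z ->] vT]|_ [z zT <-]].
  have gz : g (\row_i z i) = \sum_i b i *~ z i by rewrite /g; apply: eq_bigr => i _; rewrite mxE.
  by exists (\row_i z i); rewrite // /zball /= -gE gz.
by split; [apply/(Lb.1); exists (fun i => z 0 i) | rewrite /= gE].
Qed.

Let g_inj : injective g.
Proof.
move=> z w /eqP; rewrite -subr_eq0 -sumrB => /eqP h; apply/rowP => i; apply/eqP.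
rewrite -subr_eq0; apply/eqP; apply: (Lb.2 (fun i => z 0 i - w 0 i)).
by apply: etrans h; apply: eq_bigr => j _; rewrite mulrzBr.
Qed.

Lemma finite_lattice_ball T : finite_set (L `&` [set v | N v < T]).
Proof. by rewrite gball; apply/finite_image/finite_zball/is_norm_coords. Qed.

Lemma lattice_count : exists2 l : R, 0 < l &
  (T ^- d * (nb (L `&` [set v | N v < T]))%:R) @[T --> +oo] --> l.
Proof.
have [l l0 hl] := zcount_cvg is_norm_coords; exists l => //.
rewrite (_ : (fun T => _) = (fun T => T ^- d * (zcount nu T)%:R)) //.
apply/funext => T; rewrite gball nb_image //.
  exact/finite_zball/is_norm_coords.
by move=> z w _ _ /g_inj.
Qed.

End Count.

End Independence.

(** * Rational subspaces *)

Lemma common_denominator (I : finType) (F : I -> rat) :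
  exists2 d : nat, (0 < d)%N & forall i, exists z : int, F i * d%:R = z%:~R.
Proof.
exists (\prod_i `|denq (F i)|)%N; first by rewrite prodn_gt0 // => i; rewrite absz_gt0 denq_eq0.
move=> i; exists (numq (F i) * (\prod_(j | j != i) `|denq (F j)|)%N%:Z).
rewrite (bigD1 i) //= natrM mulrA intrM numqE; congr (_ * _ * _).
by rewrite pmulrn abszE gtr0_norm ?denq_gt0.
Qed.

Lemma common_denominator_mx (p q : nat) (S : 'M[rat]_(p, q)) :
  exists2 d : nat, (0 < d)%N & exists M : 'M[int]_(p, q), d%:R *: S = map_mx intr M.
Proof.
have [d d0 /choice[z hz]] := common_denominator (fun i : 'I_p * 'I_q => S i.1 i.2).
exists d => //; exists (\matrix_(i, j) z (i, j)).
by apply/matrixP => i j; rewrite !mxE mulrC (hz (i, j)).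
Qed.

Section RationalStructure.
Context {R : realType} {n : nat}.

Lemma map_ratr_int (p q : nat) (M : 'M[int]_(p, q)) :
  map_mx ratr (map_mx intr M : 'M[rat]_(p, q)) = map_mx intr M :> 'M[R]_(p, q).
Proof. by apply/matrixP => i j; rewrite !mxE ratr_int. Qed.

Context {L : set 'M[R]_n} (b : 'I_(n * n) -> 'M[R]_n).
Context (dL : discrete_subgroup L) (hb : indep b) (Lb : Zbasis L b).

Definition basis_mx : 'M[R]_(n * n) := \matrix_i mxvec (b i).

Lemma row_comb (x : 'rV[R]_(n * n)) : vec_mx (x *m basis_mx) = \sum_i x 0 i *: b i.
Proof.
rewrite mulmx_sum_row linear_sum; apply: eq_bigr => i _.
by rewrite linearZ /= rowK mxvecK.
Qed.

Lemma basis_mx_unit : basis_mx \in unitmx.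
Proof.
rewrite -row_free_unit; apply: inj_row_free => x xB; apply/rowP => i; rewrite mxE.
by apply: hb; rewrite -row_comb xB linear0.
Qed.

Definition coords (A : 'M[R]_n) : 'rV[R]_(n * n) := mxvec A *m invmx basis_mx.
Definition of_coords (x : 'rV[R]_(n * n)) : 'M[R]_n := vec_mx (x *m basis_mx).

Lemma coordsK : cancel coords of_coords.
Proof. by move=> A; rewrite /of_coords mulmxKV ?basis_mx_unit // mxvecK. Qed.

Lemma of_coordsK : cancel of_coords coords.
Proof. by move=> x; rewrite /coords vec_mxK mulmxK ?basis_mx_unit. Qed.

Fact coords_is_linear : linear coords.
Proof. by move=> a A B; rewrite /coords linearP mulmxDl scalemxAl. Qed.
HB.instance Definition _ := GRing.isLinear.Build R 'M[R]_n 'rV[R]_(n * n) _ coords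
  coords_is_linear.

Fact of_coords_is_linear : linear of_coords.
Proof. by move=> a A B; rewrite /of_coords mulmxDl -scalemxAl linearP. Qed.
HB.instance Definition _ := GRing.isLinear.Build R 'rV[R]_(n * n) 'M[R]_n _ of_coords
  of_coords_is_linear.

Lemma latticeP A : L A <-> exists z : 'rV[int]_(n * n), coords A = real_row z.
Proof.
split=> [/(Lb.1)[z ->]|[z zE]].
  exists (\row_i z i); rewrite -[RHS]of_coordsK; congr coords.
  by rewrite /of_coords row_comb; apply: eq_bigr => i _; rewrite !mxE scaler_int.
apply/(Lb.1); exists (fun i => z 0 i); rewrite -[LHS]coordsK zE /of_coords row_comb.
by apply: eq_bigr => i _; rewrite !mxE scaler_int.
Qed.

(** Rationality as linear algebra: in lattice coordinates, [V] is the row space of a rational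
    matrix. Sums and intersections of row spaces commute with the extension from [rat] to [R], which
    gives both closure properties at once. *)
Definition rational_space (V : {vspace 'M[R]_n}) :=
  exists S : 'M[rat]_(n * n), forall A, (A \in V) = (coords A <= map_mx ratr S)%MS.

Lemma rational_spaceI (V W : {vspace 'M[R]_n}) :
  rational_space V -> rational_space W -> rational_space (V :&: W)%VS.
Proof.
move=> [S hS] [T hT]; exists (S :&: T)%MS => A.
by rewrite memv_cap hS hT map_capmx sub_capmx.
Qed.

Lemma rational_spaceD (V W : {vspace 'M[R]_n}) :
  rational_space V -> rational_space W -> rational_space (V + W)%VS.
Proof.
move=> [S hS] [T hT]; exists (S + T)%MS => A; rewrite map_addsmx; apply/idP/idP.
  move=> /memv_addP[B BV [C CW ->]]; rewrite linearD; apply: addmx_sub_adds.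
    by rewrite -hS.
  by rewrite -hT.
move=> /sub_addsmxP[[x y] /= h].
rewrite -[A]coordsK h linearD; apply: memv_add; rewrite ?hS ?hT of_coordsK submxMl //.
Qed.

Lemma sub_discrete_subgroup (V : {vspace 'M[R]_n}) : discrete_subgroup (L `&` [set` V]).
Proof.
case: dL => [[L0 LB] Liso]; split.
  by split=> [|x y [Lx Vx] [Ly Vy]]; split; rewrite /= ?mem0v //; [apply: LB | apply: rpredB].
move=> x [Lx Vx]; have [_ [U Ux UL]] := Liso _ Lx; split; first by rewrite inE.
exists U => //; apply/seteqP; split=> [y [Uy [Ly Vy]]|y ->].
  by rewrite -UL.
by have [? ?] : (U `&` L) x by rewrite UL.
Qed.

Lemma free_indep d (c : 'I_d -> 'M[R]_n) : indep c -> free [tuple c i | i < d].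
Proof.
move=> ci; apply/freeP => k h i; apply: (ci k); rewrite -[RHS]h.
by apply: eq_bigr => j _; rewrite (nth_map j) ?size_enum_ord // nth_ord_enum.
Qed.

Lemma Zbasis_mem (A : set 'M[R]_n) d (c : 'I_d -> 'M[R]_n) i : Zbasis A c -> A (c i).
Proof.
move=> [hc _]; apply/hc; exists (fun j => (j == i)%:Z); rewrite (bigD1 i) //= eqxx mulr1z.
by rewrite big1 ?addr0 // => j /negbTE ->; rewrite mulr0z.
Qed.

Lemma rational_basis (V : {vspace 'M[R]_n}) : Defs.rational L V ->
  exists c : 'I_(\dim V) -> 'M[R]_n, [/\ Zbasis (L `&` [set` V]) c, indep c,
    forall i, c i \in V &
    forall A, A \in V -> exists x : 'I_(\dim V) -> R, A = \sum_i x i *: c i].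
Proof.
move=> [[[L0 LB] Liso] [c cZ]]; have ci := discrete_Zbasis_indep L0 Liso cZ.
have cV i : c i \in V by have [] := Zbasis_mem i cZ.
exists c; split=> // A AV.
have bV : basis_of V [tuple c i | i < \dim V].
  rewrite basisEfree free_indep // size_tuple leqnn andbT; apply/span_subvP => v.
  by move=> /mapP[i _ ->].
exists (fun i => coord [tuple c i | i < \dim V] i A).
rewrite {1}(coord_basis bV AV); apply: eq_bigr => i _.
by rewrite (nth_map i) ?size_enum_ord // nth_ord_enum.
Qed.

Lemma rational_span d (c : 'I_d -> 'M[R]_n) (V : {vspace 'M[R]_n}) :
  (forall i, L (c i)) -> (forall i, c i \in V) ->
  (forall A, A \in V -> exists x : 'I_d -> R, A = \sum_i x i *: c i) -> rational_space V.
Proof.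
move=> cL cV cs.
have /choice[z hz] : forall i, exists z : 'rV[int]_(n * n), coords (c i) = real_row z.
  by move=> i; apply/latticeP.
pose S : 'M[rat]_(d, n * n) := \matrix_i map_mx intr (z i).
have rS i : row i (map_mx ratr S) = coords (c i).
  by rewrite hz -map_row rowK map_ratr_int.
exists (<<S>>%MS) => A; rewrite map_genmx genmxE; apply/idP/idP.
  move=> /cs[x ->]; rewrite linear_sum; apply: summx_sub => i _.
  by rewrite linearZ /= scalemx_sub // -rS row_sub.
move=> /submxP[x hx]; rewrite -[A]coordsK hx mulmx_sum_row linear_sum rpred_sum //.
by move=> i _; rewrite linearZ /= rpredZ // rS coordsK.
Qed.

(** A basis of [L] in [V] has integral coordinates and hence spans a rational row space. Conversely,
    take an integral matrix spanning [V] and its Smith form [Lm D Rm]: the rows of the unimodular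
    [Rm] facing nonzero invariant factors are a real basis of [V], and integral vectors of [V] have
    integral coefficients in it because [invmx Rm] is integral. *)
Lemma rational_spaceP (V : {vspace 'M[R]_n}) : Defs.rational L V <-> rational_space V.
Proof.
split=> [/rational_basis[c [cZ ci cV cs]]|[S hS]].
  by apply: rational_span cs => // i; have [] := Zbasis_mem i cZ.
have [dd d0 [M hM]] := common_denominator_mx S.
have eqM : (map_mx ratr S :=: (map_mx intr M : 'M[R]_(n * n)))%MS.
  rewrite -map_ratr_int -hM map_mxZ; apply: eqmx_sym; apply: eqmx_scale.
  by rewrite fmorph_eq0 pnatr_eq0 -lt0n.
have [Lm Lu [Rm Ru [ds _ ME]]] := int_Smith_normal_form M.
(* Indices of the nonzero invariant factors. *)
pose J := [pred j : 'I_(n * n) | ds`_j != 0].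
pose iR (p q : nat) (X : 'M[int]_(p, q)) : 'M[R]_(p, q) := map_mx intr X.
have Mt p q r (X : 'M[int]_(p, q)) (Y : 'M[int]_(q, r)) : iR _ _ (X *m Y) = iR _ _ X *m iR _ _ Y.
  by rewrite /iR map_mxM.
have iu (X : 'M[int]_(n * n)) : X \in unitmx -> iR _ _ X \in unitmx /\
    iR _ _ (invmx X) = invmx (iR _ _ X).
  move=> Xu; have e1 : iR _ _ (invmx X) *m iR _ _ X = 1%:M by rewrite -Mt mulVmx // /iR map_mx1.
  have Xu' : iR _ _ X \in unitmx by case: (mulmx1_unit e1).
  by split=> //; rewrite -[LHS](mulmxK Xu') e1 mul1mx.
have [Lu' _] := iu _ Lu; have [Ru' Rv] := iu _ Ru.
pose c (k : 'I_#|J|) := of_coords (row (enum_val k) (iR _ _ Rm)).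
have cV k : c k \in V.
  rewrite hS of_coordsK eqM -/(iR _ _ M) ME !Mt.
  set j := enum_val k; have Jj : ds`_j != 0 by have := enum_valP k.
  have -> : row j (iR _ _ Rm) = ((ds`_j)%:~R : R)^-1 *: (delta_mx 0 j *m invmx (iR _ _ Lm)) *m
     (iR _ _ Lm *m iR _ _ (\matrix_(i, j) (ds`_i *+ (i == j :> nat))) *m iR _ _ Rm).
    have dD : delta_mx (0 : 'I_1) j *m iR _ _ (\matrix_(i, j) (ds`_i *+ (i == j :> nat))) =
        ((ds`_j)%:~R : R) *: delta_mx 0 j.
      rewrite -rowE; apply/rowP => l; rewrite !mxE eqxx [l == j]eq_sym -val_eqE /=.
      by case: eqP => _; rewrite ?mulr0 ?mulr1.
    rewrite -!scalemxAl !mulmxA mulmxKV // dD -scalemxAl scalerA mulVf ?intr_eq0 //.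
    by rewrite scale1r -rowE.
  exact: submxMl.
have wJ A : A \in V -> forall j, ~~ J j -> (coords A *m invmx (iR _ _ Rm)) 0 j = 0.
  rewrite hS eqM -/(iR _ _ M) ME !Mt => /submxP[x ->] j /=; rewrite negbK => /eqP dj.
  rewrite -!mulmxA mulmxV // mulmx1 mulmxA mxE big1 // => i _; rewrite !mxE.
  by case: eqVneq => [->|]; rewrite ?dj ?mul0rn ?mulr0n mulr0.
have cE A : A \in V -> A = \sum_k (coords A *m invmx (iR _ _ Rm)) 0 (enum_val k) *: c k.
  move=> AV; rewrite -[LHS]coordsK -[in LHS](mulmxKV Ru' (coords A)) mulmx_sum_row.
  rewrite linear_sum /= (bigID J) /= [X in _ + X]big1 ?addr0; last first.
    by move=> j Jj; rewrite wJ // scale0r linear0.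
  rewrite (eq_bigl [in J]) // big_enum_val /=.
  by apply: eq_bigr => k _; rewrite linearZ.
have cind : indep c.
  move=> x xc k.
  have h : (\sum_k x k *: delta_mx 0 (enum_val k : 'I_(n * n))) *m iR _ _ Rm = 0 :> 'rV[R]_(n * n).
    apply: (@etrans _ _ (coords (\sum_i x i *: c i))); last by rewrite xc linear0.
    rewrite [RHS]linear_sum mulmx_suml; apply: eq_bigr => i _.
    by rewrite linearZ /c /= of_coordsK -scalemxAl -rowE.
  have {}h : \sum_k x k *: delta_mx 0 (enum_val k : 'I_(n * n)) = 0 :> 'rV[R]_(n * n).
    by rewrite -[LHS](mulmxK Ru') h mul0mx.
  have := congr1 (fun v : 'rV[R]_(n * n) => v 0 (enum_val k)) h.
  rewrite summxE (bigD1 k) //= !mxE !eqxx mulr1 big1 ?addr0 // => i ik.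
  by rewrite !mxE eqxx /= (inj_eq enum_val_inj) eq_sym (negbTE ik) mulr0.
have dV : \dim V = #|J|.
  have bV : basis_of V [tuple c i | i < #|J|].
    rewrite /basis_of free_indep // andbT eqEsubv; apply/andP; split.
      by apply/span_subvP => v /mapP[i _ ->].
    apply/subvP => A AV; rewrite (cE _ AV) rpred_sum // => i _; rewrite rpredZ //.
    by apply: memv_span; apply/mapP; exists i => //; rewrite mem_enum.
  exact: size_basis bV.
split; first exact: sub_discrete_subgroup.
rewrite dV; exists c; split.
  move=> A; split=> [[/latticeP[z zE] AV]|[z ->]].
    exists (fun k => (z *m invmx Rm) 0 (enum_val k)); rewrite {1}(cE _ AV).
    apply: eq_bigr => k _; rewrite zE -[real_row z]/(iR _ _ z) -Rv -Mt mxE.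
    by rewrite scaler_int.
  split; last by rewrite /= rpred_sum // => k _; rewrite rpredMz.
  apply/latticeP; exists (\sum_k z k *: row (enum_val k) Rm).
  rewrite linear_sum /real_row raddf_sum; apply: eq_bigr => k _.
  by rewrite -scaler_int linearZ /= /c of_coordsK -map_row map_mxZ.
move=> z h k; have := cind (fun k => (z k)%:~R) _ k; move=> /(_ _)/eqP.
rewrite intr_eq0 => hz; apply/eqP/hz; rewrite -[RHS]h; apply: eq_bigr => i _.
by rewrite scaler_int.
Qed.

End RationalStructure.

(** * Column-isotropic subspaces as annihilators *)

Section Annihilators.
Context {F : fieldType} {n w : nat}.

(** The width [w] is free: width 1 gives the subspace of column vectors that defines a
    column-isotropic space, width [n] that space itself. *)
Definition annih m (p : 'M[F]_(m, n)) : {vspace 'M[F]_(n, w)} := lker (linfun (mulmx p)).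

Lemma mem_annih m (p : 'M[F]_(m, n)) A : (A \in annih p) = (p *m A == 0).
Proof. by rewrite memv_ker lfunE. Qed.

Lemma mem_annih_ker m (p : 'M[F]_(m, n)) A : (A \in annih p) = (p <= kermx A)%MS.
Proof. by rewrite mem_annih; apply/eqP/sub_kermxP. Qed.

Lemma eq_annih m1 m2 (p : 'M[F]_(m1, n)) (q : 'M[F]_(m2, n)) :
  (p :=: q)%MS -> annih p = annih q.
Proof. by move=> pq; apply/vspaceP => A; rewrite !mem_annih_ker pq. Qed.

Lemma annihS m1 m2 (p : 'M[F]_(m1, n)) (q : 'M[F]_(m2, n)) :
  (q <= p)%MS -> (annih p <= annih q)%VS.
Proof.
by move=> qp; apply/subvP => A; rewrite !mem_annih_ker; apply: submx_trans.
Qed.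

Lemma dim_annih m (p : 'M[F]_(m, n)) : \dim (annih p) = ((n - \rank p) * w)%N.
Proof.
(* With independent rows, left multiplication is surjective, and rank-nullity applies. *)
have <- : annih (row_base p) = annih p by apply: eq_annih; exact: eq_row_base.
have pf := row_base_free p.
have full : limg (linfun (mulmx (row_base p) : 'M[F]_(n, w) -> 'M[F]_(\rank p, w))) = fullv.
  apply/vspaceP => A; rewrite memvf; apply/memv_imgP; exists (pinvmx (row_base p) *m A).
    exact: memvf.
  by rewrite lfunE /= mulmxA mulmxVp ?mul1mx.
have := limg_ker_dim (linfun (mulmx (row_base p) : 'M[F]_(n, w) -> 'M[F]_(\rank p, w))) fullv.
rewrite capfv full !dimvf /dim /= => h.
by rewrite mulnBl -h addnK.
Qed.

Lemma annihD_cap m1 m2 (p : 'M[F]_(m1, n)) (q : 'M[F]_(m2, n)) :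
  annih (p + q)%MS = (annih p :&: annih q)%VS.
Proof. by apply/vspaceP => A; rewrite memv_cap !mem_annih_ker addsmx_sub. Qed.

(** The sum is contained in the annihilator of the intersection; the dimensions agree by the rank
    formula for sums and intersections. *)
Lemma annihI_add m1 m2 (p : 'M[F]_(m1, n)) (q : 'M[F]_(m2, n)) :
  annih (p :&: q)%MS = (annih p + annih q)%VS.
Proof.
apply/esym/eqP; rewrite eqEdim; apply/andP; split.
  by apply/subvP => _ /memv_addP[A pA [B qB ->]]; rewrite memvD //;
    [apply: subvP pA | apply: subvP qB]; apply: annihS; rewrite ?capmxSl ?capmxSr.
have := dimv_sum_cap (annih p) (annih q); rewrite -annihD_cap !dim_annih.
have := mxrank_sum_cap p q; have := rank_leq_col p; have := rank_leq_col q.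
have := rank_leq_col (p + q)%MS; have := rank_leq_col (p :&: q)%MS.
move: (\rank p) (\rank q) (\rank (p + q)%MS) (\rank (p :&: q)%MS) => a b c d.
move=> dn cn bn an cdab h; rewrite -(leq_add2r ((n - c) * w)%N) h -!mulnDl leq_mul2r.
by apply/orP; right; lia.
Qed.

End Annihilators.

Section ColumnIsotropic.
Context {R : realType} {n : nat}.

(** Duality: if the rows of [S] span [U], the transposed cokernel of [S] annihilates exactly [U]. *)
Lemma vspace_cV_annih (U : {vspace 'cV[R]_n}) : exists p : 'M[R]_n, U = annih p.
Proof.
pose S : 'M[R]_(\dim U, n) := \matrix_i ((vbasis U)`_i)^T.
exists (cokermx S)^T; apply/vspaceP => u.
have -> : (u \in annih (cokermx S)^T) = (u^T <= S)%MS.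
  by rewrite mem_annih submxE -(inj_eq trmx_inj) trmx_mul trmxK trmx0.
have rS i : row i S = ((vbasis U)`_i)^T by rewrite rowK.
apply/idP/idP => [uU|/submxP[x ux]].
  rewrite (coord_vbasis uU) linear_sum; apply: summx_sub => i _.
  by rewrite linearZ /= scalemx_sub // -rS row_sub.
rewrite -[u]trmxK ux mulmx_sum_row linear_sum rpred_sum // => i _.
by rewrite linearZ /= rpredZ // rS trmxK vbasis_mem // mem_nth // size_tuple.
Qed.

Lemma mulmx_cols_eq0 p q w (A : 'M[R]_(p, q)) (B : 'M[R]_(q, w)) :
  A *m B = 0 <-> forall j, A *m col j B = 0.
Proof.
split=> [AB j|h]; first by rewrite colE mulmxA AB mul0mx.
apply/matrixP => i j; have := congr1 (fun c : 'cV_p => c i 0) (h j).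
by rewrite colE mulmxA -colE !mxE.
Qed.

Lemma column_isotropicP (V : {vspace 'M[R]_n}) :
  column_isotropic V <->
  exists2 p : 'M[R]_n, V = annih p & (1 <= \rank p <= n - 1)%N.
Proof.
split=> [[U [dU hV]]|[p -> rp]].
  have [p pU] := vspace_cV_annih U; exists p.
    apply/vspaceP => A; rewrite mem_annih; apply/idP/eqP => [/hV h|pA].
      by apply/mulmx_cols_eq0 => j; apply/eqP; rewrite -mem_annih -pU.
    by apply/hV => j; rewrite pU mem_annih (mulmx_cols_eq0 p A).1.
  by move: dU; rewrite pU dim_annih muln1; have := rank_leq_col p; lia.
exists (annih p); split; first by rewrite dim_annih muln1; lia.
move=> A; rewrite mem_annih; split=> [/eqP pA j|h].
  by rewrite mem_annih (mulmx_cols_eq0 p A).1.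
by apply/eqP/mulmx_cols_eq0 => j; apply/eqP; rewrite -mem_annih.
Qed.

Lemma trace_mul_tr_eq0 m (A : 'M[R]_(m, n)) : \tr (A *m A^T) = 0 -> A = 0.
Proof.
move=> /eqP; rewrite /mxtrace psumr_eq0 => [/allP h|i _]; last first.
  by rewrite mxE sumr_ge0 // => j _; rewrite mxE -expr2 sqr_ge0.
apply/matrixP => i j; rewrite mxE; have := h i (mem_index_enum _).
rewrite mxE psumr_eq0 => [/allP/(_ j (mem_index_enum _))|k _]; last first.
  by rewrite mxE -expr2 sqr_ge0.
by rewrite mxE -expr2 sqrf_eq0 => /eqP.
Qed.

(** For a row basis [B] of [p], take [B^T (B B^T)^-1 B]; the Gram matrix is invertible since the
    trace form is positive definite. *)
Lemma orthogonal_projector m (p : 'M[R]_(m, n)) :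
  exists Q : 'M[R]_n, [/\ Q^T = Q, Q *m Q = Q & (Q :=: p)%MS].
Proof.
have [B Bf Bp] : exists2 B : 'M[R]_(\rank p, n), row_free B & (B :=: p)%MS.
  by exists (row_base p); [exact: row_base_free | exact: eq_row_base].
have Gu : B *m B^T \in unitmx.
  rewrite -row_free_unit; apply: inj_row_free => x xG.
  have : x *m B = 0.
    apply: trace_mul_tr_eq0; rewrite trmx_mul mulmxA -[x *m B *m _]mulmxA xG.
    by rewrite mul0mx mxtrace0.
  by move=> xB; rewrite -[x](mulmxKp Bf) xB mul0mx.
have GT : (invmx (B *m B^T))^T = invmx (B *m B^T) by rewrite trmx_inv trmx_mul trmxK.
exists (B^T *m invmx (B *m B^T) *m B); split.
- by rewrite !trmx_mul GT trmxK mulmxA.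
- by rewrite !mulmxA -[_ *m B *m B^T]mulmxA mulmxKV.
apply: (eqmx_trans _ Bp); apply/eqmxP; rewrite submxMl /=.
rewrite -{1}[B](_ : (B *m B^T *m invmx (B *m B^T)) *m B = B); last by rewrite mulmxV ?mul1mx.
by rewrite -!mulmxA submxMl.
Qed.

(** Left multiplication by [Q] is self-adjoint for the trace form, idempotent, and has kernel
    [annih p], so it is the orthogonal projection along [annih p]. The projected lattice thus
    becomes an explicit image of [L]. *)
Lemma proj_perp_annih (L : set 'M[R]_n) m (p : 'M[R]_(m, n)) (Q : 'M[R]_n) :
  Q^T = Q -> Q *m Q = Q -> (Q :=: p)%MS ->
  proj_perp L (annih p) = [set Q *m v | v in L].
Proof.
move=> QT QQ Qp; rewrite -(eq_annih Qp); apply/seteqP; split=> [w [wo [v Lv]]|w [v Lv <-]].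
  rewrite mem_annih mulmxBr subr_eq0 => /eqP Qv; exists v => //; rewrite Qv.
  have Qw : Q *m (w - Q *m w) = 0 by rewrite mulmxBr mulmxA QQ subrr.
  have : w - Q *m w = 0.
    apply: trace_mul_tr_eq0; rewrite [in X in _ *m X]linearB /= trmx_mul QT mulmxBr linearB /=.
    rewrite wo ?mem_annih ?Qw // sub0r mulmxA mxtrace_mulC !mulmxA.
    by rewrite Qw mul0mx mxtrace0 oppr0.
  by move/eqP; rewrite subr_eq0 => /eqP.
split=> [u|]; last by exists v => //; rewrite mem_annih mulmxBr mulmxA QQ subrr.
rewrite mem_annih => /eqP Qu; rewrite trmx_mul QT mulmxA mxtrace_mulC mulmxA Qu mul0mx.
exact: mxtrace0.
Qed.

End ColumnIsotropic.

(** * Maximal rational column-isotropic subspaces *)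

Section Commensurable.
Context {W : zmodType}.

Definition Zspan k (a : 'I_k -> W) : set W :=
  [set x | exists z : 'I_k -> int, x = \sum_i a i *~ z i].

Lemma Zspan_subgroup k (a : 'I_k -> W) : is_subgroup (Zspan a).
Proof.
split; first by exists (fun=> 0); rewrite big1.
move=> _ _ [z ->] [w ->]; exists (fun i => z i - w i).
by rewrite -sumrB; apply: eq_bigr => i _; rewrite mulrzBr.
Qed.

Lemma is_subgroupN (A : set W) x : is_subgroup A -> A x -> A (- x).
Proof. by move=> [A0 AB] Ax; rewrite -sub0r; apply: AB. Qed.

Lemma is_subgroupD (A : set W) x y : is_subgroup A -> A x -> A y -> A (x + y).
Proof.
by move=> hA Ax Ay; rewrite -[y]opprK; apply: hA.2 => //; apply: is_subgroupN.
Qed.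

Lemma is_subgroupI (A B : set W) : is_subgroup A -> is_subgroup B -> is_subgroup (A `&` B).
Proof.
move=> [A0 AB] [B0 BB]; split=> // x y [Ax Bx] [Ay By].
by split; [apply: AB | apply: BB].
Qed.

(** Reducing the coefficients modulo [d] changes a vector by an element of [C], so finitely many
    coefficient vectors represent all cosets. *)
Lemma finite_cosets k (a : 'I_k -> W) (C : set W) (d : nat) : (0 < d)%N ->
  is_subgroup C -> (forall x, Zspan a x -> C (x *+ d)) -> finite_set (cosets C (Zspan a)).
Proof.
move=> d0 hC dC.
pose rep (r : {ffun 'I_k -> 'I_d}) := [set \sum_i a i *~ (r i)%:Z + c | c in C].
apply: sub_finite_set (finite_image rep (@finite_finset _ setT)) => _ [x [z ->] <-].
pose r := [ffun i => Ordinal (ltn_pmod (absz (modz (z i) d)) d0)].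
exists r => //.
have rE : \sum_i a i *~ z i = \sum_i a i *~ (r i)%:Z + (\sum_i a i *~ (divz (z i) d)) *+ d.
  rewrite -sumrMnl -big_split; apply: eq_bigr => i _; rewrite ffunE /= modn_small; last first.
    by rewrite -ltz_nat gez0_abs ?modz_ge0 ?ltz_pmod //; lia.
  rewrite gez0_abs ?modz_ge0 //; last by lia.
  by rewrite [_ *+ d]pmulrn -mulrzA -mulrzDr addrC -divz_eq.
have Cd : C ((\sum_i a i *~ (divz (z i) d)) *+ d) by apply: dC; exists (fun i => divz (z i) d).
set y := (_ *+ d) in rE Cd; rewrite rE.
apply/seteqP; split=> [_ [c Cc <-]|_ [c Cc <-]].
  by exists (c - y); [apply: hC.2 | rewrite addrA addrAC addrK].
exists (y + c); [exact: is_subgroupD | by rewrite addrA].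
Qed.

Lemma commensurable_Zspan k l (a : 'I_k -> W) (b : 'I_l -> W) (d : nat) : (0 < d)%N ->
  (forall x, Zspan a x -> Zspan b (x *+ d)) -> (forall x, Zspan b x -> Zspan a (x *+ d)) ->
  commensurable (Zspan a) (Zspan b).
Proof.
have Md m (c : 'I_m -> W) x : Zspan c x -> Zspan c (x *+ d).
  move=> cx; elim: d => [|e IHe]; first by rewrite mulr0n; case: (Zspan_subgroup c).
  by rewrite mulrS; apply: is_subgroupD => //; apply: Zspan_subgroup.
move=> d0 ab ba; have hI := is_subgroupI (Zspan_subgroup a) (Zspan_subgroup b).
by split; apply: finite_cosets d0 hI _ => x hx; split; [apply: Md | apply: ab | apply: ba | apply: Md].
Qed.

Lemma Zspan_image (U : zmodType) k (a : 'I_k -> U) (f : {additive U -> W}) (A : set U) :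
  (forall x, A x <-> exists z : 'I_k -> int, x = \sum_i a i *~ z i) ->
  [set f x | x in A] = Zspan (fun i => f (a i)).
Proof.
move=> hA; apply/seteqP; split=> [_ [x /hA[z ->] <-]|_ [z ->]].
  by exists z; rewrite raddf_sum; apply: eq_bigr => i _; rewrite raddfMz.
exists (\sum_i a i *~ z i); first by apply/hA; exists z.
by rewrite raddf_sum; apply: eq_bigr => i _; rewrite raddfMz.
Qed.

End Commensurable.

Section FiniteMaximal.
Context {R : realType} {n : nat}.
Context {L : set 'M[R]_n} {b : 'I_(n * n) -> 'M[R]_n}.
Context (dL : discrete_subgroup L) (hb : indep b) (Lb : Zbasis L b).

(** The identity matrix is a sum [X S + Y T] of rational matrices whose rows lie in the two spaces;
    it splits every lattice vector rationally, and one denominator serves all of them. *)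
Lemma rational_sum_full (V W : {vspace 'M[R]_n}) :
  rational_space b V -> rational_space b W -> (V + W)%VS = fullv ->
  exists2 d : nat, (0 < d)%N & forall v, L v ->
    exists k w, [/\ L k, k \in V, L w, w \in W & v *+ d = k + w].
Proof.
move=> [S hS] [T hT] VW.
have ST : (1%:M <= S + T)%MS.
  rewrite -(map_submx (@ratr R)) map_mx1 map_addsmx; apply/rV_subP => x _.
  have : of_coords b x \in (V + W)%VS by rewrite VW memvf.
  move=> /memv_addP[B BV [C CW xE]].
  rewrite -[x](of_coordsK hb) xE linearD; apply: addmx_sub_adds; by [rewrite -hS | rewrite -hT].
have [[X Y] /= XY] := sub_addsmxP ST.
have [d1 d10 [M1 hM1]] := common_denominator_mx (X *m S).
have [d2 d20 [M2 hM2]] := common_denominator_mx (Y *m T).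
exists (d1 * d2)%N; first by rewrite muln_gt0 d10.
move=> v /(latticeP hb Lb)[z vz].
(* The extra factor [e'] is the denominator of the other component, so both parts are scaled by
   [d1 * d2]. *)
have part (P : 'M[rat]_(n * n)) Z (M : 'M[int]_(n * n)) e e' (U : {vspace 'M[R]_n}) :
    (forall A, (A \in U) = (coords b A <= map_mx ratr P)%MS) ->
    e%:R *: (Z *m P) = map_mx intr M ->
    let k := of_coords b (real_row (e'%:R *: (z *m M))) in L k /\ k \in U /\
    coords b k = (e' * e)%:R *: (real_row z *m map_mx ratr (Z *m P)).
  move=> hP hM k; have kE : coords b k = real_row (e'%:R *: (z *m M)) by rewrite of_coordsK.
  have kE' : coords b k = (e' * e)%:R *: (real_row z *m map_mx ratr (Z *m P)).
    rewrite kE /real_row map_mxZ map_mxM -[map_mx _ M]map_ratr_int -hM map_mxZ -scalemxAr scalerA.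
    by rewrite !rmorph_nat natrM.
  split; first by apply/(latticeP hb Lb); exists (e'%:R *: (z *m M)).
  by split=> //; rewrite hP kE' map_mxM mulmxA scalemx_sub // submxMl.
have [Lk [kV kE]] := part _ _ _ _ d2 _ hS hM1.
have [Lw [wW wE]] := part _ _ _ _ d1 _ hT hM2.
exists (of_coords b (real_row (d2%:R *: (z *m M1)))).
exists (of_coords b (real_row (d1%:R *: (z *m M2)))); split=> //.
rewrite -scaler_nat -[LHS](coordsK hb) -[RHS](coordsK hb); congr of_coords.
rewrite linearD /= kE wE linearZ /= vz [(d2 * d1)%N]mulnC -scalerDr -mulmxDr -map_mxD -XY.
by rewrite map_mx1 mulmx1.
Qed.

End FiniteMaximal.

Section MaximalColumns.
Context {R : realType} {n : nat}.
Context {L : set 'M[R]_n} (b : 'I_(n * n) -> 'M[R]_n).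
Context (dL : discrete_subgroup L) (hb : indep b) (Lb : Zbasis L b).

Definition rational_ann (p : 'M[R]_n) := rational_space b (annih p : {vspace 'M[R]_n}).

(** The cokernel of [p] lies in [annih p], and [q] kills it only if its rows lie in the row space of
    [p]. *)
Lemma annih_sub (p q : 'M[R]_n) : (annih p <= (annih q : {vspace 'M[R]_n}))%VS -> (q <= p)%MS.
Proof.
by move=> /subvP/(_ (cokermx p)); rewrite !mem_annih mulmx_coker eqxx submxE; apply.
Qed.

Lemma rational_annD p q : rational_ann p -> rational_ann q -> rational_ann (p + q)%MS.
Proof. by move=> hp hq; rewrite /rational_ann annihD_cap; apply: rational_spaceI. Qed.

Lemma rational_annI p q : rational_ann p -> rational_ann q -> rational_ann (p :&: q)%MS.
Proof. by move=> hp hq; rewrite /rational_ann annihI_add; apply: rational_spaceD. Qed.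

Lemma maximal_annP V : maximal_rational column_isotropic L V ->
  exists p : 'M[R]_n, [/\ V = annih p, rational_ann p, (1 <= \rank p <= n - 1)%N &
    forall q : 'M[R]_n, rational_ann q -> (q <= p)%MS -> q != 0 -> (p <= q)%MS].
Proof.
move=> [[Vr /column_isotropicP[p VE rp] Vf] Vmax]; exists p; split=> //.
  by rewrite /rational_ann -VE; apply/(rational_spaceP dL hb Lb).
move=> q hq qp q0; apply: annih_sub; rewrite -VE (Vmax (annih q)) ?VE ?annihS //.
have rq : (1 <= \rank q <= n - 1)%N.
  by rewrite lt0n mxrank_eq0 q0 (leq_trans (mxrankS qp)) //; case/andP: rp.
split; first exact/(rational_spaceP dL hb Lb).
  by apply/column_isotropicP; exists q.
apply/eqP => /(congr1 (fun U : {vspace _} => \dim U)); rewrite dim_annih dimvf /dim /=.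
have := rank_leq_col q; move: rq => /andP[]; nia.
Qed.

(* Here [annih r] complements both [annih p1] and [annih p2] modulo the same
   intersection, so that both quotient lattices are commensurable with its image. *)
Lemma maximal_exchange (p1 p2 r : 'M[R]_n) :
    rational_ann p1 -> rational_ann p2 -> rational_ann r ->
    (forall q, rational_ann q -> (q <= p1)%MS -> q != 0 -> (p1 <= q)%MS) ->
    (forall q, rational_ann q -> (q <= p2)%MS -> q != 0 -> (p2 <= q)%MS) ->
    (p1 <= r + p2)%MS -> ~~ (p1 <= r)%MS ->
  \rank p1 = \rank p2 /\ exists2 h : 'M[R]_n, h \in unitmx &
    commensurable [set h *m v | v in proj_perp L (annih p1)] (proj_perp L (annih p2)).
Proof.
move=> hp1 hp2 hr min1 min2 p1r p1Nr.
(* By minimality a nonzero rational subspace of [p1] is all of [p1]. *)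
have r1 : (r :&: p1 = 0)%MS.
  apply/eqP; apply: contraNT p1Nr => nz; apply: submx_trans (capmxSl r p1).
  by apply: min1 nz; [exact: rational_annI | exact: capmxSr].
have p2Nr : ~~ (p2 <= r)%MS.
  by apply: contraNN p1Nr => h; apply: submx_trans p1r _; rewrite addsmx_sub submx_refl.
have r2 : (r :&: p2 = 0)%MS.
  apply/eqP; apply: contraNT p2Nr => nz; apply: submx_trans (capmxSl r p2).
  by apply: min2 nz; [exact: rational_annI | exact: capmxSr].
(* The exchange: in [p1 = x r + y p2] the term [y p2] is nonzero and lies in both [r + p1] and [p2],
   so minimality of [p2] puts all of [p2] inside [r + p1]. *)
have p2r : (p2 <= r + p1)%MS.
  apply: submx_trans (capmxSl (r + p1)%MS p2); apply: min2.
  - by apply: rational_annI => //; apply: rational_annD.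
  - exact: capmxSr.
  apply/eqP => nz.
  have [[x y] /= xy] := sub_addsmxP p1r.
  have : (y *m p2 <= (r + p1) :&: p2)%MS.
    rewrite sub_capmx submxMl andbT.
    have -> : y *m p2 = p1 - x *m r by rewrite xy addrC addKr.
    by rewrite addmx_sub // ?addsmxSr // -mulNmx (submx_trans (submxMl _ _)) ?addsmxSl.
  rewrite nz submx0 => /eqP yp; case/negP: p1Nr.
  by rewrite xy yp addr0 submxMl.
have rk : \rank p1 = \rank p2.
  have := mxrank_sum_cap r p1; have := mxrank_sum_cap r p2; rewrite r1 r2 !mxrank0 !addn0.
  have -> : \rank (r + p1)%MS = \rank (r + p2)%MS.
    by apply/eqP; rewrite eqn_leq !mxrankS // addsmx_sub addsmxSl.
  by move=> -> /addnI.
split=> //.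
have [Q1 [Q1T Q1Q Q1p]] := orthogonal_projector p1.
have [Q2 [Q2T Q2Q Q2p]] := orthogonal_projector p2.
have : (Q2 <= r + Q1)%MS by rewrite Q2p (submx_trans p2r) // addsmxS // Q1p.
move=> /sub_addsmxP[[a g] /= Q2E].
(* On [annih r] the projector [Q2] acts as [g Q1]. Since [g] loses no rank on [Q1], it can be
   replaced by an invertible [h] with [g Q1 = h Q1]; the transposes fit [complete_unitmx], which
   completes a right factor. *)
have rkg : \rank (Q1^T *m g^T) = \rank Q1^T.
  rewrite -trmx_mul !mxrank_tr; apply/eqP; rewrite eqn_leq mxrankM_maxr /= Q1p rk -Q2p.
  have : (kermx (g *m Q1) <= kermx Q2)%MS.
    apply/sub_kermxP; have h0 := mulmx_ker (g *m Q1).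
    have : (kermx (g *m Q1) *m Q2 <= r :&: p2)%MS.
      rewrite sub_capmx; apply/andP; split.
        by rewrite Q2E mulmxDr h0 addr0 mulmxA submxMl.
      by rewrite -Q2p submxMl.
    by rewrite r2 submx0 => /eqP.
  move=> /mxrankS; rewrite !mxrank_ker.
  have := rank_leq_col (g *m Q1); have := rank_leq_col Q2.
  by move: (\rank Q2) (\rank (g *m Q1)) => x y; lia.
have [h0 h0u gh] := complete_unitmx rkg.
pose h := h0^T.
have hu : h \in unitmx by rewrite unitmx_tr.
have hgQ : g *m Q1 = h *m Q1.
  by apply: trmx_inj; rewrite !trmx_mul gh /h trmxK.
have Q2h v : r *m v = 0 -> Q2 *m v = h *m (Q1 *m v).
  by move=> rv; rewrite Q2E mulmxDl -mulmxA rv mulmx0 add0r hgQ mulmxA.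
exists h => //; rewrite (proj_perp_annih _ Q1T Q1Q Q1p) (proj_perp_annih _ Q2T Q2Q Q2p).
have -> : [set h *m v | v in [set Q1 *m v | v in L]] = Zspan (fun i => (h *m Q1) *m b i).
  rewrite -(Zspan_image (mulmx (h *m Q1)) Lb.1); apply/seteqP.
  split=> [_ [_ [v Lv <-] <-]|_ [v Lv <-]]; first by exists v => //; rewrite mulmxA.
  by exists (Q1 *m v); [exists v | rewrite mulmxA].
have hA : Zspan (fun i => (h *m Q1) *m b i) = [set (h *m Q1) *m v | v in L].
  by rewrite -(Zspan_image (mulmx (h *m Q1)) Lb.1).
have hB : Zspan (fun i => Q2 *m b i) = [set Q2 *m v | v in L].
  by rewrite -(Zspan_image (mulmx Q2) Lb.1).
have full (p : 'M[R]_n) : (r :&: p = 0)%MS -> (annih r + (annih p : {vspace 'M[R]_n}))%VS = fullv.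
  move=> rp; rewrite -annihI_add rp; apply/vspaceP => A.
  by rewrite mem_annih mul0mx eqxx memvf.
have [d1 d10 hd1] := rational_sum_full hb Lb hr hp1 (full _ r1).
have [d2 d20 hd2] := rational_sum_full hb Lb hr hp2 (full _ r2).
have mulL (v : 'M[R]_n) e : L v -> L (v *+ e).
  move=> Lv; elim: e => [|e IHe]; first by rewrite mulr0n; case: dL => [[]].
  by rewrite mulrS; apply: is_subgroupD => //; case: dL.
have Mn (A v : 'M[R]_n) e : A *m (v *+ e) = (A *m v) *+ e := raddfMn (mulmx A) e v.
have annE (p Q w : 'M[R]_n) : (Q :=: p)%MS -> w \in (annih p : {vspace 'M[R]_n}) -> Q *m w = 0.
  by move=> Qp; rewrite -(eq_annih Qp) mem_annih => /eqP.
(* A multiple of each lattice vector is congruent, modulo [annih p1] or [annih p2], to a lattice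
   vector of [annih r], where [Q2] and [h Q1] agree. *)
rewrite -hB; apply: (@commensurable_Zspan _ _ _ _ _ (d1 * d2)); first by rewrite muln_gt0 d10.
  rewrite hA hB => _ [v Lv <-]; have [k [w [Lk kr Lw wp vkw]]] := hd1 v Lv.
  exists (k *+ d2); first exact: mulL.
  rewrite Mn mulrnA -[h *m Q1 *m v *+ d1]Mn vkw mulmxDr -!mulmxA (annE _ _ _ Q1p wp) mulmx0 addr0 -Q2h //.
  by move: kr; rewrite mem_annih => /eqP.
rewrite hA hB => _ [v Lv <-]; have [k [w [Lk kr Lw wp vkw]]] := hd2 v Lv.
exists (k *+ d1); first exact: mulL.
rewrite Mn mulnC mulrnA -[Q2 *m v *+ d2]Mn vkw mulmxDr (annE _ _ _ Q2p wp) addr0 Q2h ?mulmxA //.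
by move: kr; rewrite mem_annih => /eqP.
Qed.

(** The list is a finite family of such subspaces whose intersection has least dimension. A further
    one, [V], must contain this intersection; shrinking the family to a smallest one that avoids [V]
    and still has its intersection inside [V] puts [V] and any member [W] in the situation of
    [maximal_exchange]. *)
Lemma finite_maximal_codim : column_noncoincidence L ->
  exists s : seq {vspace 'M[R]_n}, forall V, maximal_rational column_isotropic L V ->
    \dim V != (n * (n - 1))%N -> V \in s.
Proof.
move=> ncol.
pose good V := maximal_rational column_isotropic L V /\ \dim V <> (n * (n - 1))%N.
pose I (s : seq {vspace 'M[R]_n}) := (\bigcap_(V <- s) V)%VS.
have annI s : (forall V, V \in s -> good V) -> exists2 r, rational_ann r & I s = annih r.
  elim: s => [|V s IHs] gs.
    exists 0.
      exists 1%:M => A; rewrite mem_annih mul0mx eqxx; apply/esym.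
      by rewrite map_mx1 submx1.
    by rewrite /I big_nil; apply/vspaceP => A; rewrite memvf mem_annih mul0mx eqxx.
  have [r hr rE] : exists2 r, rational_ann r & I s = annih r.
    by apply: IHs => W Ws; apply: gs; rewrite inE Ws orbT.
  have [/maximal_annP[p [pE hp _ _]] _] : good V by apply: gs; rewrite mem_head.
  exists (p + r)%MS; first exact: rational_annD.
  by rewrite /I big_cons -/(I s) rE pE annihD_cap.
pose P k := `[< exists2 s, (forall V, V \in s -> good V) & \dim (I s) = k >].
have exP : exists k, P k by exists (\dim (I [::])); apply/asboolP; exists [::].
case: (ex_minnP exP) => k /asboolP[s gs dk] mink; exists s => V Vmax /eqP dV.
have gV : good V by [].
apply: contraT => Vs.
(* Adding [V] to the family cannot lower the minimal dimension. *)
have IV : (I s <= V)%VS.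
  apply/capv_idPl/eqP; rewrite eqEdim capvSl /= dk mink //; apply/asboolP.
  exists (V :: s); last by rewrite /I big_cons capvC.
  by move=> W; rewrite inE => /orP[/eqP->//|/gs].
pose Q m := `[< exists s', [/\ forall W, W \in s' -> good W, V \notin s', (I s' <= V)%VS & size s' = m] >].
have exQ : exists m, Q m by exists (size s); apply/asboolP; exists s.
case: (ex_minnP exQ) => m /asboolP[[|W s'] [gs' Vs' IsV sm]] minm.
  have [_ _ Vf] := Vmax.1; case/negP: Vf.
  by move: IsV; rewrite /I big_nil => h; rewrite eqEsubv subvf h.
have gs'' U : U \in s' -> good U by move=> Us; apply: gs'; rewrite inE Us orbT.
have gW : good W by apply: gs'; rewrite mem_head.
have [r hr rE] := annI _ gs''.
(* Without [W] the family is too short to have its intersection inside [V]; this is the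
   nondegeneracy required by the exchange. *)
have KV : ~~ (I s' <= V)%VS.
  apply/negP => h; have : (m <= size s')%N.
    apply: minm; apply/asboolP; exists s'; split=> //.
    by move: Vs'; rewrite inE negb_or => /andP[].
  by rewrite -sm ltnn.
have [p1 [VE hp1 rp1 min1]] := maximal_annP Vmax.
have [p2 [WE hp2 rp2 min2]] := maximal_annP gW.1.
have [||rk hh] := maximal_exchange hp1 hp2 hr min1 min2.
- apply: annih_sub; rewrite annihD_cap -VE -WE -rE.
  by move: IsV; rewrite /I big_cons capvC.
- by apply: contraNN KV => h; rewrite VE rE annihS.
have VW : V != W by move: Vs'; rewrite inE negb_or => /andP[].
have dV1 : \dim V = ((n - \rank p1) * n)%N by rewrite VE dim_annih.
have dW1 : \dim W = ((n - \rank p1) * n)%N by rewrite WE dim_annih rk.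
have p12 : (p1 :&: p2 = 0)%MS.
  apply/eqP; apply: contraNT VW => nz.
  have hI := rational_annI hp1 hp2; apply/eqP; rewrite VE WE; apply: eq_annih; apply/eqmxP.
  rewrite (submx_trans (min1 _ hI (capmxSl _ _) nz) (capmxSr _ _)) /=.
  exact: submx_trans (min2 _ hI (capmxSr _ _) nz) (capmxSl _ _).
(* Disjoint row spaces of equal rank give [2 * \rank p1 <= n], and the rank is not 1; hence
   [n - \rank p1] lies between [uphalf n] and [n - 2]. *)
have rs := mxrank_sum_cap p1 p2; rewrite p12 mxrank0 addn0 rk in rs.
have := rank_leq_col (p1 + p2)%MS; rewrite rs => r2.
case: (ncol (n - \rank p1)%N).
  rewrite uphalf_half; move: dV r2 rp1 rp2; rewrite dV1 rk => dV r2 /andP[a1 a2] _.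
  have r1 : \rank p2 <> 1%N by move=> e; apply: dV; rewrite e mulnC.
  by have := odd_double_half n; rewrite -muln2; lia.
exists V, W; split=> //; [exact: gW.1 | by rewrite VE WE].
Qed.

End MaximalColumns.

(** * Integer matrices of deficient row rank *)

Section Dot.
Context {j : nat}.
Implicit Types q x t : 'rV[int]_j.

Definition dot q x : int := \sum_i q 0 i * x 0 i.

Lemma dotDr q x y : dot q (x + y) = dot q x + dot q y.
Proof. by rewrite -big_split; apply: eq_bigr => i _; rewrite mxE mulrDr. Qed.

Lemma dotZr q a x : dot q (a *: x) = a * dot q x.
Proof. by rewrite mulr_sumr; apply: eq_bigr => i _; rewrite mxE mulrCA. Qed.

Lemma dotNr q x : dot q (- x) = - dot q x.
Proof. by rewrite -scaleN1r dotZr mulN1r. Qed.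

Lemma dotZl q a x : dot (a *: q) x = a * dot q x.
Proof. by rewrite mulr_sumr; apply: eq_bigr => i _; rewrite mxE mulrA. Qed.

Lemma dot_delta q i : dot q (delta_mx 0 i) = q 0 i.
Proof.
rewrite /dot (bigD1 i) //= mxE !eqxx mulr1 big1 ?addr0 // => k ki.
by rewrite mxE (negbTE ki) andbF mulr0.
Qed.

(** The least positive value of [dot q] divides all its values, so it is the gcd of the entries, and
    [t] is a vector of Bezout coefficients. *)
Lemma primitive_multiple q : q != 0 ->
  exists g q' t, [/\ g != 0, q = g *: q' & dot q' t = 1].
Proof.
(* The successor restricts the minimum to positive values. *)
move=> q0; pose P k := `[< exists t, dot q t = k.+1%:Z >].
have exP : exists k, P k.
  have [i qi] : exists i, q 0 i != 0.
    apply/existsP; apply: contraR q0 => /existsPn h; apply/eqP/rowP => i.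
    by rewrite mxE; apply/eqP; move: (h i); rewrite negbK.
  exists (absz (q 0 i)).-1; apply/asboolP.
  exists (Num.sg (q 0 i) *: delta_mx 0 i); rewrite dotZr dot_delta.
  by rewrite prednK ?absz_gt0 // abszE normrEsg.
case: (ex_minnP exP) => k /asboolP[t qt] kmin.
have dv x : (k.+1%:Z %| dot q x)%Z.
  apply: contraT => nd; have r0 : modz (dot q x) k.+1 != 0 by apply: contra nd => /eqP h; apply/dvdz_mod0P.
  have rge : 0 <= modz (dot q x) k.+1 by rewrite modz_ge0.
  have rlt : modz (dot q x) k.+1 < k.+1%:Z by rewrite ltz_pmod.
  have : (k <= (absz (modz (dot q x) k.+1)).-1)%N.
    apply: kmin; apply/asboolP; exists (x - divz (dot q x) k.+1 *: t).
    rewrite dotDr dotNr dotZr qt; have := divz_eq (dot q x) k.+1.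
    by move: r0 rge rlt; set r := modz _ _; set dd := divz _ _; lia.
  by move: r0 rge rlt; set r := modz _ _; lia.
have kE : q = k.+1%:Z *: (\row_i divz (q 0 i) k.+1).
  apply/rowP => i; rewrite !mxE mulrC; apply/esym/eqP.
  by rewrite -dvdz_eq -dot_delta dv.
exists k.+1%:Z, (\row_i divz (q 0 i) k.+1), t; split=> //.
have := qt; rewrite {1}kE dotZl => h.
by apply: (@mulfI _ k.+1%:Z) => //; rewrite h mulr1.
Qed.

End Dot.

Lemma absz_small_mul (a b : int) (u v : nat) : (u < absz b)%N -> (v < absz b)%N ->
  u%:Z - v%:Z = a * b -> u = v.
Proof.
move=> ub vb uv; have [a0|a0] := eqVneq a 0; first by move: uv; rewrite a0 mul0r; lia.
have : (1 * absz b <= absz (a * b)%R)%N by rewrite abszM leq_mul2r absz_gt0 a0 orbT.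
by rewrite -uv mul1n; lia.
Qed.

Section HyperplaneCount.

Lemma dot_rat j (q x : 'rV[int]_j) :
  (map_mx intr q : 'rV[rat]_j) *m (map_mx intr x)^T = (dot q x)%:~R%:M.
Proof.
rewrite [LHS]mx11_scalar; congr _%:M; rewrite mxE /dot rmorph_sum.
by apply: eq_bigr => i _; rewrite !mxE rmorphM.
Qed.

(** The rows of [G] generate a finite-index sublattice of the hyperplane orthogonal to [q] by
    vectors of size at most [m]; [t] witnesses that [q] is primitive. *)
Context {d m : nat} (q t : 'rV[int]_d.+1) (i0 : 'I_d.+1) (G : 'M[int]_(d, d.+1)).
Hypothesis m0 : (0 < m)%N.
Hypothesis qt : dot q t = 1.
Hypothesis qi0 : q 0 i0 != 0.
Hypothesis qG : forall k, dot q (row k G) = 0.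
Hypothesis Gm : forall k l, (absz (G k l) <= m)%N.
Hypothesis Gfree : row_free (map_mx intr G : 'M[rat]_(d, d.+1)).

Let Gr : 'M[rat]_(d, d.+1) := map_mx intr G.
Let e0 : 'rV[rat]_d.+1 := delta_mx 0 i0.
Let qr : 'rV[rat]_d.+1 := map_mx intr q.

Let qGr : qr *m Gr^T = 0.
Proof.
apply/rowP => k; rewrite [RHS]mxE mxE.
transitivity ((dot q (row k G))%:~R : rat); last by rewrite qG.
by rewrite /dot rmorph_sum; apply: eq_bigr => l _; rewrite !mxE rmorphM.
Qed.

Let full_basis : (1%:M <= Gr + e0)%MS.
Proof.
have eG : ~~ (e0 <= Gr)%MS.
  apply/negP => /submxP[y eE]; have : qr *m e0^T = 0.
    by rewrite eE trmx_mul mulmxA qGr mul0mx.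
  have -> : e0 = map_mx intr (delta_mx 0 i0 : 'rV[int]_d.+1).
    by apply/rowP => i; rewrite !mxE; case: (_ && _).
  rewrite dot_rat dot_delta => /(congr1 (fun M : 'M[rat]_1 => M 0 0)).
  by rewrite !mxE eqxx => /eqP; rewrite intr_eq0 (negbTE qi0).
rewrite sub1mx.
have := mxrank_leqif_sup (addsmxSl Gr e0); rewrite addsmx_sub submx_refl (negbTE eG).
move=> h; have := ltn_leqif h; rewrite /= (eqP Gfree) => rk.
by rewrite /row_full eqn_leq rank_leq_col.
Qed.

(** Expand [c t] in the rows of [G] and [e0]. Pairing with [q] shows that the coefficient of [e0] is
    [c / q 0 i0], below 1 in absolute value; removing the integral parts of the other coefficients
    keeps the value [c] and leaves entries at most [d m + 1]. *)
Let short_rep c : (c < absz (q 0%R i0))%N ->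
  exists x, dot q x = c%:Z /\ box d.+1 (d * m).+1 x.
Proof.
move=> cq; have : (map_mx intr (c%:Z *: t) <= Gr + e0)%MS by apply: submx_trans (submx1 _) full_basis.
move=> /sub_addsmxP[[y s] /= tE].
have s1 : `|s 0 0| < 1.
  have : map_mx intr (c%:Z *: t) *m qr^T = s *m (e0 *m qr^T).
    rewrite tE mulmxDl -!mulmxA [Gr *m qr^T](_ : _ = 0) ?mulmx0 ?add0r //.
    by apply: trmx_inj; rewrite trmx_mul trmxK qGr trmx0.
  rewrite -[LHS]trmxK trmx_mul trmxK dot_rat tr_scalar_mx dotZr qt mulr1.
  move=> /(congr1 (fun M : 'M[rat]_1 => M 0 0)).
  rewrite mxE eqxx mulr1n mxE big_ord1 -rowE !mxE => h.
  have q0 : 0 < `|(q 0 i0)%:~R| :> rat by rewrite normr_gt0 intr_eq0.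
  rewrite -(ltr_pM2r q0) mul1r -normrM -h -!intr_norm ltr_int; lia.
pose x := c%:Z *: t - \sum_k Num.floor (y 0 k) *: row k G.
exists x; split.
  rewrite dotDr dotNr dotZr qt mulr1; apply/eqP; rewrite subr_eq -subr_eq0 opprD addrA subrr sub0r oppr_eq0.
  apply/eqP; rewrite /dot.
  under eq_bigr do rewrite summxE mulr_sumr.
  rewrite exchange_big big1 //= => k _.
  transitivity (Num.floor (y 0 k) * dot q (row k G)); last by rewrite qG mulr0.
  by rewrite mulr_sumr; apply: eq_bigr => l _; rewrite !mxE; ring.
move=> l; have xE : (x 0 l)%:~R = \sum_k (y 0 k - (Num.floor (y 0 k))%:~R) * Gr k l + s 0 0 * (l == i0)%:R :> rat.
  have tl : ((c%:Z *: t) 0 l)%:~R = \sum_k y 0 k * Gr k l + s 0 0 * (l == i0)%:R :> rat.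
    have := congr1 (fun M : 'rV[rat]_d.+1 => M 0 l) tE; rewrite mxE => ->.
    by rewrite !mxE big_ord1 !mxE eqxx.
  have xl : x 0 l = (c%:Z *: t) 0 l - \sum_k Num.floor (y 0 k) * G k l.
    by rewrite /x !mxE summxE; congr (_ - _); apply: eq_bigr => k _; rewrite !mxE.
  rewrite xl intrB tl rmorph_sum addrAC -sumrB; congr (_ + _).
  by apply: eq_bigr => k _; rewrite mxE rmorphM mulrBl.
have : `|(x 0 l)%:~R| < (d * m).+2%:R :> rat.
  rewrite xE; apply: le_lt_trans (ler_normD _ _) _; rewrite -[(d * m).+2]addn1 natrD.
  apply: ler_ltD; last first.
    by rewrite normrM normr_nat; case: (l == i0); rewrite ?mulr1 ?mulr0.
  apply: le_trans (ler_norm_sum _ _ _) _.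
  apply: (@le_trans _ _ (\sum_(k < d) m%:R)); last first.
    by rewrite sumr_const card_ord -mulrnA ler_nat mulnC.
  apply: ler_sum => k _; rewrite normrM -[m%:R]mul1r ler_pM //.
    have /andP[h1 h2] := floor_itv (y 0 k); rewrite ger0_norm ?subr_ge0 //.
    by move: h2; rewrite intrD; lra.
  by rewrite mxE -intr_norm pmulrn ler_int; have := Gm k l; lia.
by rewrite -intr_norm pmulrn ltr_int; move: (x 0 l) (d * m)%N => a e; lia.
Qed.

(* Shifting the counted vectors by representatives [tt c] of the residues
   [dot q (tt c) = c], and dropping the coordinate [i0] of the result, is injective. *)
Lemma hyperplane_count :
  (nb [set x | box d.+1 m x /\ dot q x = 0] * absz (q 0%R i0) <=
   (((d.+1 * m).+1 * 2).+1) ^ d)%N.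
Proof.
have /choice[tt htt] : forall c : 'I_(absz (q 0 i0)), exists x, dot q x = (c : nat)%:Z /\ box d.+1 (d * m).+1 x.
  by move=> c; apply: short_rep.
have fA : finite_set [set x | box d.+1 m x /\ dot q x = 0].
  by apply: sub_finite_set (finite_box d.+1 m) => x [].
rewrite -[absz (q 0 i0)]card_ord -nb_setT -nb_setX //; last exact: finite_finset.
apply: leq_trans (nb_box d (d.+1 * m).+1).
apply: (@nb_inj _ _ (fun p : 'rV[int]_d.+1 * 'I_(absz (q 0 i0)) => col' i0 (p.1 + tt p.2))).
- exact: finite_box.
- move=> [x c] [x' c'] /set_mem[[/= _ qx] _] /set_mem[[/= _ qx'] _] /= xx.
  (* If the two images agree, the shifted vectors differ by a multiple of the basis vector [i0];
     pairing with [q] makes [c - c'] a multiple of [q 0 i0], hence 0. *)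
  have e : x + tt c - (x' + tt c') = (x 0 i0 + tt c 0 i0 - x' 0 i0 - tt c' 0 i0) *: delta_mx 0 i0.
    apply/rowP => i; rewrite !mxE eqxx /=; case: (unliftP i0 i) => [k ->|->].
      have := congr1 (fun M : 'rV_d => M 0 k) xx; rewrite !mxE => ->.
      by rewrite subrr eq_sym (negbTE (neq_lift _ _)) mulr0.
    by rewrite eqxx mulr1; ring.
  have := congr1 (dot q) e; rewrite dotZr dot_delta !(dotDr, dotNr) qx qx'.
  rewrite (htt c).1 (htt c').1 !add0r => h.
  have cc : c = c'.
    by apply: val_inj => /=; apply: absz_small_mul (ltn_ord c) (ltn_ord c') h.
  have a0 : x 0 i0 + tt c 0 i0 - x' 0 i0 - tt c' 0 i0 = 0.
    by apply: (mulIf qi0); rewrite mul0r -h cc subrr.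
  move: e; rewrite a0 scale0r cc => /eqP; rewrite subr_eq0 => /eqP/addIr ->.
  by [].
- move=> [x c] [[/= xm _] _] i; rewrite !mxE.
  have := xm (lift i0 i); have := (htt c).2 (lift i0 i).
  by rewrite /= mulSn; lia.
Qed.

End HyperplaneCount.

Lemma row_free_col_mx (F : fieldType) (n s : nat) (p : 'rV[F]_n) (P : 'M[F]_(s, n)) :
  row_free P -> ~~ (p <= P)%MS -> row_free (col_mx p P).
Proof.
move=> Pf pP; apply: (@inj_row_free _ (1 + s)) => v; rewrite -[v]hsubmxK mul_row_col => h.
have l0 : lsubmx v = 0.
  apply: contraNeq pP => l0; have l00 : lsubmx v 0 0 != 0.
    by apply: contraNneq l0 => e; apply/eqP/rowP => o; rewrite ord1 e mxE.
  rewrite [lsubmx v]mx11_scalar mul_scalar_mx in h.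
  rewrite -[p]scale1r -(mulVf l00) -scalerA scalemx_sub //.
  by move/eqP: h; rewrite addr_eq0 => /eqP ->; rewrite -mulNmx submxMl.
rewrite l0 mul0mx add0r in h *.
by rewrite (_ : rsubmx v = 0) ?row_mx0 // -[LHS](mulmxKp Pf) h mul0mx.
Qed.

Lemma row_free_extend (F : fieldType) (j g k : nat) (Pr : 'rV[F]_j -> Prop) (G : 'M[F]_(g, j)) :
  row_free G -> (k + g <= j)%N -> (forall i, Pr (row i G)) -> (forall i, Pr (delta_mx 0 i)) ->
  exists G' : 'M[F]_(k + g, j), [/\ row_free G', (G <= G')%MS & forall i, Pr (row i G')].
Proof.
move=> Gf; elim: k => [|k IHk] kg PG Pe; first by exists G.
have [G' [G'f GG' PG']] := IHk (ltnW kg) PG Pe.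
have [i iG'] : exists i, ~~ ((delta_mx 0 i : 'rV[F]_j) <= G')%MS.
  apply/existsP; apply: contraLR kg => /existsPn h; rewrite -leqNgt -ltnS ltnS.
  have : (1%:M <= G')%MS.
    by apply/row_subP => i; rewrite row1; move: (h i); rewrite negbK.
  by move=> /mxrankS; rewrite mxrank1 (eqP G'f).
exists (col_mx (delta_mx 0 i) G' : 'M[F]_(1 + (k + g), j)); split.
- exact: row_free_col_mx.
- have G'S : (G' <= col_mx (delta_mx 0 i : 'rV[F]_j) G')%MS by rewrite -addsmxE addsmxSr.
  exact: submx_trans GG' G'S.
move=> l; case: (@split_ordP 1 (k + g) l) => l' ->.
  rewrite (rowKu l' (delta_mx 0 i : 'rV[F]_j)).
  by rewrite (_ : row l' _ = delta_mx 0 i) //; apply/rowP => o; rewrite !mxE ord1.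
by rewrite (rowKd l' (delta_mx 0 i : 'rV[F]_j)).
Qed.

(* The columns of [Y] are completed by standard basis vectors to [d] independent
   vectors bounded by [m]; [q] is the primitive normal of their hyperplane. *)
Lemma singular_annihilator (d n m : nat) (Y : 'M[int]_(d.+1, n)) (q0 : 'rV[int]_d.+1) :
  (0 < m)%N -> (forall i k, (absz (Y i k) <= m)%N) -> q0 != 0 -> q0 *m Y = 0 ->
  exists q t : 'rV[int]_d.+1, exists i0, exists G : 'M[int]_(d, d.+1),
    [/\ dot q t = 1, q 0 i0 != 0, forall k, dot q (row k G) = 0,
        forall k l, (absz (G k l) <= m)%N & row_free (map_mx intr G : 'M[rat]_(d, d.+1))] /\
    q *m Y = 0 /\ forall i, (absz (q 0%R i) <= absz (q 0%R i0))%N.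
Proof.
move=> m0 Ym q00 q0Y; pose S : 'M[rat]_(n, d.+1) := (map_mx intr Y)^T.
(* Integrality with entries at most [m]; standard basis vectors qualify because [m] is positive. *)
pose Pr (v : 'rV[rat]_d.+1) :=
  exists z : 'rV[int]_d.+1, v = map_mx intr z /\ forall l, (absz (z 0%R l) <= m)%N.
pose S0 := rowsub (maxrankfun S) S.
have rS : (\rank S <= d)%N.
  have : ~~ row_free S^T.
    apply/negP => Sf; have : (map_mx intr q0 : 'rV[rat]_d.+1) *m S^T = 0.
      by rewrite trmxK -map_mxM q0Y map_mx0.
    move=> h; have : (map_mx intr q0 : 'rV[rat]_d.+1) = 0 by rewrite -[LHS](mulmxKp Sf) h mul0mx.
    move=> /rowP e; case/eqP: q00; apply/rowP => i; apply/eqP; have := e i.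
    by rewrite !mxE => /eqP; rewrite intr_eq0.
  by rewrite /row_free mxrank_tr; have := rank_leq_col S; lia.
have PrS0 i : Pr (row i S0).
  exists ((col (maxrankfun S i) Y)^T); split; first by apply/rowP => l; rewrite !mxE.
  by move=> l; rewrite !mxE.
have Pre (i : 'I_d.+1) : Pr (delta_mx 0 i).
  exists (delta_mx 0 i); split; first by apply/rowP => l; rewrite !mxE; case: (_ && _).
  by move=> l; rewrite !mxE; case: (_ && _); rewrite ?absz1 ?absz0.
have [|G' [G'f SG' PrG']] := row_free_extend (k := d - \rank S) (maxrowsub_free S) _ PrS0 Pre.
  by rewrite subnK.
move: G' G'f SG' PrG'; rewrite subnK // => G' G'f SG' /choice[z hz].
pose G := \matrix_k z k.
have GG' : map_mx intr G = G' by apply/row_matrixP => k; rewrite -map_row rowK (hz k).1.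
pose u := nz_row (kermx G'^T).
have u0 : u != 0.
  rewrite nz_row_eq0 -mxrank_eq0 mxrank_ker mxrank_tr (eqP G'f).
  by rewrite subSnn.
have uG : u *m G'^T = 0 by apply/sub_kermxP; exact: nz_row_sub.
have [e e0 [v uv]] := common_denominator_mx u.
have v0 : v != 0.
  apply: contraNneq u0 => v00; move: uv; rewrite v00 map_mx0 => /eqP.
  by rewrite scalemx_eq0 pnatr_eq0 eqn0Ngt e0.
have [g [q [t [g0 vq qt]]]] := primitive_multiple v0.
have qG' : (map_mx intr q : 'rV[rat]_d.+1) *m G'^T = 0.
  have : g%:~R *: ((map_mx intr q : 'rV[rat]_d.+1) *m G'^T) = 0.
    by rewrite scalemxAl -map_mxZ -vq -uv -scalemxAl uG scaler0.
  by move/eqP; rewrite scalemx_eq0 intr_eq0 (negbTE g0) => /eqP.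
(* A largest coordinate makes the divisor in [hyperplane_count] equal to the sup norm of [q]. *)
pose i0 := [arg max_(i > ord0) absz (q 0 i)].
have qi0 i : (absz (q 0%R i) <= absz (q 0%R i0))%N.
  by rewrite /i0; case: arg_maxnP => // i1 _; apply.
exists q, t, i0, G; split; last split=> //.
  split=> //; last by rewrite GG'.
  - apply/eqP => z0; have : dot q t = 0.
      rewrite /dot big1 // => i _; have := qi0 i; rewrite z0 absz0 leqn0 absz_eq0.
      by move=> /eqP->; rewrite mul0r.
    by rewrite qt.
  - move=> k; have := congr1 (fun M : 'rV[rat]_d => M 0 k) qG'; rewrite [RHS]mxE.
    have -> : ((map_mx intr q : 'rV[rat]_d.+1) *m G'^T) 0 k = (dot q (row k G))%:~R.
      rewrite mxE /dot rmorph_sum; apply: eq_bigr => l _.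
      by rewrite -GG' !mxE rmorphM.
    by move/eqP; rewrite intr_eq0 => /eqP.
  - by move=> k l; have := (hz k).2 l; rewrite mxE.
have SG : (S <= G')%MS by rewrite -(eq_maxrowsub S).
have [x Sx] := submxP SG.
have : (map_mx intr q : 'rV[rat]_d.+1) *m map_mx intr Y = 0.
  by rewrite -[map_mx intr Y]trmxK -/S Sx trmx_mul mulmxA qG' mul0mx.
rewrite -map_mxM => /rowP h; apply/rowP => k; rewrite [RHS]mxE.
have := h k; rewrite [LHS]mxE [RHS]mxE => /eqP.
by rewrite intr_eq0 => /eqP.
Qed.

Lemma nb_bigcup_le (I T : choiceType) (D : set I) (F : I -> set T) (c : nat) :
  finite_set D -> (forall i, D i -> finite_set (F i) /\ (nb (F i) <= c)%N) ->
  (nb (\bigcup_(i in D) F i) <= nb D * c)%N.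
Proof.
move=> fD hF; rewrite -{1}(fset_setK fD).
have h i : i \in (fset_set D : seq I) -> finite_set (F i) /\ (nb (F i) <= c)%N.
  by move=> iD; apply: hF; apply/set_mem; rewrite -in_fset_set.
apply: leq_trans (nb_bigcup (fun i iD => (h i iD).1)) _.
apply: (@leq_trans (\sum_(i <- fset_set D) c)%N).
  by rewrite big_seq [leqRHS]big_seq; apply: leq_sum => i iD; have [] := h i iD.
by rewrite big_const_seq iter_addn_0 count_predT mulnC.
Qed.

Lemma nb_ffun (T U : choiceType) (n : nat) (A : set T) (B : set U) (f : 'I_n -> U -> T) :
  finite_set A -> (forall Y k, B Y -> A (f k Y)) ->
  {in B &, forall Y Z, (forall k, f k Y = f k Z) -> Y = Z} -> (0 < nb A)%N ->
  finite_set B /\ (nb B <= nb A ^ n)%N.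
Proof.
move=> fA AB fi A0; have [a Aa] : A !=set0.
  apply/set0P; apply/eqP => A00; move: A0; rewrite A00 /nb fset_set0.
  by rewrite cardfs0.
pose s : seq T := fset_set A.
have inA x : A x -> x \in s by move=> Ax; rewrite in_fset_set // mem_set.
have idx x : A x -> (index x s < (nb A).-1.+1)%N by move=> /inA xs; rewrite prednK // index_mem.
pose g Y := [ffun k : 'I_n => inord (index (f k Y) s) : 'I_(nb A).-1.+1].
have gi : {in B &, injective g}.
  move=> Y Z BY BZ /ffunP gYZ; apply: fi => // k; move: BY BZ => /set_mem BY /set_mem BZ.
  have := congr1 val (gYZ k); rewrite !ffunE /= !inordK ?idx //; try exact: AB.
  by move=> /(congr1 (nth a s)); rewrite !nth_index //; apply/inA/AB.
have fT := @finite_finset {ffun 'I_n -> 'I_(nb A).-1.+1} setT.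
split; first exact: finite_inj fT gi _.
apply: leq_trans (nb_inj fT gi _) _ => //.
by rewrite nb_setT card_ffun !card_ord prednK.
Qed.

(** A vector of sup norm [k] is determined by the position and the sign of a maximal entry together
    with the other [d] entries. *)
Lemma nb_sphere (d k : nat) :
  (nb [set q : 'rV[int]_d.+1 | exists i0, absz (q 0%R i0) = k /\
     forall i, (absz (q 0%R i) <= absz (q 0%R i0))%N] <= d.+1 * 2 * (k * 2).+1 ^ d)%N.
Proof.
set A := [set q | _].
have /choice[i0 hi0] : forall q : 'rV[int]_d.+1, exists i0, A q -> absz (q 0 i0) = k /\
     forall i, (absz (q 0%R i) <= absz (q 0%R i0))%N.
  move=> q; have [[i h]|nA] := pselect (A q); first by exists i.
  by exists 0 => /nA.
pose g (q : 'rV[int]_d.+1) := ((i0 q, 0 <= q 0 (i0 q)), col' (i0 q) q).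
have gi : {in A &, injective g}.
  move=> q q' /set_mem/hi0[qk _] /set_mem/hi0[qk' _] [e s c].
  apply/rowP => i; case: (unliftP (i0 q) i) => [l ->|->].
    have := congr1 (fun M : 'rV_d => M 0 l) c; rewrite !mxE -e => ->.
    by rewrite e.
  by move: s qk qk'; rewrite -e; lia.
have fT : finite_set ([set: 'I_d.+1 * bool] `*` box d k).
  by apply: finite_setX; [exact: finite_finset | exact: finite_box].
apply: leq_trans (nb_inj fT gi _) _.
  by move=> q /hi0[qk qm]; split=> // l; rewrite /g /= mxE -qk.
rewrite nb_setX; [| exact: finite_finset | exact: finite_box].
by rewrite nb_setT card_prod card_ord card_bool leq_mul2l nb_box orbT.
Qed.

(** Telescoping, with the square of [B + 1] bounded below by [B (B + 1)]. *)
Lemma sum_inv_sq (P B : nat) : (0 < P)%N -> (P <= B)%N ->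
  \sum_(P <= k < B) (k.+1%:R ^- 2) <= P%:R^-1 - B%:R^-1 :> rat.
Proof.
move=> P0; elim: B => [|B IHB]; first by rewrite leqn0 => /eqP P00; rewrite P00 in P0.
rewrite leq_eqVlt => /orP[/eqP <-|]; first by rewrite big_geq // subrr.
rewrite ltnS => PB; rewrite big_nat_recr //=; have := IHB PB.
have B0 : 0 < B%:R :> rat by rewrite ltr0n (leq_trans P0).
suff h : B.+1%:R ^- 2 <= B%:R^-1 - B.+1%:R^-1 :> rat.
  by move=> IH; apply: le_trans (lerD IH h) _; rewrite addrA subrK.
have B1 : 0 < B.+1%:R :> rat by rewrite ltr0n.
have -> : B%:R^-1 - B.+1%:R^-1 = (B%:R * B.+1%:R)^-1 :> rat.
  by rewrite -natr1 in B1 *; field; rewrite !gt_eqF.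
rewrite lef_pV2 ?posrE ?mulr_gt0 ?exprn_gt0 //.
by rewrite expr2 ler_pM2r // ler_nat.
Qed.

Section SingularCount.
Context {d n : nat} (dn : (d.+1 < n)%N).

(** The tail of the count: bounded matrices of deficient row rank all of whose integral row
    relations exceed the size [P]. *)
Definition short_singular (P m : nat) : set 'M[int]_(d.+1, n) :=
  [set Y : 'M[int]_(d.+1, n) | [/\ forall i k, (absz (Y i k) <= m)%N,
     exists2 q : 'rV[int]_d.+1, q != 0 & q *m Y = 0 &
     forall q : 'rV[int]_d.+1, q != 0 -> box d.+1 P q -> q *m Y != 0]].

Lemma finite_mx_box m : finite_set [set Y : 'M[int]_(d.+1, n) | forall i k, (absz (Y i k) <= m)%N].
Proof.
apply: (@finite_inj _ _ mxvec _ (box _ m)); first exact: finite_box.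
  by move=> x y _ _; apply: (can_inj mxvecK).
by move=> Y Ym l; case/mxvec_indexP: l => i k; rewrite mxvecE.
Qed.

Let A m := (((d.+1 * m).+1 * 2).+1 ^ d)%N.

Let annihilated (m : nat) (q : 'rV[int]_d.+1) : set 'M[int]_(d.+1, n) :=
  [set Y : 'M[int]_(d.+1, n) | (forall i k, (absz (Y i k) <= m)%N) /\ q *m Y = 0].

(** The primitive normals of sup norm [k] delivered by [singular_annihilator], with the data that
    [hyperplane_count] requires. *)
Let good (m k : nat) : set 'rV[int]_d.+1 := [set q |
  exists t i0, exists G : 'M[int]_(d, d.+1),
    [/\ dot q t = 1, q 0 i0 != 0, forall k, dot q (row k G) = 0,
        forall k l, (absz (G k l) <= m)%N & row_free (map_mx intr G : 'M[rat]_(d, d.+1))] /\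
    absz (q 0%R i0) = k /\ forall i, (absz (q 0%R i) <= absz (q 0%R i0))%N].

(** Each of the [n] columns of an annihilated matrix lies in the box and in the hyperplane of [q],
    which leaves at most [A m / k] choices. The zero vector is one of them, so [k <= A m] and the
    range of [k] is finite. *)
Let good_count m k q : (0 < m)%N -> good m k q ->
  (0 < k <= A m)%N /\ (nb (annihilated m q) <= (A m %/ k) ^ n)%N.
Proof.
move=> m0 [t [i0 [G [[qt qi0 qG Gm Gf] [qk _]]]]].
have := hyperplane_count m0 qt qi0 qG Gm Gf; rewrite qk -/(A m) => hc.
have k0 : (0 < k)%N by rewrite -qk absz_gt0.
set B := [set x | _] in hc.
have fB : finite_set B by apply: sub_finite_set (finite_box d.+1 m) => x [].
have B0 : (0 < nb B)%N.
  apply: (@leq_trans (nb [set` [:: 0 : 'rV[int]_d.+1]])); first by rewrite nb_seq.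
  apply: nbS => // x /=; rewrite inE => /eqP ->; split; first by move=> i; rewrite mxE.
  by rewrite /dot big1 // => i _; rewrite mxE mulr0.
split; first by rewrite k0 (leq_trans _ hc) // leq_pmull.
have [||_ hB] := @nb_ffun _ _ n B (annihilated m q) (fun k Y => (col k Y)^T) fB _ _ B0.
- move=> Y l [Ym qY]; split; first by move=> i; rewrite !mxE.
  have := congr1 (fun M : 'rV_n => M 0 l) qY; rewrite [RHS]mxE => h; apply: etrans h.
  by rewrite mxE; apply: eq_bigr => i _; rewrite !mxE.
- move=> Y Z _ _ YZ; apply/matrixP => i l; have := congr1 (fun M : 'rV_d.+1 => M 0 i) (YZ l).
  by rewrite !mxE.
apply: leq_trans hB _.
by rewrite leq_exp2r ?(leq_trans _ dn) // leq_divRL.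
Qed.

(** Sort the matrices by the sup norm [k > P] of a primitive annihilator. The sphere of radius [k]
    contributes a factor of order [k ^ d] and the columns [(A m / k) ^ n]; as [d + 2 <= n], the sum
    over [k] is dominated by that of the inverse squares. *)
Lemma singular_count : exists C : nat, forall P m, (0 < P)%N -> (0 < m)%N ->
  (P * nb (short_singular P m) <= C * m ^ (d * n))%N.
Proof.
(* [3 ^ d] comes from [2 k + 1 <= 3 k], and the base [2 d + 5] from
   [2 ((d + 1) m + 1) + 1 <= (2 d + 5) m]. *)
exists ((d.+1 * 2 * 3 ^ d) * ((2 * d).+1 + 4) ^ (d * n))%N => P m P0 m0.
have sub : short_singular P m `<=`
    \bigcup_(k in [set` iota P.+1 (A m - P)]) \bigcup_(q in good m k) annihilated m q.
  move=> Y [Ym [q0 q00 q0Y] hP].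
  have [q [t [i0 [G [[qt qi0 qG Gm Gf] [qY qmax]]]]]] := singular_annihilator m0 Ym q00 q0Y.
  have gq : good m (absz (q 0 i0)) q by exists t, i0, G.
  have [/andP[_ kA] _] := good_count m0 gq.
  exists (absz (q 0 i0)); last by exists q.
  rewrite /= mem_iota; have Pk : (P < absz (q 0%R i0))%N.
    rewrite ltnNge; apply/negP => kP; have : q *m Y != 0.
      apply: hP => [|i]; last exact: leq_trans (qmax i) kP.
      by apply: contraNneq qi0 => ->; rewrite mxE.
    by rewrite qY eqxx.
  by rewrite Pk /=; lia.
have fgood k : finite_set (good m k).
  by apply: sub_finite_set (finite_box d.+1 k) => q [t [i0 [G [_ [<- qm]]]]].
have fann q : finite_set (annihilated m q).
  by apply: sub_finite_set (finite_mx_box m) => Y [].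
have fU k : finite_set (\bigcup_(q in good m k) annihilated m q).
  by apply: bigcup_finite.
have cU k : (nb (\bigcup_(q in good m k) annihilated m q) <=
    (d.+1 * 2 * (k * 2).+1 ^ d) * (A m %/ k) ^ n)%N.
  apply: leq_trans (nb_bigcup_le (fgood k) (c := ((A m %/ k) ^ n)%N) _) _.
    by move=> q gq; split=> //; case: (good_count m0 gq).
  rewrite leq_mul2r; apply/orP; right; apply: leq_trans (nb_sphere d k); apply: nbS.
    by apply: sub_finite_set (finite_box d.+1 k) => q [i0 [<- qm]].
  by move=> q [t [i0 [G [_ h]]]]; exists i0.
have := nbS _ sub => /(_ (bigcup_finite (finite_seq _) (fun k _ => fU k))).
move=> /leq_trans/(_ (nb_bigcup (fun k _ => fU k))).
move=> /leq_trans/(_ (leq_sum _ (fun k _ => cU k))) hs.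
rewrite -(ler_nat rat) natrM -[P%:R]invrK ler_pdivrMl ?invr_gt0 ?ltr0n //.
have {}hs : (nb (short_singular P m))%:R <=
   \sum_(k <- iota P.+1 (A m - P)) ((d.+1 * 2 * 3 ^ d * A m ^ n)%N%:R * (k%:R ^- 2)) :> rat.
  apply: (@le_trans _ _ (\sum_(i <- iota P.+1 (A m - P)) d.+1 * 2 * (i * 2).+1 ^ d * (A m %/ i) ^ n)%N%:R).
    by rewrite ler_nat.
  rewrite natr_sum big_seq [leRHS]big_seq; apply: ler_sum => k; rewrite mem_iota => /andP[Pk _].
  have k0 : (0 < k)%N by apply: leq_trans Pk.
  have kR : 0 < k%:R :> rat by rewrite ltr0n.
  have kRn e : 0 < k%:R ^+ e :> rat by rewrite exprn_gt0.
  rewrite ler_pdivlMr // -natrX -natrM ler_nat.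
  rewrite -!mulnA leq_mul2l /= leq_mul2l /=.
  have h1 : ((k * 2).+1 ^ d <= 3 ^ d * k ^ d)%N.
    by rewrite -expnMn; case: (d) => // d'; rewrite leq_exp2r //; lia.
  have h2 : (k ^ d * ((A m %/ k) ^ n * k ^ 2) <= A m ^ n)%N.
    apply: (@leq_trans ((A m %/ k) ^ n * k ^ n)); last first.
      by rewrite -expnMn leq_exp2r ?leq_trunc_div // (leq_trans _ dn).
    rewrite mulnCA leq_mul2l; apply/orP; right; rewrite -expnD leq_pexp2l //.
    by rewrite addn2.
  apply: leq_trans (leq_mul h1 (leqnn _)) _.
  by rewrite -mulnA leq_mul2l h2 orbT.
apply: (le_trans hs); rewrite -mulr_sumr.
have [APle|AP] := leqP (A m) P.
  have -> : (A m - P = 0)%N by apply/eqP; rewrite subn_eq0.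
  by rewrite big_nil mulr0 mulr_ge0 ?invr_ge0.
have e : \sum_(k <- iota P.+1 (A m - P)) (k%:R ^- 2) <= P%:R^-1 :> rat.
  rewrite -[iota P.+1 _]/(iota (1 + P) _) iotaDl big_map.
  apply: le_trans (_ : P%:R^-1 - (A m)%:R^-1 <= _); last by rewrite lerBlDr lerDl invr_ge0.
  by have := sum_inv_sq P0 (ltnW AP); rewrite /index_iota; under eq_bigr do rewrite -add1n.
apply: (@le_trans _ _ ((d.+1 * 2 * 3 ^ d * A m ^ n)%N%:R * P%:R^-1)); first by rewrite ler_wpM2l.
rewrite mulrC ler_pM2l ?invr_gt0 ?ltr0n // ler_nat -!mulnA; do 3 (rewrite leq_mul2l; apply/orP; right).
rewrite /A -expnM -expnMn; case: (d * n)%N => // e'; rewrite leq_exp2r //.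
by nia.
Qed.

End SingularCount.

(** * Rational hyperplanes *)

Lemma max_independent_rows (F : fieldType) (n : nat) (Pr : 'rV[F]_n -> Prop) :
  exists s (P : 'M[F]_(s, n)), [/\ row_free P, forall i, Pr (row i P) &
    forall p, Pr p -> (p <= P)%MS].
Proof.
pose Q s := `[< exists P : 'M[F]_(s, n), row_free P /\ forall i, Pr (row i P) >].
have exQ : exists s, Q s.
  by exists 0%N; apply/asboolP; exists 0; split=> [|[]//]; rewrite /row_free mxrank0.
have Qn s : Q s -> (s <= n)%N.
  by move=> /asboolP[P [Pf _]]; rewrite -(eqP Pf) rank_leq_col.
case: (ex_maxnP exQ Qn) => s /asboolP[P [Pf PP]] smax; exists s, P; split=> // p Pp.
apply: contraT => pP; have : (s.+1 <= s)%N; last by rewrite ltnn.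
apply: smax; apply/asboolP; exists (col_mx p P : 'M[F]_(1 + s, n)).
split; first exact: row_free_col_mx.
move=> l; case: (@split_ordP 1 s l) => l' ->; last by rewrite (rowKd l' p).
by rewrite (rowKu l' p) (_ : row l' p = p) //; apply/rowP => o; rewrite !mxE ord1.
Qed.

Section Classes.
Context {R : realType} {n : nat} (n0 : (0 < n)%N).
Context {L : set 'M[R]_n} (b : 'I_(n * n) -> 'M[R]_n).
Context (dL : discrete_subgroup L) (hb : indep b) (Lb : Zbasis L b).

Local Notation "A ^Q" := (map_mx (@ratr R) A) (at level 2, format "A ^Q").

(** The map [A -> p A] in lattice coordinates; its rows generate the image of the lattice under
    [p]. *)
Definition eval_mx (p : 'rV[R]_n) : 'M[R]_(n * n, n) := \matrix_i (p *m b i).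

Lemma mul_eval_mx (p : 'rV[R]_n) (x : 'rV[R]_(n * n)) :
  x *m eval_mx p = p *m of_coords b x.
Proof.
rewrite mulmx_sum_row /of_coords row_comb linear_sum; apply: eq_bigr => i _.
by rewrite rowK /= linearZ.
Qed.

Lemma eval_mxE (p : 'rV[R]_n) A : p *m A = coords b A *m eval_mx p.
Proof. by rewrite mul_eval_mx coordsK. Qed.

Fact eval_mx_is_linear : linear eval_mx.
Proof.
by move=> a p q; apply/row_matrixP => i; rewrite linearP /= !rowK mulmxDl scalemxAl.
Qed.
HB.instance Definition _ := GRing.isLinear.Build R 'rV[R]_n 'M[R]_(n * n, n) _ eval_mx
  eval_mx_is_linear.

(* [p] maps the rational span of the lattice into the one of the rows of [beta]. *)
Definition in_class (beta : 'M[R]_n) (p : 'rV[R]_n) : Prop :=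
  exists Y : 'M[rat]_(n * n, n), eval_mx p = Y^Q *m beta.

Definition rational_row (p : 'rV[R]_n) : Prop :=
  rational_space b (annih p : {vspace 'M[R]_n}).

(** As [beta] is invertible, the kernel of [p] is that of the rational matrix [Y]. *)
Lemma in_class_rational beta p : beta \in unitmx -> in_class beta p -> rational_row p.
Proof.
move=> bu [Y pY]; exists (kermx Y) => A.
rewrite mem_annih eval_mxE pY mulmxA map_kermx sub_kermx.
apply/eqP/eqP => [h|->]; last by rewrite mul0mx.
by rewrite -[LHS](mulmxK bu) h mul0mx.
Qed.

Lemma eval_mx_full p : p != 0 -> row_full (eval_mx p).
Proof.
move=> p0; rewrite -sub1mx; apply/rV_subP => y _.
apply/submxP; exists (coords b (pinvmx p *m y)); rewrite -eval_mxE mulmxA.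
have -> : p *m pinvmx p = 1%:M.
  by rewrite mulmxVp // /row_free eqn_leq rank_leq_row lt0n mxrank_eq0.
by rewrite mul1mx.
Qed.

(** The rational kernel of [p] and [n] coordinate vectors that [p] maps to a real basis [beta]
    together span all rational coordinates. Modulo the kernel, every rational vector is therefore a
    rational combination of these [n], so its image is one of the rows of [beta]. *)
Lemma rational_row_class p : p != 0 -> rational_row p ->
  exists beta, [/\ beta \in unitmx, in_class beta p &
    exists E : 'M[rat]_(n, n * n), beta = E^Q *m eval_mx p].
Proof.
move=> p0 [S hS]; have full := eval_mx_full p0.
pose f := fullrankfun full.
pose E : 'M[rat]_(n, n * n) := rowsub f 1%:M.
have EQ : E^Q = rowsub f 1%:M by apply/matrixP => i k; rewrite !mxE; case: eqP => _; rewrite ?rmorph1 ?rmorph0.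
pose beta := rowsub f (eval_mx p).
have bE : beta = E^Q *m eval_mx p by rewrite EQ mul_rowsub_mx mul1mx.
have bu : beta \in unitmx by rewrite -row_full_unit fullrowsub_full.
exists beta; split=> //; last by exists E.
have kS (x : 'rV[R]_(n * n)) : (x <= S^Q)%MS = (x *m eval_mx p == 0).
  by rewrite mul_eval_mx -mem_annih hS of_coordsK.
have SE : (1%:M <= S + E)%MS.
  rewrite -(map_submx (@ratr R)) map_mx1 map_addsmx; apply/rV_subP => x _.
  pose y := x *m eval_mx p *m invmx beta.
  rewrite -(subrK (y *m E^Q) x); apply: addmx_sub_adds; last exact: submxMl.
  rewrite kS mulmxBl -mulmxA -bE /y mulmxKV // subrr //.
have [[u v] /= uv] := sub_addsmxP SE.
exists v; rewrite bE mulmxA -map_mxM -[LHS]mul1mx -(map_mx1 (@ratr R)) uv map_mxD mulmxDl.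
rewrite [X in X + _](_ : _ = 0) ?add0r //.
apply/row_matrixP => i; rewrite row_mul row0; apply/eqP; rewrite -kS.
by apply: submx_trans (row_sub _ _) _; rewrite map_mxM submxMl.
Qed.

(** Independence of the rows of [P] makes [A -> P A] surjective over [R], so the images of the rows
    can be prescribed separately. Relative to the [beta i] this is a rational linear system;
    solvable over [R], it is solvable over [rat]. *)
Lemma joint_surjective s (P : 'M[R]_(s, n)) (beta : 'I_s -> 'M[R]_n) (k : 'I_s) (y : 'rV[rat]_n) :
  row_free P -> (forall i, beta i \in unitmx) -> (forall i, in_class (beta i) (row i P)) ->
  exists x : 'rV[rat]_(n * n), forall i,
    x^Q *m eval_mx (row i P) = (i == k)%:R *: (y^Q *m beta k).
Proof.
move=> Pf bu /choice[Y hY].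
pose Yj : 'M[rat]_(n * n, s * n) := \matrix_j mxvec (\matrix_i row j (Y i)).
(* Stated for any morphism out of [rat]: [ratr] serves the real solution, the identity the rational
   one. *)
have YjE (F : fieldType) (g : {rmorphism rat -> F}) (x : 'rV[F]_(n * n)) :
    x *m map_mx g Yj = mxvec (\matrix_i (x *m map_mx g (Y i))).
  apply/rowP => l; case/mxvec_indexP: l => i l; rewrite mxvecE !mxE.
  by apply: eq_bigr => j _; rewrite !mxE mxvecE !mxE.
pose T : 'M[rat]_(s, n) := \matrix_i ((i == k)%:R *: y).
have : (mxvec T <= Yj)%MS.
  rewrite -(map_submx (@ratr R)).
  pose A := pinvmx P *m (\matrix_i (row i T^Q *m beta i)).
  have PA i : row i P *m A = row i T^Q *m beta i.
    by rewrite -row_mul mulmxA mulmxVp // mul1mx rowK.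
  apply/submxP; exists (coords b A); rewrite YjE map_mxvec; congr mxvec.
  apply/row_matrixP => i; rewrite rowK -[LHS](mulmxK (bu i)) -PA eval_mxE hY mulmxA.
  by rewrite mulmxK.
move=> /submxP[x Tx]; exists x => i.
have /(can_inj mxvecK)/(congr1 (row i)) : mxvec T = mxvec (\matrix_i (x *m Y i)).
  rewrite Tx; have := YjE _ idfun x; rewrite map_mx_id // => ->.
  by congr mxvec; apply/row_matrixP => l; rewrite !rowK map_mx_id.
rewrite !rowK => xY; rewrite hY mulmxA -map_mxM -xY map_mxZ rmorph_nat -scalemxAl.
by case: eqP => [->|]; rewrite ?scale0r.
Qed.

Lemma eval_mx_comb s (P : 'M[R]_(s, n)) (c : 'rV[R]_s) :
  eval_mx (c *m P) = \sum_i c 0 i *: eval_mx (row i P).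
Proof.
by rewrite mulmx_sum_row linear_sum; apply: eq_bigr => i _; rewrite linearZ.
Qed.

Lemma joint_eval s (P : 'M[R]_(s, n)) (c : 'rV[R]_s) (beta : 'I_s -> 'M[R]_n) k
    (y : 'rV[rat]_n) (x : 'rV[rat]_(n * n)) :
  (forall i, x^Q *m eval_mx (row i P) = (i == k)%:R *: (y^Q *m beta k)) ->
  x^Q *m eval_mx (c *m P) = c 0 k *: (y^Q *m beta k).
Proof.
move=> hx; rewrite eval_mx_comb mulmx_sumr (bigD1 k) //= big1 => [|i ik].
  by rewrite addr0 -scalemxAr hx eqxx scale1r.
by rewrite -scalemxAr hx (negbTE ik) scale0r scaler0.
Qed.

(** Choose a rational vector that row [k] of [P] maps to a row of [beta] and the other rows map to
    0. Its image under [c P] is [c 0 k] times that row of [beta], and membership in the class makes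
    the factor rational. *)
Lemma class_coefficients s (P : 'M[R]_(s, n)) beta (c : 'rV[R]_s) :
  beta \in unitmx -> row_free P -> (forall i, in_class beta (row i P)) ->
  in_class beta (c *m P) -> exists q : 'rV[rat]_s, c = q^Q.
Proof.
move=> bu Pf PY [Y hY].
have /choice[q hq] : forall k, exists q : rat, c 0 k = ratr q.
  move=> k; pose i0 := Ordinal n0.
  have [x hx] := @joint_surjective s P (fun=> beta) k (delta_mx 0 i0) Pf (fun=> bu) PY.
  exists ((x *m Y) 0 i0).
  have := joint_eval (beta := fun=> beta) c hx; rewrite hY mulmxA -map_mxM scalemxAl.
  move=> /(can_inj (mulmxK bu))/(congr1 (fun v : 'rV_n => v 0 i0)).
  by rewrite !mxE !eqxx rmorph1 mulr1 => ->.
by exists (\row_k q k); apply/rowP => k; rewrite !mxE hq.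
Qed.

(* Write [p] in a maximal independent family of rational rows: by joint
   surjectivity, [p] shares its class with every member having a nonzero coefficient. *)
Lemma finite_classes : exists bs : seq 'M[R]_n, (forall beta, beta \in bs -> beta \in unitmx) /\
  forall p, p != 0 -> rational_row p -> exists2 c : R, c != 0 &
    exists2 beta, beta \in bs & in_class beta (c *: p).
Proof.
have [s [P [Pf PP Pmax]]] := max_independent_rows (fun p => p != 0 /\ rational_row p).
have /choice[be hbe] : forall i, exists beta, beta \in unitmx /\ in_class beta (row i P).
  by move=> i; have [p0 pr] := PP i; have [beta [? ? _]] := rational_row_class p0 pr; exists beta.
exists [seq be i | i : 'I_s]; split; first by move=> _ /mapP[i _ ->]; case: (hbe i).
move=> p p0 pr; have [c pE] := submxP (Pmax p (conj p0 pr)).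
have [k ck] : exists k, c 0 k != 0.
  apply/existsP; apply: contraR p0 => /existsPn h; rewrite pE (_ : c = 0) ?mul0mx //.
  by apply/rowP => i; rewrite mxE; apply/eqP; move: (h i); rewrite negbK.
have [beta [bu [Y hY] _]] := rational_row_class p0 pr.
have /choice[x hx] : forall i : 'I_n, exists x : 'rV[rat]_(n * n),
    x^Q *m eval_mx p = c 0 k *: ((delta_mx 0 i : 'rV[rat]_n)^Q *m be k).
  move=> i; have [x hx] := @joint_surjective s P be k (delta_mx 0 i) Pf
    (fun i => (hbe i).1) (fun i => (hbe i).2).
  by exists x; rewrite pE; apply: joint_eval hx.
pose W := \matrix_i (x i *m Y).
(* [W] is a rational change of basis between [beta] and the multiple of [be k], so both define the
   same class up to the scalar [c 0 k]. *)
have WE : W^Q *m beta = c 0 k *: be k.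
  apply/row_matrixP => i; rewrite row_mul -map_row rowK map_mxM -mulmxA -hY hx.
  rewrite linearZ /=; congr (_ *: _); rewrite [RHS]rowE; congr (_ *m _).
  by apply/rowP => l; rewrite !mxE; case: (_ && _); rewrite ?rmorph1 ?rmorph0.
have Wu : W \in unitmx.
  rewrite -(map_unitmx (@ratr R)); have : W^Q *m beta \in unitmx.
    by rewrite WE unitmxZ ?unitfE // (hbe k).1.
  by rewrite unitmx_mul => /andP[].
exists (c 0 k)^-1; first by rewrite invr_eq0.
exists (be k); first by apply/mapP; exists k => //; rewrite mem_enum.
exists (Y *m invmx W); rewrite linearZ /= hY.
have -> : beta = (invmx W)^Q *m (c 0 k *: be k).
  by rewrite -WE mulmxA -map_mxM mulVmx // map_mx1 mul1mx.
by rewrite -!scalemxAr scalerA mulVf // scale1r map_mxM mulmxA.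
Qed.

Lemma subgroup_Mz (A : set 'M[R]_n) x (z : int) : is_subgroup A -> A x -> A (x *~ z).
Proof.
move=> hA Ax; have nat_ok m : A (x *+ m).
  elim: m => [|m IHm]; first by rewrite mulr0n; case: hA.
  by rewrite mulrS; apply: is_subgroupD.
by case: z => m; rewrite ?NegzE ?mulrNz; [|apply: is_subgroupN => //]; apply: nat_ok.
Qed.

Lemma Zspan_sub k (a : 'I_k -> 'M[R]_n) (A : set 'M[R]_n) : is_subgroup A ->
  (forall i, A (a i)) -> Zspan a `<=` A.
Proof.
move=> hA aA _ [z ->]; elim/big_ind: _ => [|x y Ax Ay|i _]; first by case: hA.
  exact: is_subgroupD.
exact: subgroup_Mz.
Qed.

Lemma int_lattice_Zspan (g1 g2 : 'M[R]_n) :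
  [set g1 *m map_mx intr z *m g2 | z in [set: 'M[int]_n]] =
  Zspan (fun l : 'I_(n * n) => g1 *m vec_mx (delta_mx 0 l) *m g2).
Proof.
have E (z : 'I_(n * n) -> int) : g1 *m map_mx intr (vec_mx (\row_l z l)) *m g2 =
    \sum_l g1 *m vec_mx (delta_mx 0 l) *m g2 *~ z l.
  have -> : map_mx intr (vec_mx (\row_l z l)) = \sum_l (z l)%:~R *: vec_mx (delta_mx 0 l) :> 'M[R]_n.
    rewrite map_vec_mx [map_mx _ _]row_sum_delta linear_sum; apply: eq_bigr => l _.
    by rewrite linearZ /= !mxE.
  rewrite mulmx_sumr mulmx_suml; apply: eq_bigr => l _.
  by rewrite -scalemxAr -scalemxAl scaler_int.
apply/seteqP; split=> [_ [z _ <-]|_ [z ->]].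
  exists (fun l => mxvec z 0 l); rewrite -E; congr (_ *m map_mx _ _ *m _).
  by rewrite -[LHS]mxvecK; congr vec_mx; apply/rowP => l; rewrite mxE.
by exists (vec_mx (\row_l z l)) => //; rewrite E.
Qed.

Lemma class_integral s (P : 'M[R]_(s, n)) beta : (forall i, in_class beta (row i P)) ->
  exists2 d : nat, (0 < d)%N &
    forall v, L v -> exists Z : 'M[int]_(s, n), d%:R *: (P *m v) = map_mx intr Z *m beta.
Proof.
move=> /choice[Y hY].
have [d d0 hd] := common_denominator (fun t : 'I_s * 'I_(n * n) * 'I_n => Y t.1.1 t.1.2 t.2).
exists d => // v /(latticeP hb Lb)[z vz].
have /choice[U hU] : forall i, exists U : 'M[int]_(n * n, n), d%:R *: Y i = map_mx intr U.
  move=> i; have /choice[u hu] : forall t : 'I_(n * n) * 'I_n, exists u : int, Y i t.1 t.2 * d%:R = u%:~R.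
    by move=> t; apply: (hd (i, t.1, t.2)).
  by exists (\matrix_(j, l) u (j, l)); apply/matrixP => j l; rewrite !mxE mulrC (hu (j, l)).
exists (\matrix_i (z *m U i)); apply/row_matrixP => i.
rewrite linearZ /= !row_mul eval_mxE vz hY -map_row rowK map_mxM -[map_mx _ (U i)]map_ratr_int -hU.
by rewrite map_mxZ rmorph_nat -scalemxAr -!scalemxAl mulmxA.
Qed.

(* For [s = n] the lattice is commensurable with [P^-1 M_n(Z) beta]. *)
Lemma class_dim s (P : 'M[R]_(s, n)) beta : ~ Qsplit_type L ->
  beta \in unitmx -> row_free P -> (forall i, in_class beta (row i P)) -> (s < n)%N.
Proof.
move=> nsplit bu Pf PY; rewrite ltn_neqAle -{2}(eqP Pf) rank_leq_col andbT.
apply/negP => /eqP sn; apply: nsplit; subst s.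
have Pu : P \in unitmx by rewrite -row_free_unit.
have [d d0 hd] := class_integral PY.
have dR : d%:R != 0 :> R by rewrite pnatr_eq0 -lt0n.
have bL i : L (b i) := Zbasis_mem i Lb.
have /choice[Z hZ] : forall j, exists Z : 'M[int]_n, d%:R *: (P *m b j) = map_mx intr Z *m beta.
  by move=> j; apply: hd.
(* The denominator [d] is absorbed in the right factor, so that [L] lies inside the split
   lattice. *)
exists (invmx P), (d%:R^-1 *: beta); split; [by rewrite unitmx_inv | by rewrite unitmxZ // unitrV unitfE |].
set G := [set _ | _ in _].
have GZ : G = Zspan (fun l : 'I_(n * n) => invmx P *m vec_mx (delta_mx 0 l) *m (d%:R^-1 *: beta)).
  exact: int_lattice_Zspan.
(* Conversely the generators, up to the factor [d], have rational lattice coordinates [x l]; their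
   common denominator [e] brings them into [L]. *)
have /choice[x hx] : forall l : 'I_(n * n), exists x : 'rV[rat]_(n * n),
    of_coords b x^Q = invmx P *m vec_mx (delta_mx 0 l) *m beta.
  move=> l; case/mxvec_indexP: l => i l.
  have [x hx] := @joint_surjective n P (fun=> beta) i (delta_mx 0 l) Pf (fun=> bu) PY.
  exists x; rewrite -[LHS](mulKmx Pu) -mulmxA; congr (_ *m _).
  apply/row_matrixP => k; rewrite !row_mul -mul_eval_mx hx scalemxAl; congr (_ *m _).
  by apply/rowP => q; rewrite vec_mx_delta !mxE eqxx /= rmorph_nat -natrM mulnb.
have [e e0 he] := common_denominator (fun t : 'I_(n * n) * 'I_(n * n) => x t.1 0 t.2).
have sL : is_subgroup L by case: dL.
have LZ : L = Zspan b by apply/seteqP; split=> v /Lb.1.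
have inL l : L (e%:R *: of_coords b (x l)^Q).
  have /choice[z hz] : forall k, exists z : int, x l 0 k * e%:R = z%:~R by move=> k; apply: (he (l, k)).
  apply/(latticeP hb Lb); exists (\row_k z k); rewrite linearZ /= of_coordsK //.
  apply/rowP => k; rewrite !mxE -[RHS](ratr_int R) -hz rmorphM /= rmorph_nat mulrC //.
rewrite GZ LZ; apply: (@commensurable_Zspan _ _ _ _ _ (d * e)).
- by rewrite muln_gt0 d0.
- have sG := Zspan_subgroup (fun l : 'I_(n * n) => invmx P *m vec_mx (delta_mx 0 l) *m (d%:R^-1 *: beta)).
  move=> v Lv; rewrite pmulrn; apply: subgroup_Mz => //.
  apply: (Zspan_sub sG _ Lv) => i; rewrite -GZ; exists (Z i) => //.
  rewrite -mulmxA -scalemxAr -hZ scalerA mulVf // scale1r mulmxA mulVmx // mul1mx.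
  by [].
move=> _ [z ->]; rewrite -LZ -sumrMnl.
elim/big_ind: _ => [|u v Lu Lw|l _]; [by case: sL | exact: is_subgroupD |].
rewrite pmulrn -mulrzA mulrC mulrzA; apply: subgroup_Mz => //.
rewrite -pmulrn -scalemxAr -hx -scaler_nat scalerA natrM mulrAC divff // mul1r.
exact: inL.
Qed.

End Classes.

(** * Counting in one class of hyperplanes *)

Section Bounds.
Context {R : realType}.

Lemma near_pinfty_ex (P : R -> Prop) : (\forall T \near +oo, P T) ->
  exists2 T0 : R, 0 < T0 & forall T, T0 <= T -> P T.
Proof.
move=> [M [_ hM]]; exists (`|M| + 1); first by rewrite ltr_wpDl.
by move=> T MT; apply: hM; apply: lt_le_trans MT; rewrite ltr_pwDr // ler_norm.
Qed.

Lemma mulmx_entry_le m k l (A : 'M[R]_(m, k)) (B : 'M[R]_(k, l)) i j c :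
  0 <= c -> (forall h, `|B h j| <= c) -> `|(A *m B) i j| <= (\sum_h `|A i h|) * c.
Proof.
move=> c0 Bc; rewrite mxE; apply: le_trans (ler_norm_sum _ _ _) _.
by rewrite mulr_suml; apply: ler_sum => h _; rewrite normrM ler_wpM2l.
Qed.

Lemma is_norm_entry n (N : 'M[R]_n -> R) : is_norm N ->
  exists2 C : R, 0 < C & forall (v : 'M[R]_n) i j, `|v i j| <= C * N v.
Proof.
move=> hN; have [c c0 hc] := is_norm_lower (is_norm_comp (f := vec_mx) (can_inj vec_mxK) hN).
exists c^-1; first by rewrite invr_gt0.
move=> v i j; rewrite ler_pdivlMl //; have := hc (mxvec v); rewrite /= mxvecK.
by apply: le_trans; rewrite ler_pM2l // -mxvecE mx_entry_le.
Qed.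

Lemma bilinear_entry_le n m (N : 'M[R]_n -> R) (A : 'M[R]_(m, n)) (B : 'M[R]_n) : is_norm N ->
  exists2 C : R, 0 < C & forall (v : 'M[R]_n) i j, `|(A *m v *m B) i j| <= C * N v.
Proof.
move=> hN; have [C C0 hC] := is_norm_entry hN.
pose SA := \sum_i \sum_h `|A i h|; pose SB := \sum_h \sum_j `|B h j|.
have SA0 : 0 <= SA by do 2 apply: sumr_ge0 => ? _.
have SB0 : 0 <= SB by do 2 apply: sumr_ge0 => ? _.
have N0 v : 0 <= N v by apply: is_norm_ge0.
exists ((SA * C + 1) * (SB + 1)); first by rewrite mulr_gt0 // ltr_wpDl // mulr_ge0 // ltW.
move=> v i j.
have h1 k : `|(A *m v) i k| <= SA * (C * N v).
  have C0v : 0 <= C * N v by rewrite mulr_ge0 // ltW.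
  apply: le_trans (@mulmx_entry_le _ _ _ A v i k _ C0v (fun h => hC v h k)) _.
  apply: ler_wpM2r; first by rewrite mulr_ge0 // ltW.
  by rewrite /SA (bigD1 i) //= lerDl; do 2 apply: sumr_ge0 => ? _.
rewrite mxE; apply: le_trans (ler_norm_sum _ _ _) _.
apply: (@le_trans _ _ (\sum_h (SA * (C * N v)) * `|B h j|)).
  by apply: ler_sum => h _; rewrite normrM ler_wpM2r.
rewrite -mulr_sumr.
have h2 : \sum_h `|B h j| <= SB.
  by apply: ler_sum => h _; rewrite (bigD1 j) //= lerDl sumr_ge0.
have h3 : 0 <= \sum_h `|B h j| by apply: sumr_ge0.
rewrite [leRHS]mulrAC mulrA; apply: ler_pM => //.
- by rewrite !mulr_ge0 // ltW.
- by rewrite mulrDl mul1r; apply: ler_wpDr.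
- by lra.
Qed.

End Bounds.

Section ClassTail.
Context {R : realType} {n : nat} (n2 : (2 <= n)%N).
Context {L : set 'M[R]_n} (b : 'I_(n * n) -> 'M[R]_n).
Context (dL : discrete_subgroup L) (hb : indep b) (Lb : Zbasis L b).
Context (N : 'M[R]_n -> R) (hN : is_norm N).

Lemma finite_ball T : finite_set (L `&` [set v | N v < T]).
Proof. have h := finite_lattice_ball hN hb Lb T. exact: h. Qed.

Lemma rational_count (V : {vspace 'M[R]_n}) : Defs.rational L V ->
  exists2 l : R, 0 < l &
  (T ^- (\dim V) * (nb (L `&` [set` V] `&` [set v | N v < T]))%:R) @[T --> +oo] --> l.
Proof.
move=> rV; have [c [cZ ci _ _]] := rational_basis rV.
have h := lattice_count hN ci cZ; exact: h.
Qed.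

Lemma rational_count_le (V : {vspace 'M[R]_n}) : Defs.rational L V ->
  exists2 K : R, 0 < K & exists2 T0, 0 < T0 & forall T, T0 <= T ->
    (nb (L `&` [set` V] `&` [set v | N v < T]))%:R <= K * T ^+ (\dim V).
Proof.
move=> /rational_count[l l0 hl]; exists (l + 1); first by rewrite addr_gt0.
have l1 : l < l + 1 by rewrite ltrDl.
have [T0 T00 hT] := near_pinfty_ex (cvgr_lt _ hl _ l1).
exists T0 => // T TT; have T0' : 0 < T by apply: lt_le_trans TT.
by have /ltW := hT _ TT; rewrite ler_pdivrMl ?exprn_gt0 // mulrC.
Qed.

(** The bound is uniform in the coset: subtracting one of its points in the ball moves the others
    into [V] and at most doubles the radius. *)
Lemma coset_count (V : {vspace 'M[R]_n}) : Defs.rational L V ->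
  exists2 K : R, 0 < K & exists2 T0, 0 < T0 & forall T v0, T0 <= T ->
    (nb ([set v | L v /\ v - v0 \in V] `&` [set v | N v < T]))%:R <= K * T ^+ (\dim V).
Proof.
move=> rV; have [K K0 [T0 T00 hK]] := rational_count_le rV.
exists (K * 2 ^+ \dim V); first by rewrite mulr_gt0 // exprn_gt0.
exists T0 => // T v0 TT; have Tp : 0 < T by apply: lt_le_trans TT.
set A := _ `&` _; have [->|/set0P[w [[Lw wV] wT]]] := eqVneq A set0.
  by rewrite /nb fset_set0 cardfs0 mulr_ge0 ?exprn_ge0 ?mulr_ge0 ?exprn_ge0 // ltW.
have T2 : T0 <= 2 * T by lra.
rewrite -mulrA -exprMn; apply: le_trans (hK _ T2); rewrite ler_nat.
apply: (@nb_inj _ _ (fun v => v - w)).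
- by apply: sub_finite_set (finite_ball (2 * T)) => v [[]].
- by move=> x y _ _ /addIr.
move=> v [[Lv vV] vT]; split; [split|].
- by case: dL => -[_ LB] _; apply: LB.
- have e : v - w = (v - v0) - (w - v0) by rewrite opprB addrA subrK.
  by rewrite /= e; apply: memvB.
- by rewrite /=; apply: le_lt_trans (is_normB hN _ _) _; rewrite /= in wT vT; lra.
Qed.

Lemma rational_space_bigcap s (V : 'I_s -> {vspace 'M[R]_n}) :
  (forall i, rational_space b (V i)) -> rational_space b (\bigcap_i V i)%VS.
Proof.
move=> hV; elim/big_ind: _ => [|U W|i _]; [|exact: rational_spaceI|exact: hV].
by exists 1%:M => A; rewrite memvf map_mx1 submx1.
Qed.

Lemma annih_rows s (P : 'M[R]_(s, n)) :
  annih P = (\bigcap_i annih (row i P))%VS :> {vspace 'M[R]_n}.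
Proof.
apply/vspaceP => A; rewrite mem_annih [RHS]memvE; apply/eqP/subv_bigcapP => [PA i _|h].
  by rewrite -memvE mem_annih -row_mul PA row0.
apply/row_matrixP => i; rewrite row_mul row0; apply/eqP; rewrite -mem_annih memvE.
exact: h.
Qed.

Local Notation "A ^Q" := (map_mx (@ratr R) A) (at level 2, format "A ^Q").

(** The fibre dimension plus the exponent of [singular_count]. *)
Lemma codim_split d : (d.+1 < n)%N -> (n * (n - 1) = (n - d.+1) * n + d * n)%N.
Proof. by move=> dn; rewrite -mulnDl mulnC; congr (_ * _)%N; lia. Qed.

(** The integral map [psi], a multiple of [P v] in coordinates of [beta], has cosets of [annih P] as
    fibres. The listed hyperplanes come from the integral relations of size at most [P0], so the
    remaining points map into [short_singular P0 m], and a large [P0] makes the product of the two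
    bounds small. *)
Lemma class_tail (nsplit : ~ Qsplit_type L) beta (e : R) : beta \in unitmx -> 0 < e ->
  exists F : seq {vspace 'M[R]_n}, (forall V, V \in F -> Defs.rational L V /\
      exists2 p : 'rV[R]_n, p != 0 & V = annih p) /\
  exists2 T0, 0 < T0 & forall T, T0 <= T ->
    (nb [set v | [/\ L v, N v < T, exists2 p, p != 0 & in_class b beta p /\ p *m v = 0 &
          forall V, V \in F -> v \notin V]])%:R <= e * T ^+ (n * (n - 1)).
Proof.
move=> bu e0; have n0 : (0 < n)%N by apply: leq_trans n2.
have alg (k x c y z p : R) : k * x * (c * (y * z) / p) = k * c * y / p * (x * z) by ring.
have [s [P [Pf PP Pmax]]] := max_independent_rows (in_class b beta).
have sn := class_dim dL hb Lb nsplit bu Pf PP.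
(* If [s = 0], the class contains no nonzero row and nothing is counted. *)
case: s P Pf PP Pmax sn => [|d] P Pf PP Pmax dn.
  exists [::]; split=> //; exists 1 => // T T1.
  rewrite (_ : [set _ | _] = set0) ?/nb ?fset_set0 ?cardfs0.
    by rewrite mulr_ge0 ?exprn_ge0 // ?ltW // (lt_le_trans _ T1).
  rewrite -subset0 => v [_ _ [p p0 [/Pmax pP _]] _]; case/eqP: p0.
  by apply/eqP; rewrite -mxrank_eq0 -leqn0 (leq_trans (mxrankS pP)) // rank_leq_row.
have [d0 d00 hd0] := class_integral hb Lb PP.
have d0R : d0%:R != 0 :> R by rewrite pnatr_eq0 -lt0n.
have /choice[psi hpsi] : forall v, exists Z : 'M[int]_(d.+1, n),
    L v -> d0%:R *: (P *m v) = map_mx intr Z *m beta.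
  move=> v; have [/hd0[Z hZ]|nL] := pselect (L v); first by exists Z.
  by exists 0 => /nL.
have psiE v : L v -> map_mx intr (psi v) = d0%:R *: P *m v *m invmx beta.
  by move=> Lv; rewrite -scalemxAl hpsi // mulmxK.
have [C C0 hC] := bilinear_entry_le (d0%:R *: P) (invmx beta) hN.
have rP : Defs.rational L (annih P).
  apply/(rational_spaceP dL hb Lb); rewrite annih_rows; apply: rational_space_bigcap => i.
  by have := in_class_rational hb bu (PP i).
have [K K0 [T1 T10 hK]] := coset_count rP.
have [C2 hC2] := singular_count dn.
(* Product of the constants for the fibres, for the image, and for [m <= 2 * C * T]; [P0] is taken
   above [B / e]. *)
pose B := K * C2%:R * (2 * C) ^+ (d * n).
have B0 : 0 <= B by rewrite !mulr_ge0 ?exprn_ge0 ?mulr_ge0 // ltW.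
pose P0 := (Num.trunc (B / e)).+1.
have P0B : B / P0%:R <= e.
  rewrite ler_pdivrMr ?ltr0n // mulrC -ler_pdivrMr //.
  by have /andP[_ /ltW] := truncn_itv (divr_ge0 B0 (ltW e0)).
pose D : set 'rV[int]_d.+1 := box d.+1 P0 `&` [set q | q != 0].
have fD : finite_set D by apply: sub_finite_set (finite_box d.+1 P0) => q [].
pose pq (q : 'rV[int]_d.+1) : 'rV[R]_n := real_row q *m P.
have pq0 q : q != 0 -> pq q != 0.
  apply: contraNneq => /(congr1 (mulmx^~ (pinvmx P))); rewrite mul0mx mulmxKp // => /rowP h.
  by apply/eqP/rowP => i; apply/eqP; have := h i; rewrite !mxE => /eqP; rewrite intr_eq0.
have pqc q : in_class b beta (pq q).
  have /choice[Y hY] := PP; exists (\sum_i (q 0 i)%:~R *: Y i).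
  rewrite eval_mx_comb raddf_sum mulmx_suml; apply: eq_bigr => i _.
  by rewrite mxE hY /= map_mxZ /= ratr_int scalemxAl.
exists [seq annih (pq q) | q <- fset_set D]; split.
  move=> _ /mapP[q + ->]; rewrite in_fset_set // => /set_mem[_ q0]; split.
    by apply/(rational_spaceP dL hb Lb); have := in_class_rational hb bu (pqc q).
  by exists (pq q) => //; apply: pq0.
(* [T >= C^-1] gives [1 <= C * T], which absorbs the rounding of [C * T] up to [m]. *)
exists (Num.max T1 C^-1); first by rewrite lt_max T10.
move=> T; rewrite ge_max => /andP[T1T CT].
have Tp : 0 < T by apply: lt_le_trans T1T.
set S := [set v | _].
have fS : finite_set S by apply: sub_finite_set (finite_ball T) => v [].
pose m := (Num.trunc (C * T)).+1.
have /andP[m1 m2] := truncn_itv (ltW (mulr_gt0 C0 Tp)).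
have CT1 : 1 <= C * T by rewrite -ler_pdivrMl // mulr1.
have mT : m%:R <= 2 * C * T by rewrite /m -natr1; lra.
have sub : psi @` S `<=` short_singular P0 m.
  move=> _ [v [Lv vT [p p0 [pc pv]] vF] <-]; split.
  - move=> i k; have : `|(psi v i k)%:~R| < m%:R :> R.
      have -> : (psi v i k)%:~R = (d0%:R *: P *m v *m invmx beta) i k by rewrite -psiE // mxE.
      apply: le_lt_trans (hC _ _ _) _; apply: lt_trans m2.
      by rewrite ltr_pM2l.
    by rewrite -intr_norm pmulrn ltr_int; move: (psi v i k) (m) => z mm; clear; lia.
  (* The coefficients of [p] on the rows of [P] are rational; clearing denominators turns [p v = 0]
     into an integral relation on the rows of [psi v]. *)
  - have [c pE] := submxP (Pmax _ pc).
    have [q cq] := class_coefficients n0 hb bu Pf PP (eq_ind _ _ pc _ pE).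
    have [g g0 [z gz]] := common_denominator_mx q.
    have gR : g%:R != 0 :> R by rewrite pnatr_eq0 -lt0n.
    have zE : real_row z = g%:R *: c :> 'rV[R]_d.+1.
      by rewrite cq -(rmorph_nat (@ratr R) g) -map_mxZ gz map_ratr_int.
    exists z.
      apply: contraNneq p0 => z0; rewrite pE.
      have : real_row z = 0 :> 'rV[R]_d.+1 by rewrite z0; apply/rowP => i; rewrite !mxE.
      rewrite zE => /eqP; rewrite scalemx_eq0 (negbTE gR) => /eqP ->.
      by rewrite mul0mx.
    have h : map_mx intr (z *m psi v) = 0 :> 'rV[R]_n.
      rewrite map_mxM psiE // -[map_mx intr z]/(real_row z) zE -!scalemxAl -!scalemxAr.
      by rewrite !mulmxA -pE pv mul0mx !scaler0.
    apply/rowP => i; apply/eqP; have := congr1 (fun M : 'rV[R]_n => M 0 i) h.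
    by rewrite [LHS]mxE [RHS]mxE [X in _ -> _ == X]mxE => /eqP; rewrite intr_eq0.
  - move=> q q0 qb; apply/eqP => qpsi; have := vF (annih (pq q)).
    rewrite mem_annih => /(_ _)/negP; apply.
      by apply/mapP; exists q => //; rewrite in_fset_set //; apply/mem_set; split.
    have : d0%:R *: (pq q *m v) = 0.
      rewrite /pq -mulmxA scalemxAr hpsi // mulmxA -map_mxM qpsi map_mx0 mul0mx //.
    by move/eqP; rewrite scalemx_eq0 (negbTE d0R).
have fSS : finite_set (short_singular P0 m : set 'M[int]_(d.+1, n)).
  by apply: sub_finite_set (finite_mx_box m) => Y [].
pose Mf := Num.trunc (K * T ^+ \dim (annih P : {vspace 'M[R]_n})).
have KT0 : 0 <= K * T ^+ \dim (annih P : {vspace 'M[R]_n}) by rewrite mulr_ge0 ?exprn_ge0 ?ltW.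
have fib Y : (nb (S `&` psi @^-1` [set Y]) <= Mf)%N.
  have [->|/set0P[v0 [[Lv0 _ _ _] v0Y]]] := eqVneq (S `&` psi @^-1` [set Y]) set0.
    by rewrite /nb fset_set0 cardfs0.
  rewrite truncn_ge_nat //; apply: le_trans (hK T v0 T1T); rewrite ler_nat; apply: nbS.
    by apply: sub_finite_set (finite_ball T) => v [[]].
  move=> v [[Lv vT _ _] vY]; split=> //; split=> //.
  rewrite mem_annih mulmxBr subr_eq0; apply/eqP; apply: (scalerI d0R).
  by rewrite !hpsi // vY v0Y.
have h1 := nb_fiber fS fib.
have h2 : (nb (psi @` S) <= nb (short_singular P0 m : set 'M[int]_(d.+1, n)))%N by apply: nbS.
have h3 := hC2 P0 m isT isT.
apply: (@le_trans _ _ (Mf%:R * (nb (short_singular P0 m : set 'M[int]_(d.+1, n)))%:R)).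
  by rewrite -natrM ler_nat (leq_trans h1) // leq_mul2l h2 orbT.
have h4 : (nb (short_singular P0 m : set 'M[int]_(d.+1, n)))%:R <= C2%:R * (2 * C * T) ^+ (d * n) / P0%:R :> R.
  rewrite ler_pdivlMr ?ltr0n // mulrC -natrM; apply: (@le_trans _ _ (C2 * m ^ (d * n))%N%:R).
    by rewrite ler_nat.
  rewrite natrM natrX ler_wpM2l //; apply: lerXn2r; rewrite ?nnegrE //.
  by rewrite !mulr_ge0 // ltW.
have h5 : Mf%:R <= K * T ^+ \dim (annih P : {vspace 'M[R]_n}) by rewrite truncn_le.
apply: le_trans (ler_pM _ _ h5 h4) _ => //.
have -> : K * T ^+ \dim (annih P : {vspace 'M[R]_n}) * (C2%:R * (2 * C * T) ^+ (d * n) / P0%:R) =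
    (B / P0%:R) * T ^+ (n * (n - 1)).
  have -> : (n * (n - 1) = \dim (annih P : {vspace 'M[R]_n}) + d * n)%N.
    by rewrite dim_annih (eqP Pf) (codim_split dn).
  by rewrite exprD [(2 * C * T) ^+ _]exprMn alg.
by rewrite ler_wpM2r // exprn_ge0 // ltW.
Qed.

End ClassTail.

(** * Thin sets of lattice points *)

Section Thin.
Context {R : realType} {n : nat} (n2 : (2 <= n)%N).
Context {L : set 'M[R]_n} (b : 'I_(n * n) -> 'M[R]_n).
Context (dL : discrete_subgroup L) (hb : indep b) (Lb : Zbasis L b).
Context (N : 'M[R]_n -> R) (hN : is_norm N).

Definition uncovered (Q : 'M[R]_n -> Prop) (F : seq {vspace 'M[R]_n}) (T : R) : set 'M[R]_n :=
  [set v | [/\ L v, N v < T, Q v & forall V, V \in F -> v \notin V]].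

(* Up to an arbitrarily small proportion, the lattice points satisfying [Q] lie in
   finitely many of the subspaces satisfying [G]. *)
Definition thin (G : {vspace 'M[R]_n} -> Prop) (Q : 'M[R]_n -> Prop) : Prop :=
  forall e : R, 0 < e -> exists F : seq {vspace 'M[R]_n}, (forall V, V \in F -> G V) /\
    exists2 T0 : R, 0 < T0 & forall T, T0 <= T ->
      (nb (uncovered Q F T))%:R <= e * T ^+ (n * (n - 1)).

Lemma finite_uncovered Q F T : finite_set (uncovered Q F T).
Proof. by apply: sub_finite_set (finite_ball hb Lb hN T) => v []. Qed.

Lemma uncoveredS Q Q' F F' T : (forall v, L v -> Q v -> Q' v) -> {subset F' <= F} ->
  (nb (uncovered Q F T) <= nb (uncovered Q' F' T))%N.
Proof.
move=> QQ FF; apply: nbS; first exact: finite_uncovered.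
by move=> v [Lv vT Qv vF]; split=> //; [apply: QQ | move=> V /FF/vF].
Qed.

Lemma thin_sub G Q Q' : (forall v, L v -> Q v -> Q' v) -> thin G Q' -> thin G Q.
Proof.
move=> QQ tQ e e0; have [F [FG [T0 T00 h]]] := tQ e e0.
exists F; split=> //; exists T0 => // T /h; apply: le_trans; rewrite ler_nat.
exact: uncoveredS.
Qed.

Lemma thin_weaken (G G' : {vspace 'M[R]_n} -> Prop) Q :
  (forall V, G V -> G' V) -> thin G Q -> thin G' Q.
Proof.
by move=> GG tQ e e0; have [F [FG h]] := tQ e e0; exists F; split=> // V /FG/GG.
Qed.

Lemma thin_or G Q1 Q2 : thin G Q1 -> thin G Q2 -> thin G (fun v => Q1 v \/ Q2 v).
Proof.
move=> t1 t2 e e0; have e2 : 0 < e / 2 by rewrite divr_gt0.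
have [F1 [G1 [T1 T10 h1]]] := t1 _ e2; have [F2 [G2 [T2 T20 h2]]] := t2 _ e2.
exists (F1 ++ F2); split; first by move=> V; rewrite mem_cat => /orP[/G1|/G2].
exists (Num.max T1 T2); first by rewrite lt_max T10.
move=> T; rewrite ge_max => /andP[/h1 {}h1 /h2 {}h2].
apply: (@le_trans _ _ ((nb (uncovered Q1 F1 T))%:R + (nb (uncovered Q2 F2 T))%:R)).
  rewrite -natrD ler_nat; apply: leq_trans (nbU (finite_uncovered _ _ _) (finite_uncovered _ _ _)).
  apply: nbS; first by rewrite finite_setU; split; exact: finite_uncovered.
  move=> v [Lv vT [Qv|Qv] vF]; [left|right]; split=> // V VF; apply: vF; by rewrite mem_cat VF ?orbT.
by apply: le_trans (lerD h1 h2) _; rewrite -mulrDl -splitr.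
Qed.

Lemma thin_False G : thin G (fun=> False).
Proof.
move=> e e0; exists [::]; split=> //; exists 1 => // T T1.
rewrite (_ : uncovered _ _ _ = set0) ?/nb ?fset_set0 ?cardfs0; last first.
  by rewrite -subset0 => v [].
by rewrite mulr_ge0 ?exprn_ge0 // ltW // (lt_le_trans _ T1).
Qed.

Lemma thin_seq (I : eqType) (s : seq I) G (Q : I -> 'M[R]_n -> Prop) :
  (forall i, i \in s -> thin G (Q i)) -> thin G (fun v => exists2 i, i \in s & Q i v).
Proof.
elim: s => [|i s IHs] h; first by apply: thin_sub (thin_False G) => v _ [].
apply: (thin_sub _ (thin_or (h i (mem_head _ _)) (IHs _))).
  by move=> v _ [k]; rewrite inE => /orP[/eqP->|ks]; [left | right; exists k].
by move=> k ks; apply: h; rewrite inE ks orbT.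
Qed.

(** A missing power of [T] beats any constant, so the empty list of subspaces suffices. *)
Lemma thin_low_dim G V : Defs.rational L V -> (\dim V < n * (n - 1))%N ->
  thin G (fun v => v \in V).
Proof.
move=> rV dV e e0; have [K K0 [T0 T00 hK]] := rational_count_le hN rV.
exists [::]; split=> //; exists (Num.max T0 (Num.max 1 (K / e))); first by rewrite lt_max T00.
move=> T; rewrite !ge_max => /and3P[T0T T1 KT].
have Tp : 0 < T by apply: lt_le_trans T0T.
apply: (@le_trans _ _ (nb (L `&` [set` V] `&` [set v | N v < T]))%:R).
  rewrite ler_nat; apply: nbS; last by move=> v [].
  by apply: sub_finite_set (finite_ball hb Lb hN T) => v [[]].
apply: le_trans (hK _ T0T) _; 
have e1 : (n * (n - 1) = (\dim V).+1 + (n * (n - 1) - (\dim V).+1))%N by rewrite subnKC.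
rewrite [X in e * T ^+ X]e1 exprD exprS.
rewrite mulrA [leRHS](_ : _ = e * T * T ^+ \dim V * T ^+ (n * (n - 1) - (\dim V).+1)); last by ring.
apply: (@le_trans _ _ (e * T * T ^+ \dim V)).
  by rewrite ler_wpM2r ?exprn_ge0 ?(ltW Tp) // mulrC -ler_pdivrMr.
rewrite -{1}[_ * T ^+ _]mulr1 ler_wpM2l ?exprn_ege1 //.
by rewrite !mulr_ge0 ?exprn_ge0 ?ltW.
Qed.

Definition hyper (V : {vspace 'M[R]_n}) : Prop :=
  [/\ Defs.rational L V, column_isotropic V & \dim V = (n * (n - 1))%N].

Lemma annih_row_hyper (p : 'rV[R]_n) : p != 0 -> Defs.rational L (annih p) -> hyper (annih p).
Proof.
move=> p0 rp; have rk : \rank p = 1%N by apply/eqP; rewrite eqn_leq rank_leq_row lt0n mxrank_eq0.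
split=> //; last by rewrite dim_annih rk mulnC.
by apply/column_isotropicP; exists <<p>>%MS;
  [apply: eq_annih; apply: eqmx_sym; exact: genmxE | rewrite mxrank_gen rk /=; lia].
Qed.

Lemma maximal_above V : Defs.rational L V -> column_isotropic V ->
  exists2 V', maximal_rational column_isotropic L V' & (V <= V')%VS.
Proof.
have iso_proper V' : column_isotropic V' -> V' != fullv.
  move=> /column_isotropicP[p -> rp]; apply/eqP => /(congr1 (fun U : {vspace _} => \dim U)).
  by rewrite dim_annih dimvf /dim /=; move: rp => /andP[]; nia.
move=> rV cV; pose Q k := `[< exists V', [/\ proper_rational column_isotropic L V',
  (V <= V')%VS & \dim V' = k] >].
have exQ : exists k, Q k by exists (\dim V); apply/asboolP; exists V; split=> //; split=> //; exact: iso_proper.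
have Qn k : Q k -> (k <= n * n)%N.
  move=> /asboolP[V' [_ _ <-]]; apply: leq_trans (dimvS (subvf V')) _.
  by rewrite dimvf /dim.
case: (ex_maxnP exQ Qn) => k /asboolP[V' [pV' VV' dk]] kmax.
exists V' => //; split=> // W pW VW; apply/esym/eqP; rewrite eqEdim VW /= dk; apply: kmax.
by apply/asboolP; exists W; split=> //; apply: subv_trans VW.
Qed.

(** Every counted point lies in a maximal rational subspace. Those of dimension below [n (n - 1)]
    are finitely many and negligible; the others are annihilators of one row and fall into finitely
    many classes. *)
Lemma column_thin : ~ Qsplit_type L -> column_noncoincidence L ->
  thin hyper (fun v => exists V, [/\ Defs.rational L V, column_isotropic V & v \in V]).
Proof.
move=> nsplit ncol; have n0 : (0 < n)%N by apply: leq_trans n2.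
have [s hs] := finite_maximal_codim dL hb Lb ncol.
have [bs [bsu hbs]] := finite_classes hb.
(* [s] is only known to contain the maximal subspaces of smaller dimension; its other members are
   filtered out. *)
pose s' := [seq V <- s | `[< Defs.rational L V /\ (\dim V < n * (n - 1))%N >]].
pose Qc beta (v : 'M[R]_n) := exists2 p, p != 0 & in_class b beta p /\ p *m v = 0.
have t1 : thin hyper (fun v => exists2 V, V \in s' & v \in V).
  apply: thin_seq => V; rewrite mem_filter => /andP[/asboolP[rV dV] _].
  exact: thin_low_dim.
have t2 : thin hyper (fun v => exists2 beta, beta \in bs & Qc beta v).
  apply: thin_seq => beta /bsu bu e e0.
  have [F [FG hF]] := class_tail n2 dL hb Lb hN nsplit bu e0.
  by exists F; split=> // V /FG[rV [p p0 VE]]; move: rV; rewrite VE; apply: annih_row_hyper.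
apply: thin_sub (thin_or t1 t2) => v Lv [V0 [rV0 cV0 vV0]].
have [V Vmax VV] := maximal_above rV0 cV0.
have vV : v \in V by apply: subvP VV _ vV0.
have [[rV /column_isotropicP[p VE /andP[rp _]] _] _] := Vmax.
have [dV|dV] := eqVneq (\dim V) (n * (n - 1))%N; [right | left].
  have rk : \rank p = 1%N.
    move: dV; rewrite VE dim_annih => h; have := rank_leq_col p.
    have : (n - \rank p = n - 1)%N.
      by apply/eqP; rewrite -(eqn_pmul2r n0) h mulnC.
    by move: rp n0; lia.
  pose u := nz_row p.
  have u0 : u != 0 by rewrite nz_row_eq0 -mxrank_eq0 rk.
  have up : (u :=: p)%MS.
    apply/eqmxP; rewrite nz_row_sub /= -(geq_leqif (mxrank_leqif_sup (nz_row_sub p))).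
    by rewrite rk lt0n mxrank_eq0.
  have ru : rational_row b u.
    by rewrite /rational_row (eq_annih up) -VE; apply/(rational_spaceP dL hb Lb).
  have [c c0 [beta bbs bc]] := hbs u u0 ru; exists beta => //; exists (c *: u).
    by rewrite scalemx_eq0 negb_or c0.
  split=> //; rewrite -scalemxAl; move: vV; rewrite VE -(eq_annih up) mem_annih => /eqP ->.
  by rewrite scaler0.
exists V => //; rewrite mem_filter hs // andbT; apply/asboolP; split=> //.
rewrite ltn_neqAle dV VE dim_annih [leqRHS]mulnC leq_mul2r; apply/orP; right; move: rp; lia.
Qed.

End Thin.

(** * Existence and positivity of the limit density *)

Section Limit.
Context {R : realType} {n : nat}.
Context {L : set 'M[R]_n} (b : 'I_(n * n) -> 'M[R]_n).
Context (dL : discrete_subgroup L) (hb : indep b) (Lb : Zbasis L b).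
Context (N : 'M[R]_n -> R) (hN : is_norm N).

Local Notation D := (n * (n - 1))%N.

Definition ball_of (Q : 'M[R]_n -> Prop) (T : R) : set 'M[R]_n :=
  [set v | [/\ L v, N v < T & Q v]].

Local Notation dens Q T := (T ^- D * (nb (ball_of Q T))%:R).

Lemma finite_ball_of Q T : finite_set (ball_of Q T).
Proof. by apply: sub_finite_set (finite_ball hb Lb hN T) => v []. Qed.

Lemma nb_ball_ofS Q Q' T : (forall v, L v -> Q v -> Q' v) ->
  (nb (ball_of Q T) <= nb (ball_of Q' T))%N.
Proof.
move=> QQ; apply: nbS; first exact: finite_ball_of.
by move=> v [Lv vT Qv]; split=> //; apply: QQ.
Qed.

Lemma nb_ball_of_or Q Q' T :
  (nb (ball_of (fun v => Q v \/ Q' v) T) + nb (ball_of (fun v => Q v /\ Q' v) T) =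
   nb (ball_of Q T) + nb (ball_of Q' T))%N.
Proof.
have fQ := finite_ball_of Q T; have fQ' := finite_ball_of Q' T.
rewrite /nb -[RHS]cardfsUI -fset_setU // -fset_setI //.
have -> : ball_of Q T `|` ball_of Q' T = ball_of (fun v => Q v \/ Q' v) T.
  apply/seteqP; split=> [v [[Lv vT Qv]|[Lv vT Qv]]|v [Lv vT [Qv|Qv]]]; first by split=> //; left.
  - by split=> //; right.
  - by left.
  - by right.
have -> // : ball_of Q T `&` ball_of Q' T = ball_of (fun v => Q v /\ Q' v) T.
by apply/seteqP; split=> [v [[Lv vT Qv] [_ _ Q'v]]|v [Lv vT [Qv Q'v]]].
Qed.

(** When no subspace is admissible, the covering list is empty and thinness bounds the whole
    count. *)
Lemma dens_thin0 Q : thin (L := L) N (fun=> False) Q -> dens Q T @[T --> +oo] --> (0 : R).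
Proof.
move=> tQ; apply/cvgrPdist_lt => e e0.
have [F [F0 [T0 T00 hT]]] := tQ (e / 2) (divr_gt0 e0 (ltr0n _ 2)).
near=> T.
have TT : T0 <= T by near: T; apply: nbhs_pinfty_ge; rewrite num_real.
have Tp : 0 < T by apply: lt_le_trans TT.
rewrite sub0r normrN ger0_norm ?mulr_ge0 ?invr_ge0 ?exprn_ge0 ?(ltW Tp) //.
rewrite ltr_pdivrMl ?exprn_gt0 //.
apply: (@le_lt_trans _ _ (e / 2 * T ^+ D)).
  apply: le_trans (hT T TT); rewrite ler_nat; apply: nbS.
    exact: (finite_uncovered hb Lb hN).
  by move=> v [Lv vT Qv]; split=> // V /F0.
by rewrite [ltRHS]mulrC ltr_pM2r ?exprn_gt0 //; lra.
Unshelve. all: by end_near.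
Qed.

Context (G : {vspace 'M[R]_n} -> Prop).
Hypothesis hG : forall V, G V -> Defs.rational L V /\ \dim V = D.

Lemma dens_space V : G V -> exists2 l : R, 0 < l & dens (fun v => v \in V) T @[T --> +oo] --> l.
Proof.
move=> /hG[rV dV]; have [l l0] := rational_count hN rV; rewrite dV => h.
exists l => //; have -> // : (fun T => dens (fun v => v \in V) T) =
  (fun T => T ^- D * (nb (L `&` [set` V] `&` [set v | N v < T]))%:R).
apply/funext => T; congr (_ * (nb _)%:R).
by apply/seteqP; split=> [v [? ? ?]|v [[? ?] ?]].
Qed.

(** Inclusion and exclusion, one subspace at a time: distinct subspaces of equal dimension meet in
    smaller dimension, so the overlap has density 0. *)
Lemma dens_union (F : seq {vspace 'M[R]_n}) : (forall V, V \in F -> G V) ->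
  exists2 l : R, 0 <= l &
    dens (fun v => exists2 V, V \in F & v \in V) T @[T --> +oo] --> l.
Proof.
elim: F => [|V F IHF] FG.
  exists 0 => //; apply: dens_thin0; apply: (thin_sub hb Lb hN _ (thin_False N _)).
  by move=> v _ [].
have [|l l0 hl] := IHF; first by move=> W WF; apply: FG; rewrite inE WF orbT.
have GV : G V by apply: FG; rewrite mem_head.
have [VF|VF] := boolP (V \in F).
  exists l => //; have -> // : (fun T => dens (fun v => exists2 V0, V0 \in V :: F & v \in V0) T) =
    (fun T => dens (fun v => exists2 V, V \in F & v \in V) T).
  apply/funext => T; congr (_ * (nb _)%:R); apply/seteqP.
  split=> v [Lv vT [W WF vW]]; split=> //.
    by move: WF vW; rewrite inE => /orP[/eqP->|WF] vW; [exists V | exists W].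
  by exists W; rewrite // inE WF orbT.
have [lV lV0 hV] := dens_space GV.
have h0 : dens (fun v => v \in V /\ exists2 W, W \in F & v \in W) T @[T --> +oo] --> (0 : R).
  apply: dens_thin0.
  apply: (thin_sub hb Lb hN (Q' := fun v => exists2 W, W \in F & v \in (V :&: W)%VS)).
    by move=> v _ [vV [W WF vW]]; exists W => //; rewrite memv_cap vV.
  apply: (thin_seq hb Lb hN) => W WF; have GW : G W by apply: FG; rewrite inE WF orbT.
  have [[rV dV] [rW dW]] := (hG GV, hG GW).
  apply: (thin_low_dim hb Lb hN).
    by apply/(rational_spaceP dL hb Lb)/rational_spaceI; apply/(rational_spaceP dL hb Lb).
  rewrite ltnNge; apply: contra VF => h.
  have VW : (V <= W)%VS by apply/capv_idPl/eqP; rewrite eqEdim capvSl dV h.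
  by have /eqP -> // : V == W by rewrite eqEdim VW dV dW leqnn.
exists (lV + l); first by rewrite addr_ge0 // ltW.
rewrite -[lV + l]subr0.
have -> : (fun T => dens (fun v => exists2 V0, V0 \in V :: F & v \in V0) T) =
  (fun T => (dens (fun v => v \in V) T + dens (fun v => exists2 V, V \in F & v \in V) T) -
     dens (fun v => v \in V /\ exists2 W, W \in F & v \in W) T).
  apply/funext => T; rewrite -mulrDr -mulrBr; congr (_ * _); rewrite -natrD.
  rewrite -nb_ball_of_or natrD addrK; congr (nb _)%:R; apply/seteqP; split=> v [Lv vT].
    by move=> [W]; rewrite inE => /orP[/eqP->|WF] vW; split=> //; [left | right; exists W].
  move=> [vV|[W WF vW]]; split=> //; first by exists V => //; rewrite mem_head.
  by exists W; rewrite // inE WF orbT.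
by apply: cvgB => //; apply: cvgD.
Qed.

(** The limit is the supremum of the densities of finite unions. One subspace already has positive
    density, and without subspaces only the empty union is left. *)
Lemma thin_limit (Q : 'M[R]_n -> Prop) :
  (forall V v, G V -> L v -> v \in V -> Q v) -> thin (L := L) N G Q ->
  exists c : R, [/\ 0 <= c, dens Q T @[T --> +oo] --> c & 0 < c <-> exists V, G V].
Proof.
move=> GQ tQ.
pose Lim (F : seq {vspace 'M[R]_n}) l := dens (fun v => exists2 V, V \in F & v \in V) T @[T --> +oo] --> (l : R).
pose E : set R := [set l | exists2 F, (forall V, V \in F -> G V) & Lim F l].
have E0 : E 0.
  exists [::] => //; have [|l _ hl] := @dens_union [::] => //.
  rewrite /Lim; have -> // : (fun T => dens (fun v => exists2 V : {vspace 'M[R]_n}, V \in [::] & v \in V) T) = (fun=> 0).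
    apply/funext => T; rewrite (_ : ball_of _ _ = set0) ?/nb ?fset_set0 ?cardfs0 ?mulr0 //.
    by rewrite -subset0 => v [_ _ []].
  exact: cvg_cst.
have lower F l e : (forall V, V \in F -> G V) -> Lim F l -> 0 < e ->
    \forall T \near +oo, l - e < dens Q T.
  move=> FG hl e0; near=> T; have Tp : 0 < T by near: T; apply: nbhs_pinfty_gt; rewrite num_real.
  apply: (@lt_le_trans _ _ (dens (fun v => exists2 V, V \in F & v \in V) T)).
    near: T; apply: (cvgr_gt _ hl); lra.
  rewrite ler_wpM2l ?invr_ge0 ?exprn_ge0 ?(ltW Tp) // ler_nat; apply: nb_ball_ofS.
  by move=> v Lv [V VF vV]; apply: GQ vV => //; apply: FG.
have upper e : 0 < e -> exists2 l, E l & \forall T \near +oo, dens Q T < l + e.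
  move=> e0; have e2 : 0 < e / 2 by rewrite divr_gt0.
  have [F [FG [T0 T00 hT]]] := tQ _ e2; have [l l0 hl] := dens_union FG.
  exists l; first by exists F.
  near=> T; have TT : T0 <= T by near: T; apply: nbhs_pinfty_ge; rewrite num_real.
  have Tp : 0 < T by apply: lt_le_trans TT.
  have h1 : dens (fun v => exists2 V, V \in F & v \in V) T < l + e / 2.
    by near: T; apply: (cvgr_lt _ hl); lra.
  have h2 : T ^- D * (nb (uncovered (L := L) N Q F T))%:R <= e / 2.
    by rewrite ler_pdivrMl ?exprn_gt0 // mulrC hT.
  have h3 : dens Q T <= dens (fun v => exists2 V, V \in F & v \in V) T +
      T ^- D * (nb (uncovered (L := L) N Q F T))%:R.
    rewrite -mulrDr ler_wpM2l ?invr_ge0 ?exprn_ge0 ?(ltW Tp) // -natrD ler_nat.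
    apply: leq_trans (nbU (finite_ball_of _ _) (finite_uncovered hb Lb hN _ _ _)).
    apply: nbS.
      by rewrite finite_setU; split; [exact: finite_ball_of | exact: (finite_uncovered hb Lb hN)].
    move=> v [Lv vT Qv]; have [[V VF vV]|nV] := pselect (exists2 V, V \in F & v \in V).
      by left; split=> //; exists V.
    by right; split=> // V VF; apply/negP => vV; apply: nV; exists V.
  lra.
have [l1 El1 hl1] := upper 1 ltr01.
have ubE : ubound E (l1 + 2).
  move=> l [F FG hl]; have h := lower F l 1 FG hl ltr01.
  have [T] : exists T : R, l - 1 < dens Q T /\ dens Q T < l1 + 1.
    have : \forall T \near +oo, l - 1 < dens Q T /\ dens Q T < l1 + 1.
      by near=> T; split; near: T.
    by move=> /near_pinfty_ex[T0 _ hT]; exists T0; apply: hT.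
  by move=> [a1 a2]; lra.
have sE : has_sup E by split; [exists 0 | exists (l1 + 2)].
pose c := sup E.
have cub l : E l -> l <= c by move=> El; apply: ub_le_sup => //; case: sE.
exists c; split; first exact: cub.
  apply/cvgrPdist_lt => e e0; have e2 : 0 < e / 2 by rewrite divr_gt0.
  have [l El hl] := upper _ e2.
  have [l' [F' FG' hl'] ll'] := sup_adherent e2 sE.
  have lo := lower F' l' _ FG' hl' e2.
  near=> T.
  have h1 : dens Q T < l + e / 2 by near: T.
  have h2 : l' - e / 2 < dens Q T by near: T.
  have h3 := cub _ El; rewrite -/c in ll'.
  by rewrite ltr_norml; apply/andP; split; lra.
split=> [c0|[V GV]].
  apply: contrapT => nG; have : c <= 0; last by rewrite leNgt c0.
  apply: ge_sup; first by exists 0.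
  move=> l [[|V F] FG hl]; last by case: nG; exists V; apply: FG; rewrite mem_head.
  have : Lim [::] 0.
    rewrite /Lim; have -> // : (fun T => dens (fun v => exists2 V : {vspace 'M[R]_n}, V \in [::] & v \in V) T) = (fun=> 0).
      apply/funext => T; rewrite (_ : ball_of _ _ = set0) ?/nb ?fset_set0 ?cardfs0 ?mulr0 //.
      by rewrite -subset0 => v [_ _ []].
    exact: cvg_cst.
  by move=> h; rewrite (cvg_unique _ hl h).
have [l l0 hl] := dens_space GV; apply: lt_le_trans l0 (cub _ _); exists [:: V].
  by move=> W; rewrite inE => /eqP ->.
rewrite /Lim; have -> // : (fun T => dens (fun v => exists2 W, W \in [:: V] & v \in W) T) =
  (fun T => dens (fun v => v \in V) T).
apply/funext => T; congr (_ * (nb _)%:R); apply/seteqP; split=> v [Lv vT].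
  by move=> [W]; rewrite inE => /eqP -> vV.
by move=> vV; split=> //; exists V; rewrite // mem_head.
Unshelve. all: by end_near.
Qed.

End Limit.

(** * Spaces of singular matrices *)

Section SingularSpaces.
Context {R : realType}.

Lemma poly_eq0_nat (p : {poly R}) : (forall m : nat, p.[m%:R] = 0) -> p = 0.
Proof.
move=> h; pose rs := [seq i%:R : R | i <- iota 0 (size p)].
apply: (@roots_geq_poly_eq0 _ p rs); last by rewrite size_map size_iota.
  by apply/allP => _ /mapP[m _ ->]; rewrite /root h.
by rewrite map_inj_uniq ?iota_uniq // => i j /eqP; rewrite eqr_nat => /eqP.
Qed.

Section Blocks.
Context {r s : nat}.
Implicit Types (A : 'M[R]_r) (B : 'M[R]_(r, s)) (C : 'M[R]_(s, r)) (D : 'M[R]_s).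

(** The top rows already have rank [r], so the bottom rows are combinations of them, and the left
    blocks determine the coefficients [C A^-1]. *)
Lemma schur_rank A B C D : A \in unitmx -> (\rank (block_mx A B C D) <= r)%N ->
  D = C *m invmx A *m B.
Proof.
move=> Au rk; rewrite /block_mx in rk.
have rAB : \rank (row_mx A B) = r.
  apply/eqP; rewrite eqn_leq rank_leq_row /=.
  have := mxrankM_maxl (row_mx A B) (col_mx 1%:M 0).
  rewrite mul_row_col mulmx1 mulmx0 addr0.
  by have /eqP -> : row_free A by rewrite row_free_unit.
have sub : (row_mx A B <= col_mx (row_mx A B) (row_mx C D))%MS.
  by rewrite -addsmxE addsmxSl.
have : (col_mx (row_mx A B) (row_mx C D) <= row_mx A B)%MS.
  by rewrite -(geq_leqif (mxrank_leqif_sup sub)) rAB.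
rewrite -addsmxE addsmx_sub => /andP[_ /submxP[Y]].
rewrite mul_mx_row => /eq_row_mx[-> ->].
by rewrite mulmxK.
Qed.

(* The coefficients of the polynomial identity
   [det (1 + t A) D = t C adj (1 + t A) B] in [t]. *)
Lemma flanders_blocks A B C D :
  (forall t : R, (\rank (block_mx (1%:M : 'M[R]_r) 0 0 (0 : 'M[R]_s) + t *: block_mx A B C D)%R <= r)%N) ->
  D = 0 /\ C *m B = 0.
Proof.
move=> rk.
pose pc p q (M : 'M[R]_(p, q)) : 'M[{poly R}]_(p, q) := map_mx polyC M.
pose Ap : 'M[{poly R}]_r := 1%:M + 'X *: pc _ _ A.
pose Z : 'M[{poly R}]_s := pc _ _ C *m \adj Ap *m pc _ _ B.
pose P : 'M[{poly R}]_s := \det Ap *: pc _ _ D - 'X *: Z.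
pose ev t p q (M : 'M[{poly R}]_(p, q)) : 'M[R]_(p, q) := map_mx (horner_eval t) M.
have evpc t p q (M : 'M[R]_(p, q)) : ev t _ _ (pc _ _ M) = M.
  by apply/matrixP => i j; rewrite !mxE /horner_eval hornerC.
have evA t : ev t _ _ Ap = 1%:M + t *: A.
  by rewrite /ev /Ap map_mxD map_mx1 map_mxZ -/(ev t _ _ _) evpc /= /horner_eval hornerX.
have detA t : (\det Ap).[t] = \det (1%:M + t *: A).
  by rewrite -evA /ev det_map_mx.
have evZ t : ev t _ _ Z = C *m \adj (1%:M + t *: A) *m B.
  by rewrite /ev /Z !map_mxM map_mx_adj -!/(ev t _ _ _) !evpc evA.
have evP t : ev t _ _ P = \det (1%:M + t *: A) *: D - t *: (C *m \adj (1%:M + t *: A) *m B).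
  rewrite /ev /P map_mxB !map_mxZ -!/(ev t _ _ _) evpc evZ /= /horner_eval hornerX detA //.
have det0 : \det Ap != 0.
  apply/eqP => h; have := detA 0; rewrite h horner0 scale0r addr0 det1 => /eqP.
  by rewrite eq_sym oner_eq0.
have P0 : P = 0.
  apply/matrixP => k l; rewrite [RHS]mxE.
  (* The two extra factors vanish where the Schur complement gives nothing, at singular [1 + t A]
     and at [t = 0]; being nonzero polynomials, they cancel afterwards. *)
  have : P k l * \det Ap * 'X = 0.
    apply: poly_eq0_nat => m; rewrite !hornerE detA; move: (m%:R : R) => t {m}.
    have [->|t0] := eqVneq t 0; first by rewrite mulr0.
    have [->|d0] := eqVneq (\det (1%:M + t *: A)) 0; first by rewrite mulr0 mul0r.
    have Au : 1%:M + t *: A \in unitmx by rewrite unitmxE unitfE.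
    have := rk t; rewrite scale_block_mx add_block_mx !add0r => /(schur_rank Au) tD.
    have -> : (P k l).[t] = (ev t _ _ P) k l by rewrite /ev [RHS]mxE.
    have DE : D = t *: (C *m invmx (1%:M + t *: A) *m B).
      by apply: (scalerI t0); rewrite tD -!scalemxAl -scalemxAr.
    rewrite evP {1}DE /invmx Au -!scalemxAr -!scalemxAl !scalerA.
    by rewrite [_ * (t / _)]mulrCA divff // mulr1 subrr mxE !mul0r.
  move/eqP; rewrite !mulf_eq0 polyX_eq0 (negbTE det0) !orbF => /eqP //.
have D0 : D = 0.
  have := evP 0; rewrite P0 !scale0r addr0 det1 scale1r subr0 => <-.
  by apply/matrixP => i j; rewrite !mxE /horner_eval horner0.
split=> //.
have Z0 : Z = 0.
  have : 'X *: Z = 0.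
    have := P0; rewrite /P D0 /pc map_mx0 scaler0 sub0r => /eqP.
    by rewrite oppr_eq0 => /eqP.
  move=> h; apply/matrixP => k l; rewrite [RHS]mxE.
  have := congr1 (fun M : 'M[{poly R}]_s => M k l) h; rewrite [LHS]mxE [RHS]mxE => /eqP.
  by rewrite mulf_eq0 polyX_eq0 => /eqP.
have := evZ 0; rewrite scale0r addr0 adj1 mulmx1 => <-.
by rewrite Z0; apply/matrixP => i j; rewrite !mxE /horner_eval horner0.
Qed.

End Blocks.

(** Comparing the units [1] and [1 + delta_mx i j] gives [C *m delta_mx i j *m B = 0], whose entries
    are all products of an entry of [C] and an entry of [B]. *)
Lemma mulmx_units_eq0 r s s' (C : 'M[R]_(s, r)) (B : 'M[R]_(r, s')) :
  (forall X, X \in unitmx -> C *m X *m B = 0) -> C = 0 \/ B = 0.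
Proof.
move=> h; have CB : C *m B = 0 by have := h _ (unitmx1 _ _); rewrite mulmx1.
have E i j : C *m delta_mx i j *m B = 0.
  have : (1%:M + delta_mx i j : 'M[R]_r) \in unitmx.
    have [->|ij] := eqVneq i j.
      have e : (1%:M + delta_mx j j) *m (1%:M - 2^-1 *: delta_mx j j) = 1%:M :> 'M[R]_r.
        rewrite mulmxDl mul1mx mulmxBr mulmx1 -scalemxAr mul_delta_mx.
        apply/matrixP => a c; rewrite !mxE; lra.
      by case: (mulmx1_unit e).
    have e : (1%:M + delta_mx i j) *m (1%:M - delta_mx i j) = 1%:M :> 'M[R]_r.
      rewrite mulmxDl mul1mx mulmxBr mulmx1 mul_delta_mx_cond [j == i]eq_sym (negbTE ij) mulr0n subr0.
      by rewrite subrK.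
    by case: (mulmx1_unit e).
  by move=> /h; rewrite mulmxDr mulmx1 mulmxDl CB add0r.
have [C0|C0] := eqVneq C 0; [by left | right].
have [k [i Cki]] : exists k i, C k i != 0.
  apply/not_existsP => H; case/eqP: C0; apply/matrixP => k i; rewrite mxE.
  by apply/eqP; apply: contraT => Cki; case: (H k); exists i.
apply/matrixP => j l; rewrite mxE; have := congr1 (fun M : 'M[R]__ => M k l) (E i j).
rewrite !mxE (bigD1 j) //= big1 ?addr0 => [|a aj].
  rewrite mxE (bigD1 i) //= big1 ?addr0 => [|a ai].
    by rewrite !mxE !eqxx mulr1 => /eqP; rewrite mulf_eq0 (negbTE Cki) => /eqP.
  by rewrite !mxE (negbTE ai) mulr0.
by rewrite mxE big1 ?mul0r // => c _; rewrite !mxE (negbTE aj) andbF mulr0.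
Qed.

Section BlockSpace.
Context {r s : nat} (V : {vspace 'M[R]_(r + s)}).
Hypothesis JV : block_mx (1%:M : 'M[R]_r) 0 0 0 \in V.
Hypothesis rkV : forall M, M \in V -> (\rank M <= r)%N.

Local Notation M_ := ('M[R]_(r + s)).

Lemma block_conditions (M : M_) : M \in V -> drsubmx M = 0 /\ dlsubmx M *m ursubmx M = 0.
Proof.
move=> MV; apply: (@flanders_blocks _ _ (ulsubmx M)) => t; rewrite submxK.
by apply: rkV; rewrite rpredD // rpredZ.
Qed.

Let fB : 'Hom(M_, 'M[R]_(r, s)) := linfun (rsubmx \o usubmx).
Let fC : 'Hom(M_, 'M[R]_(r, s)) := linfun (trmx \o lsubmx \o dsubmx).
Let fA : 'Hom(M_, 'M[R]_r) := linfun (lsubmx \o usubmx).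

Let fBE M : fB M = ursubmx M. Proof. by rewrite /fB lfunE. Qed.
Let fCE M : fC M = (dlsubmx M)^T. Proof. by rewrite /fC lfunE. Qed.
Let fAE M : fA M = ulsubmx M. Proof. by rewrite /fA lfunE. Qed.

(** Filtration of [V] by the vanishing of the upper right block, then also of the lower left one;
    the lower right block is always 0. *)
Let V2 := (V :&: lker fB)%VS.
Let V1 := (V2 :&: lker fC)%VS.

Let V1P M : M \in V1 -> M = block_mx (ulsubmx M) 0 0 0.
Proof.
rewrite !memv_cap => /andP[/andP[MV]].
rewrite !memv_ker fBE fCE => /eqP B0 /eqP C0; have [D0 _] := block_conditions MV.
have {}C0 : dlsubmx M = 0 by rewrite -[LHS]trmxK C0 trmx0.
by rewrite -[LHS]submxK B0 C0 D0.
Qed.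

Let fA_inj : \dim (fA @: V1) = \dim V1.
Proof.
apply: limg_dim_eq; apply/eqP; rewrite -subv0; apply/subvP => M.
rewrite memv_cap => /andP[/V1P ME]; rewrite memv_ker fAE memv0 => /eqP A0.
by rewrite ME A0 block_mx0.
Qed.

(* Polarizing [C B = 0] shows that a common value [B = C^T] satisfies [C C^T = 0]. *)
Let fBC_disjoint : (fB @: V :&: fC @: V2 = 0)%VS.
Proof.
apply/eqP; rewrite -subv0; apply/subvP => x; rewrite memv_cap => /andP[].
move=> /memv_imgP[M1 M1V ->] /memv_imgP[M2 + e]; rewrite memv_cap => /andP[M2V].
rewrite memv_ker fBE => /eqP B2; move: e; rewrite fBE fCE => BC.
have [_ h1] := block_conditions M1V.
have [_] := block_conditions (rpredD M1V M2V).
have -> : ursubmx (M1 + M2) = ursubmx M1.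
  by rewrite -!fBE linearD /= !fBE B2 addr0.
have -> : dlsubmx (M1 + M2) = dlsubmx M1 + dlsubmx M2.
  by apply: trmx_inj; rewrite -fCE linearD /= !fCE linearD.
rewrite mulmxDl h1 add0r BC => h2; rewrite memv0; apply/eqP.
have : (dlsubmx M2) = 0 by apply: trace_mul_tr_eq0; rewrite h2 mxtrace0.
by move=> ->; rewrite trmx0.
Qed.

Let dim_split : \dim V = (\dim V1 + (\dim (fC @: V2) + \dim (fB @: V)))%N.
Proof. by rewrite addnA limg_ker_dim limg_ker_dim. Qed.

Let dim_BC : (\dim (fC @: V2) + \dim (fB @: V) <= r * s)%N.
Proof.
rewrite addnC -dimv_disjoint_sum ?fBC_disjoint //.
by apply: leq_trans (dimvS (subvf _)) _; rewrite dimvf /dim.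
Qed.

Let dim_V1 : (\dim V1 <= r * r)%N.
Proof.
by rewrite -fA_inj; apply: leq_trans (dimvS (subvf _)) _; rewrite dimvf /dim.
Qed.

Lemma bounded_rank_dim : (\dim V <= r * (r + s))%N.
Proof. by rewrite dim_split mulnDr leq_add. Qed.

(** Equality in the dimension bound puts every upper left block into [V]. Correcting that block of a
    member to an arbitrary invertible matrix yields [C X B = 0] for all units [X], so [C = 0] or
    [B = 0] for each member. *)
Lemma bounded_rank_eq : \dim V = (r * (r + s))%N ->
  (forall M, M \in V -> dsubmx M = 0) \/ (forall M, M \in V -> rsubmx M = 0).
Proof.
move=> dV.
have d1 : \dim V1 = (r * r)%N.
  by apply/eqP; rewrite eqn_leq dim_V1 /=; move: dV dim_BC; rewrite dim_split mulnDr; lia.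
have fAV1 : (fA @: V1 = fullv)%VS.
  by apply/eqP; rewrite eqEdim subvf fA_inj d1 dimvf /dim leqnn.
have inV (X : 'M[R]_r) : block_mx X 0 0 0 \in V.
  have : X \in (fA @: V1)%VS by rewrite fAV1 memvf.
  move=> /memv_imgP[M MV1 ->]; rewrite fAE -(V1P MV1).
  by move: MV1; rewrite !memv_cap => /andP[/andP[]].
have CB M : M \in V -> dlsubmx M = 0 \/ ursubmx M = 0.
  move=> MV; have [D0 _] := block_conditions MV.
  apply: mulmx_units_eq0 => X Xu.
  have iXu : invmx X \in unitmx by rewrite unitmx_inv.
  have : block_mx (invmx X) (ursubmx M) (dlsubmx M) 0 \in V.
    have -> : block_mx (invmx X) (ursubmx M) (dlsubmx M) 0 =
        M + block_mx (invmx X - ulsubmx M) 0 0 0.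
      by rewrite -{3}[M]submxK D0 add_block_mx !addr0 addrC subrK.
    by rewrite rpredD.
  by move=> /rkV/(schur_rank iXu); rewrite invmxK.
have Cpart M : M \in V -> dlsubmx M = 0 -> dsubmx M = 0.
  move=> MV C0; have [D0 _] := block_conditions MV.
  by rewrite -[LHS]hsubmxK -[lsubmx _]/(dlsubmx M) -[rsubmx _]/(drsubmx M) C0 D0 row_mx0.
have Bpart M : M \in V -> ursubmx M = 0 -> rsubmx M = 0.
  move=> MV B0; have [D0 _] := block_conditions MV.
  by rewrite -[M]submxK B0 D0 block_mxEh row_mxKr col_mx0.
have [hC|hC] := pselect (forall M, M \in V -> dlsubmx M = 0).
  by left=> M MV; apply: Cpart => //; apply: hC.
right=> M MV; apply: Bpart => //.
(* The alternative is uniform: if [M1] has nonzero [C] and [M] has [C = 0], then [M + M1] has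
   nonzero [C], which forces [B = 0] for [M]. *)
move/existsNP: hC => [M1 /not_implyP[M1V C1]].
have B1 : ursubmx M1 = 0 by case: (CB _ M1V).
have [C0|//] := CB _ MV.
have [] := CB _ (rpredD MV M1V).
  have -> : dlsubmx (M + M1) = dlsubmx M + dlsubmx M1.
    by apply: trmx_inj; rewrite -fCE linearD /= !fCE linearD.
  by rewrite C0 add0r => /C1.
have -> : ursubmx (M + M1) = ursubmx M + ursubmx M1 by rewrite -!fBE linearD.
by rewrite B1 addr0.
Qed.

End BlockSpace.

(** A member of maximal rank is normalized to an identity block by invertible factors on both sides.
    The two equality cases kill the last row or the last column, giving a common null vector on the
    left or on the right. *)
Lemma singular_space_dim n (V : {vspace 'M[R]_n}) : (0 < n)%N ->
  (forall A, A \in V -> \det A = 0) -> \dim V = (n * (n - 1))%N ->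
  (exists2 p : 'rV[R]_n, p != 0 & forall A, A \in V -> p *m A = 0) \/
  (exists2 v : 'cV[R]_n, v != 0 & forall A, A \in V -> A *m v = 0).
Proof.
move=> n0 detV dV; pose P k := `[< exists2 A, A \in V & \rank A = k >].
have exP : exists k, P k by exists (\rank (0 : 'M[R]_n)); apply/asboolP; exists 0; rewrite ?mem0v.
have Pn k : P k -> (k <= n)%N by move=> /asboolP[A _ <-]; apply: rank_leq_row.
case: (ex_maxnP exP Pn) => r /asboolP[J JV rJ] rmax.
have {}rmax A : A \in V -> (\rank A <= r)%N.
  by move=> AV; apply: rmax; apply/asboolP; exists A.
have rn : (r < n)%N.
  rewrite ltnNge; apply/negP => nr; have : J \in unitmx.
    by rewrite -row_free_unit /row_free eqn_leq rank_leq_row rJ.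
  by rewrite unitmxE detV // unitr0.
have [s ns] : exists s, n = (r + s)%N by exists (n - r)%N; rewrite subnKC // ltnW.
subst n; pose Lc := invmx (col_ebase J); pose Rr := invmx (row_ebase J).
have Lu : Lc \in unitmx by rewrite unitmx_inv col_ebase_unit.
have Ru : Rr \in unitmx by rewrite unitmx_inv row_ebase_unit.
pose f : 'End('M[R]_(r + s)) := linfun (mulmxr Rr \o mulmx Lc).
have fE A : f A = Lc *m A *m Rr by rewrite /f lfunE.
have dfV : \dim (f @: V) = \dim V.
  apply: limg_dim_eq; apply/eqP; rewrite -subv0; apply/subvP => A.
  rewrite memv_cap memv_ker fE memv0 => /andP[_ /eqP h]; apply/eqP.
  by rewrite -[A](mulKmx Lu) -[Lc *m A](mulmxK Ru) h mul0mx mulmx0.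
have JfV : block_mx (1%:M : 'M[R]_r) 0 0 0 \in (f @: V)%VS.
  apply/memv_imgP; exists J => //; rewrite fE -{1}(mulmx_ebase J) rJ -pid_mx_block.
  by rewrite !mulmxA mulVmx ?col_ebase_unit // mul1mx mulmxK ?row_ebase_unit.
have rkfV M : M \in (f @: V)%VS -> (\rank M <= r)%N.
  move=> /memv_imgP[A AV ->]; rewrite fE; apply: leq_trans (mxrankM_maxl _ _) _.
  by apply: leq_trans (mxrankM_maxr _ _) _; apply: rmax.
(* The bound [n (n - 1) <= r n] with [r < n] leaves only [r = n - 1]. *)
have := bounded_rank_dim JfV rkfV; rewrite dfV dV => hd.
have s1 : s = 1%N.
  have : (r + s - 1 <= r)%N by rewrite -(leq_pmul2l n0) [X in (_ <= X)%N]mulnC.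
  by move: rn; lia.
subst s; have deq : \dim (f @: V) = (r * (r + 1))%N by rewrite dfV dV addnK mulnC.
have [h|h] := bounded_rank_eq JfV rkfV deq; [left | right].
  have u0 : row_mx 0 1%:M != 0 :> 'M[R]_(1, r + 1).
    by apply/eqP => /(congr1 rsubmx); rewrite row_mxKr linear0 => /eqP; rewrite oner_eq0.
  exists (row_mx 0 1%:M *m Lc).
    by apply: contraNneq u0 => e; rewrite -[row_mx _ _](mulmxK Lu) e mul0mx.
  move=> A AV; have e : dsubmx (f A) = 0 by apply: h; apply: memv_img.
  have uf : row_mx 0 1%:M *m f A = 0.
    by rewrite -[f A]vsubmxK e mul_row_col mul0mx mulmx0 addr0.
  by rewrite -[LHS](mulmxK Ru) -(mul0mx _ (invmx Rr)) -uf fE !mulmxA.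
have u0 : col_mx 0 1%:M != 0 :> 'M[R]_(r + 1, 1).
  by apply/eqP => /(congr1 dsubmx); rewrite col_mxKd linear0 => /eqP; rewrite oner_eq0.
exists (Rr *m col_mx 0 1%:M).
  by apply: contraNneq u0 => e; rewrite -[col_mx _ _](mulKmx Ru) e mulmx0.
move=> A AV; have e : rsubmx (f A) = 0 by apply: h; apply: memv_img.
have fu : f A *m col_mx 0 1%:M = 0.
  by rewrite -[f A]hsubmxK e mul_row_col mulmx0 mul0mx addr0.
by rewrite -[LHS](mulKmx Lu) -(mulmx0 _ (invmx Lc)) -fu fE !mulmxA.
Qed.

(* One integral coefficient at a time is replaced by a real one. *)
Lemma det_real_span n d (c : 'I_d -> 'M[R]_n) :
  (forall z : 'I_d -> int, \det (\sum_i c i *~ z i) = 0) ->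
  forall x : 'I_d -> R, \det (\sum_i x i *: c i) = 0.
Proof.
move=> h x.
have {}h k : forall x : 'I_d -> R, (forall i : 'I_d, (k <= i)%N -> exists z : int, x i = z%:~R) ->
    \det (\sum_i x i *: c i) = 0.
  elim: k => [|k IHk] {}x xz.
    have /choice[z hz] := fun i => xz i isT; rewrite -[RHS](h z); congr (\det _).
    by apply: eq_bigr => i _; rewrite hz scaler_int.
  have [kd|dk] := ltnP k d; last by apply: IHk => i; rewrite leqNgt (leq_trans (ltn_ord i)).
  pose i0 := Ordinal kd.
  pose A := \sum_(i | i != i0) x i *: c i.
  (* The determinant as a polynomial in the coefficient of [c i0]; the induction hypothesis makes it
     vanish at every natural number. *)
  pose p := \det (map_mx polyC A + 'X *: map_mx polyC (c i0)).
  have pE t : p.[t] = \det (A + t *: c i0).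
    rewrite -[p.[t]]/(horner_eval t p) -det_map_mx; congr (\det _).
    have evpc (M : 'M[R]_n) : map_mx (horner_eval t) (map_mx polyC M) = M.
      by apply/matrixP => i j; rewrite !mxE /horner_eval hornerC.
    by rewrite map_mxD map_mxZ !evpc /= /horner_eval hornerX.
  rewrite (bigD1 i0) //= addrC -/A -pE (_ : p = 0) ?horner0 //.
  apply: poly_eq0_nat => m; rewrite pE.
  have -> : A + m%:R *: c i0 = \sum_i (if i == i0 then m%:R else x i) *: c i.
    rewrite (bigD1 i0) //= eqxx addrC; congr (_ + _); apply: eq_bigr => i ii.
    by rewrite (negbTE ii).
  apply: IHk => i ki; case: eqVneq => [_|ii]; first by exists m%:Z; rewrite -pmulrn.
  by apply: xz; rewrite ltn_neqAle ki eq_sym andbT.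
by apply: (h d) => i; rewrite leqNgt ltn_ord.
Qed.

End SingularSpaces.

(** * Transposition *)

Lemma commensurable_image (U W : zmodType) (f : {additive U -> W}) (A B : set U) :
  injective f -> commensurable A B -> commensurable (f @` A) (f @` B).
Proof.
move=> fi; have fI (X Y : set U) : f @` X `&` f @` Y = f @` (X `&` Y).
  apply/seteqP; split=> [_ [[x Xx <-] [y Yy /fi yx]]|_ [x [Xx Yx] <-]].
    by exists x => //; split=> //; rewrite -yx.
  by split; exists x.
have fc (X Y : set U) : finite_set (cosets (X `&` Y) X) ->
    finite_set (cosets (f @` X `&` f @` Y) (f @` X)).
  move=> h; apply: sub_finite_set (finite_image (fun S => f @` S) h).
  move=> _ [_ [x Xx <-] <-]; exists [set x + b | b in X `&` Y]; first by exists x.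
  rewrite fI; apply/seteqP; split=> [_ [_ [b hb <-] <-]|_ [_ [b hb <-] <-]].
    by exists (f b); [exists b | rewrite raddfD].
  by exists (x + b); [exists b | rewrite raddfD].
move=> [hA hB]; split; first exact: fc.
by rewrite setIC; apply: fc; rewrite setIC.
Qed.

Section Transpose.
Context {R : realType} {n : nat}.
Implicit Types (L : set 'M[R]_n) (V : {vspace 'M[R]_n}).

Definition tr_set L : set 'M[R]_n := [set v | L v^T].
Definition tr_space V : {vspace 'M[R]_n} := (linfun trmx @: V)%VS.

Lemma mem_tr_space V A : (A \in tr_space V) = (A^T \in V).
Proof.
apply/idP/idP => [/memv_imgP[B BV ->]|AV]; first by rewrite lfunE /= trmxK.
by apply/memv_imgP; exists A^T; rewrite // lfunE /= trmxK.
Qed.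

Lemma tr_spaceK : involutive tr_space.
Proof. by move=> V; apply/vspaceP => A; rewrite !mem_tr_space trmxK. Qed.

Lemma tr_setK : involutive tr_set.
Proof. by move=> L; apply/seteqP; split=> v; rewrite /tr_set /= trmxK. Qed.

Lemma tr_set_image L : tr_set L = trmx @` L.
Proof.
apply/seteqP; split=> [v Lv|_ [v Lv <-]]; last by rewrite /tr_set /= trmxK.
by exists v^T => //; rewrite trmxK.
Qed.

Lemma dim_tr_space V : \dim (tr_space V) = \dim V.
Proof.
apply: limg_dim_eq; apply/eqP; rewrite -subv0; apply/subvP => A.
by rewrite memv_cap memv_ker lfunE memv0 /= trmx_eq0 => /andP[].
Qed.

Lemma tr_spaceS V W : (tr_space V <= tr_space W)%VS = (V <= W)%VS.
Proof.
apply/subvP/subvP => VW A; last by rewrite !mem_tr_space => /VW.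
by have := VW A^T; rewrite !mem_tr_space trmxK.
Qed.

Lemma nbhs_trmx (A : 'M[R]_n) (U : set 'M[R]_n) : nbhs A^T U -> nbhs A (tr_set U).
Proof.
move=> /nbhs_ballP[e /= e0 h]; apply/nbhs_ballP; exists e => //= B.
rewrite mx_norm_ball /ball_ /= => AB; apply: h; rewrite mx_norm_ball /ball_ /=.
apply: le_lt_trans AB; apply: mx_norm_le => // i j.
by rewrite -linearB mxE mx_entry_le.
Qed.

Lemma tr_discrete L : discrete_subgroup L -> discrete_subgroup (tr_set L).
Proof.
move=> [[L0 LB] Liso]; split.
  split=> [|x y Lx Ly]; first by rewrite /tr_set /= trmx0.
  by rewrite /tr_set /= linearB; apply: LB.
move=> x Lx; have [_ [U Ux UL]] := Liso _ Lx; split; first by rewrite inE.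
exists (tr_set U); first exact: nbhs_trmx.
apply/seteqP; split=> [y [Uy Ly]|_ ->]; last first.
  have : (U `&` L) x^T by rewrite UL.
  by [].
have : (U `&` L) y^T by split.
by rewrite UL => /trmx_inj.
Qed.

Lemma tr_Zbasis L d (c : 'I_d -> 'M[R]_n) : Zbasis L c -> Zbasis (tr_set L) (fun i => (c i)^T).
Proof.
have E (z : 'I_d -> int) : \sum_i (c i)^T *~ z i = (\sum_i c i *~ z i)^T.
  by rewrite raddf_sum; apply: eq_bigr => i _; rewrite raddfMz.
move=> [cL cZ]; split=> [x|z].
  split=> [/cL[z xz]|[z ->]]; first by exists z; rewrite E -xz trmxK.
  by rewrite E /tr_set /= trmxK; apply/cL; exists z.
by move=> h; apply: cZ; apply: trmx_inj; rewrite -E h trmx0.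
Qed.

Lemma tr_rational L V : Defs.rational L V -> Defs.rational (tr_set L) (tr_space V).
Proof.
have E : tr_set L `&` [set` tr_space V] = tr_set (L `&` [set` V]).
  by apply/seteqP; split=> v; rewrite /tr_set /= mem_tr_space.
move=> [dLV [c cZ]]; split; rewrite E; first exact: tr_discrete.
by rewrite dim_tr_space; exists (fun i => (c i)^T); apply: tr_Zbasis.
Qed.

Lemma tr_column_isotropic V : column_isotropic (tr_space V) <-> row_isotropic V.
Proof.
split=> -[U [dU h]]; exists U; split=> // A.
  have := h A^T; rewrite mem_tr_space trmxK => ->.
  by split=> H i; have := H i; rewrite tr_row.
rewrite mem_tr_space; have := h A^T => ->.
by split=> H i; have := H i; rewrite -tr_col trmxK.
Qed.

Lemma tr_maximal L V : maximal_rational column_isotropic (tr_set L) V ->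
  maximal_rational row_isotropic L (tr_space V).
Proof.
have proper W : proper_rational column_isotropic (tr_set L) W ->
    proper_rational row_isotropic L (tr_space W).
  move=> [rW cW fW]; split.
  - by rewrite -[L]tr_setK; apply: tr_rational.
  - by apply/tr_column_isotropic; rewrite tr_spaceK.
  apply: contraNneq fW => h; rewrite -[W]tr_spaceK h; apply/eqP/vspaceP => A.
  by rewrite mem_tr_space !memvf.
have proper' W : proper_rational row_isotropic L W ->
    proper_rational column_isotropic (tr_set L) (tr_space W).
  move=> [rW cW fW]; split; [exact: tr_rational | exact/tr_column_isotropic |].
  apply: contraNneq fW => h; rewrite -[W]tr_spaceK h; apply/eqP/vspaceP => A.
  by rewrite mem_tr_space !memvf.
move=> [pV mV]; split; first exact: proper.
move=> W /proper' pW VW; rewrite -[W]tr_spaceK; congr tr_space.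
by apply: mV => //; rewrite -tr_spaceS tr_spaceK.
Qed.

Lemma tr_proj_perp L V : proj_perp (tr_set L) V = tr_set (proj_perp L (tr_space V)).
Proof.
have tt (u w : 'M[R]_n) : \tr (u^T *m w) = \tr (u *m w^T).
  by rewrite -mxtrace_tr trmx_mul trmxK mxtrace_mulC.
apply/seteqP; split=> [w [wo [v Lv vw]]|w [wo [v Lv vw]]]; split.
- by move=> u; rewrite mem_tr_space trmxK => /wo; rewrite -tt trmxK.
- by exists v^T => //; rewrite -linearB mem_tr_space trmxK.
- by move=> u uV; have := wo u^T; rewrite mem_tr_space trmxK => /(_ uV); rewrite trmxK tt.
- exists v^T; first by rewrite /tr_set /= trmxK.
  by move: vw; rewrite mem_tr_space linearB /= trmxK.
Qed.

Lemma tr_noncoincidence L : row_noncoincidence L -> column_noncoincidence (tr_set L).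
Proof.
move=> h k hk [V1 [V2 [V12 m1 m2 [d1 d2] [g gu cg]]]]; apply: (h k hk).
exists (tr_space V1), (tr_space V2); split.
- by apply: contraNneq V12 => e; rewrite -[V1]tr_spaceK e tr_spaceK.
- exact: tr_maximal.
- exact: tr_maximal.
- by rewrite !dim_tr_space.
exists g^T; first by rewrite unitmx_tr.
have := commensurable_image (f := trmx) (@trmx_inj R n n) cg.
rewrite -!tr_set_image !tr_proj_perp tr_setK; congr (commensurable _ _).
apply/seteqP; split=> [v [w Lw wv]|_ [w Lw <-]].
  by exists w^T => //; rewrite -trmx_mul wv trmxK.
by exists w^T; rewrite /tr_set /= ?trmxK // trmx_mul trmxK.
Qed.

Lemma tr_Qsplit L : Qsplit_type (tr_set L) -> Qsplit_type L.
Proof.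
move=> [g1 [g2 [g1u g2u cg]]]; exists g2^T, g1^T; split; rewrite ?unitmx_tr //.
have := commensurable_image (f := trmx) (@trmx_inj R n n) cg.
rewrite -!tr_set_image tr_setK; congr (commensurable _ _).
apply/seteqP; split=> [v [z _ zv]|_ [z _ <-]].
  exists z^T => //; rewrite -[v]trmxK -zv !trmx_mul map_trmx mulmxA //.
by exists z^T => //; rewrite !trmx_mul !trmxK -map_trmx mulmxA.
Qed.

Lemma SO_norm_is_norm (N : 'M[R]_n -> R) : SO_invariant_norm N -> is_norm N.
Proof. by case=> h1 h2 h3 _ _; split. Qed.

Lemma is_norm_tr (N : 'M[R]_n -> R) : is_norm N -> is_norm (N \o trmx).
Proof. by move=> hN; apply: (is_norm_comp (f := trmx)) => //; apply: trmx_inj. Qed.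

End Transpose.

(** * Column and row subspaces together, and singular sublattices *)

Section Isotropic.
Context {R : realType} {n : nat} (n2 : (2 <= n)%N).
Context {L : set 'M[R]_n} (b : 'I_(n * n) -> 'M[R]_n).
Context (dL : discrete_subgroup L) (hb : indep b) (Lb : Zbasis L b).
Context (N : 'M[R]_n -> R) (hN : is_norm N).

Definition isotropic_hyper (V : {vspace 'M[R]_n}) : Prop :=
  [/\ Defs.rational L V, column_isotropic V \/ row_isotropic V & \dim V = (n * (n - 1))%N].

(** The column case for the transposed lattice, counted with the norm [N \o trmx]. *)
Lemma row_thin : ~ Qsplit_type L -> row_noncoincidence L ->
  thin (L := L) N isotropic_hyper
    (fun v => exists V, [/\ Defs.rational L V, row_isotropic V & v \in V]).
Proof.
move=> nsplit nrow e e0; have dtL := tr_discrete dL; have Ltb := tr_Zbasis Lb.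
have [[tL0 _] tLiso] := dtL; have htb := discrete_Zbasis_indep tL0 tLiso Ltb.
have [F [FG [T0 T00 hT]]] := column_thin n2 dtL htb Ltb (is_norm_tr hN)
  (fun q => nsplit (tr_Qsplit q)) (tr_noncoincidence nrow) e0.
exists [seq tr_space V | V <- F]; split.
  move=> _ /mapP[V /FG[rV cV dV] ->]; split; last by rewrite dim_tr_space.
    by rewrite -[L]tr_setK; apply: tr_rational.
  by right; apply/tr_column_isotropic; rewrite tr_spaceK.
exists T0 => // T /hT; apply: le_trans; rewrite ler_nat.
apply: (nb_inj (finite_uncovered htb Ltb (is_norm_tr hN) _ _ _)).
  by move=> x y _ _; apply: trmx_inj.
move=> v [Lv vT [V [rV rowV vV]] vF]; split.
- by rewrite /tr_set /= trmxK.
- by rewrite /= trmxK.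
- exists (tr_space V); split; [exact: tr_rational | exact/tr_column_isotropic |].
  by rewrite mem_tr_space trmxK.
move=> W WF; have := vF (tr_space W); rewrite mem_tr_space; apply.
by apply/mapP; exists W.
Qed.

Lemma isotropic_thin : ~ Qsplit_type L -> isotropic_noncoincidence L ->
  thin (L := L) N isotropic_hyper (Lambda_iso L).
Proof.
move=> nsplit [ncol nrow].
have h V : hyper (L := L) V -> isotropic_hyper V by move=> [rV cV dV]; split=> //; left.
have tc := thin_weaken h (column_thin n2 dL hb Lb hN nsplit ncol).
apply: (thin_sub hb Lb hN _ (thin_or hb Lb hN tc (row_thin nsplit nrow))).
by move=> v Lv [V [rV [cV|cV] _ vV]]; [left | right]; exists V.
Qed.

Lemma isotropic_det0 (V : {vspace 'M[R]_n}) A : column_isotropic V \/ row_isotropic V -> A \in V -> \det A = 0.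
Proof.
have col (W : {vspace 'M[R]_n}) B : column_isotropic W -> B \in W -> \det B = 0.
  move=> /column_isotropicP[p -> /andP[rp _]]; rewrite mem_annih => /eqP pB.
  apply/eqP; apply: contraTT rp => dB.
  have Bu : B \in unitmx by rewrite unitmxE unitfE.
  by rewrite -leqNgt leqn0 mxrank_eq0 -[p](mulmxK Bu) pB mul0mx.
move=> [cV|rV] AV; first exact: col cV AV.
rewrite -det_tr; apply: (col (tr_space V)); last by rewrite mem_tr_space trmxK.
exact/tr_column_isotropic.
Qed.

Lemma singular_sublattice L' : is_subgroup L' -> L' `<=` L -> Zrank L' (n * (n - 1)) ->
  (forall v, L' v -> \det v = 0) -> exists V, isotropic_hyper V.
Proof.
move=> sL' L'L [c cZ] detL'.
have L'iso : L' `<=` isolated L'.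
  move=> x L'x; have [_ [U Ux UL]] := dL.2 _ (L'L _ L'x); split; first by rewrite inE.
  exists U => //; apply/seteqP; split=> [y [Uy L'y]|_ ->].
    by rewrite -UL; split=> //; apply: L'L.
  by split=> //; have [? _] : (U `&` L) x by rewrite UL.
have ci := discrete_Zbasis_indep sL'.1 L'iso cZ.
pose V : {vspace 'M[R]_n} := <<[tuple c i | i < n * (n - 1)]>>%VS.
have cV i : c i \in V by apply: memv_span; apply/mapP; exists i => //; rewrite mem_enum.
have cs A : A \in V -> exists x : 'I_(n * (n - 1)) -> R, A = \sum_i x i *: c i.
  move=> AV; exists (fun i => coord [tuple c i | i < n * (n - 1)] i A).
  rewrite {1}(coord_span AV); apply: eq_bigr => i _.
  by rewrite (nth_map i) ?size_enum_ord // nth_ord_enum.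
have rV : Defs.rational L V.
  apply/(rational_spaceP dL hb Lb); apply: (rational_span hb Lb) cV cs => i.
  exact/L'L/(Zbasis_mem i cZ).
have dV : \dim V = (n * (n - 1))%N.
  by have /eqP := free_indep ci; rewrite size_tuple.
have detV A : A \in V -> \det A = 0.
  move=> /cs[x ->]; apply: det_real_span => z; apply: detL'.
  by apply/cZ.1; exists z.
(* The annihilator of a nonzero row has dimension [n (n - 1)], so inclusion is equality. *)
have full (W : {vspace 'M[R]_n}) (p : 'rV[R]_n) : p != 0 -> \dim W = (n * (n - 1))%N ->
    (forall A, A \in W -> p *m A = 0) -> W = annih p.
  move=> p0 dW pW; apply/eqP; rewrite eqEdim dim_annih; apply/andP; split.
    by apply/subvP => A AW; rewrite mem_annih pW.
  have -> : \rank p = 1%N by apply/eqP; rewrite eqn_leq rank_leq_row lt0n mxrank_eq0.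
  by rewrite dW mulnC.
have [[p p0 pV]|[v v0 Vv]] := singular_space_dim (ltnW n2) detV dV.
  have VE := full _ _ p0 dV pV.
  exists V; rewrite VE; rewrite VE in rV.
  have [? ? ?] := annih_row_hyper n2 p0 rV; split=> //; by left.
exists V; split=> //; right; apply/tr_column_isotropic.
have tE : tr_space V = annih v^T.
  apply: full; rewrite ?trmx_eq0 ?dim_tr_space // => A.
  by rewrite mem_tr_space => /Vv h; apply: trmx_inj; rewrite trmx_mul trmxK h trmx0.
have := tr_rational rV; rewrite tE => /(annih_row_hyper n2)[] //.
by rewrite trmx_eq0.
Qed.

End Isotropic.

Theorem theorem3p14 (R : realType) (n : nat) (hn : (2 <= n)%N)
    (N : 'M[R]_n -> R) (hN : SO_invariant_norm N)
    (L : set 'M[R]_n) (hL : lattice L) (hdioph : diophantine L)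
    (hsplit : ~ Qsplit_type L) (hiso : isotropic_noncoincidence L) :
  exists c : R,
    [/\ 0 <= c,
        (T ^- (n * (n - 1)) * (count_iso N L T)%:R) @[T --> +oo] --> c &
        0 < c <-> exists L' : set 'M[R]_n,
          [/\ is_subgroup L', L' `<=` L, Zrank L' (n * (n - 1)) &
              forall v, L' v -> \det v = 0]].
Proof.
have [dL [b Lb]] := hL; have hb := discrete_Zbasis_indep dL.1.1 dL.2 Lb.
have nN := SO_norm_is_norm hN.
have [||c [c0 hc cpos]] := thin_limit dL hb Lb nN (G := isotropic_hyper (L := L)) _ _
  (isotropic_thin hn dL hb Lb nN hsplit hiso).
- by move=> V [].
- by move=> V v [rV iV dV] Lv vV; exists V.
exists c; split=> //.
  have -> // : (fun T : R => T ^- (n * (n - 1)) * (count_iso N L T)%:R) =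
    (fun T => T ^- (n * (n - 1)) * (nb (ball_of (L := L) N (Lambda_iso L) T))%:R).
  apply/funext => T; congr (_ * (nb _)%:R).
  apply/seteqP; split=> [v [[V [rV iV Lv vV]] vT]|v [Lv vT [V [rV iV _ vV]]]].
    by split=> //; exists V.
  by split=> //; exists V.
rewrite cpos; split=> [[V [rV iV dV]]|[L' [sL' L'L rL' dL']]].
  exists (L `&` [set` V]); split.
  - by case: rV.1.
  - by move=> v [].
  - by rewrite -dV; case: rV.
  - by move=> v [_ vV]; apply: isotropic_det0 iV vV.
exact: (singular_sublattice hn dL hb Lb sL' L'L rL' dL').
Qed.
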